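(* Let $K$ be a compact Hausdorff space, let $X$ be a Banach $C(K)$-module (with $C(K)=Z(X)$), let $T: X\to X$ be a compact disjointness preserving (linear) operator, and let $\lambda\in\sigma(T)\setminus\{0\}$. Then there are an atom $F\in X'$ and a $p\in\mathbb{N}$ such that $(T')^pF=\lambda^pF$ and the elements $F,T'F,\ldots,(T')^{p-1}F$ are pairwise disjoint atoms.
   Context: Scalars are complex; $C(K)$ is the algebra of continuous complex-valued functions on a compact Hausdorff space $K$, and Banach lattices are complex Banach lattices (complexifications of real ones). $L(X)$ is the space of bounded linear operators on a Banach space $X$, $X'$ is the Banach dual, $T'$ is the adjoint of $T$, $\sigma(T)$ is the spectrum of $T$, and $\mathbb{N}=\{1,2,\ldots\}$. A Banach space $X$ is a Banach $C(K)$-module if there is an isometry $m: C(K)\to L(X)$ (an isometric unital algebra homomorphism); one writes $fx=m(f)x$ and identifies $C(K)$ with its image in $L(X)$. The center $Z(X)$ of $X$ is the closure of $C(K)$ in $L(X)$ in the strong operator topology. Standing assumption: $C(K)=Z(X)$ for the modules considered. The dual $X'$ of a Banach $C(K)$-module carries the adjoint action $f'F=F\circ m(f)$ and is regarded as a Banach module over its center $Z(X')$. For $x\in X$ the cyclic subspace is $X(x)=\mathrm{cl}_X\{fx: f\in C(K)\}$; it is a Banach lattice with positive cone $X(x)_+=\mathrm{cl}_X\{fx: f\in C(K), f\ge 0\}$. An element $x\in X$ is an atom if $X(x)$ is one-dimensional. Two elements $x_1,x_2$ of a Banach $C(K)$-module $X$ are disjoint if $x_1,x_2\in X(x_1+x_2)$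 and $x_1,x_2$ are disjoint elements of the Banach lattice $X(x_1+x_2)$, i.e. $|x_1|\wedge|x_2|=0$ there. A linear operator $T:X\to X$ is disjointness preserving if $Tx_1$ and $Tx_2$ are disjoint whenever $x_1$ and $x_2$ are disjoint. *)

(* Defs.v *)
From HB Require Import structures.
From mathcomp Require Import all_boot all_order all_algebra.
From mathcomp Require Import complex.
From mathcomp Require Import all_classical all_reals all_analysis.

Set Implicit Arguments.
Unset Strict Implicit.
Unset Printing Implicit Defensive.

Import Order.TTheory GRing.Theory Num.Theory.
Import numFieldNormedType.Exports.

Local Open Scope classical_set_scope.
Local Open Scope ring_scope.
Local Open Scope complex_scope.

Section BoundedOperators.
Context {R : realType}.
Local Notation C := R[i].

(* Norms of complex normed spaces take their values in R[i]; [rnorm] is the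
   same norm with values in R, so that suprema are available. *)
Definition rnorm {V : normedModType C} (x : V) : R := complex.Re `|x|.

Lemma rnormE (V : normedModType C) (x : V) : `|x| = (rnorm x)%:C.
Proof. by rewrite /rnorm RRe_real// normr_real. Qed.

Lemma rnorm_ge0 (V : normedModType C) (x : V) : 0 <= rnorm x.
Proof. by rewrite -ler0c -rnormE normr_ge0. Qed.

Lemma rnormD (V : normedModType C) (x y : V) :
  rnorm (x + y) <= rnorm x + rnorm y.
Proof. by rewrite -lecR rmorphD/= -!rnormE ler_normD. Qed.

Lemma rnorm0 (V : normedModType C) : rnorm (0 : V) = 0.
Proof. by rewrite /rnorm normr0. Qed.

Lemma rnorm_eq0 (V : normedModType C) (x : V) : (rnorm x == 0) = (x == 0).
Proof. by rewrite -(inj_eq (@complexI R)) -rnormE normr_eq0. Qed.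

Lemma rnorm_gt0 (V : normedModType C) (x : V) : (0 < rnorm x) = (x != 0).
Proof. by rewrite lt_def rnorm_ge0 andbT rnorm_eq0. Qed.

Lemma rnormZ (V : normedModType C) (a : C) (x : V) :
  rnorm (a *: x) = rnorm (a : C^o) * rnorm x.
Proof. by apply: complexI; rewrite rmorphM/= -!rnormE normrZ. Qed.

Lemma rnormZr (V : normedModType C) (r : R) (x : V) :
  0 <= r -> rnorm (r%:C *: x) = r * rnorm x.
Proof.
by move=> r0; apply: complexI; rewrite rmorphM/= -!rnormE normrZ ger0_norm ?ler0c.
Qed.

Definition blin_pred (V W : normedModType C) : {pred V -> W} :=
  fun f => `[< linear f /\ continuous f >].
Arguments blin_pred : clear implicits.

Record blin (V W : normedModType C) := Blin {
  blin_val :> V -> W;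
  blin_valP : blin_val \in blin_pred V W }.

HB.instance Definition _ (V W : normedModType C) :=
  [isSub for @blin_val V W].
HB.instance Definition _ (V W : normedModType C) :=
  [Choice of blin V W by <:].

Lemma blinP (V W : normedModType C) (f : blin V W) : linear f /\ continuous f.
Proof. by apply/asboolP; exact: (blin_valP f). Qed.

Lemma blin_ext (V W : normedModType C) (f g : blin V W) : f =1 g -> f = g.
Proof. by move=> fg; apply: val_inj; apply/funext. Qed.

Definition mkblin (V W : normedModType C) (f : V -> W)
  (lf : linear f) (cf : continuous f) : blin V W :=
  @Blin V W f (asboolT (conj lf cf)).

Lemma blin_submod (V W : normedModType C) : submod_closed (blin_pred V W).
Proof.
split.
  apply/asboolP; split; first by move=> a x y /=; rewrite scaler0 addr0.
  by move=> x; exact: cst_continuous.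
move=> a f g /asboolP[lf cf] /asboolP[lg cg]; apply/asboolP; split.
  move=> b x y /=; rewrite !fctE lf lg !scalerDr !scalerA (mulrC a b).
  by rewrite -!addrA; congr (_ + _); rewrite addrCA.
move=> x; apply: (@continuousD _ _ _ (a *: f) g); last exact: cg.
by apply: (@continuousZr _ _ _ f a); exact: cf.
Qed.

HB.instance Definition _ (V W : normedModType C) :=
  GRing.isSubmodClosed.Build C (V -> W) (blin_pred V W) (@blin_submod V W).
HB.instance Definition _ (V W : normedModType C) :=
  [SubChoice_isSubLmodule of blin V W by <:].
HB.instance Definition _ (V W : normedModType C) (f : blin V W) :=
  GRing.isLinear.Build C V W *:%R (blin_val f) (proj1 (blinP f)).

Definition opnorm (V W : normedModType C) (f : V -> W) : R :=
  sup [set rnorm (f x) | x in [set x | rnorm x <= 1]].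

Lemma opnorm_has_sup (V W : normedModType C) (f : blin V W) :
  has_sup [set rnorm (f x) | x in [set x | rnorm x <= 1]].
Proof.
split; first by exists (rnorm (f 0)); exists 0 => //=; rewrite rnorm0.
have [_ cf] := blinP f.
have /linear_boundedP/pinfty_ex_gt0[M M0 fM] :=
  @continuous_linear_bounded _ _ _ 0 f (cf 0).
exists (complex.Re M) => _ [x /= x1 <-].
have M_real : M = (complex.Re M)%:C by rewrite RRe_real// gtr0_real.
rewrite -lecR -rnormE (le_trans (fM x))// -M_real.
by rewrite ler_piMr ?(ltW M0)// rnormE lecR.
Qed.

Lemma opnorm_le1 (V W : normedModType C) (f : blin V W) (x : V) :
  rnorm x <= 1 -> rnorm (f x) <= opnorm f.
Proof. by move=> x1; apply: sup_upper_bound (opnorm_has_sup f) _ _; exists x. Qed.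

Lemma opnorm_ge0 (V W : normedModType C) (f : blin V W) : 0 <= opnorm f.
Proof.
by apply: (le_trans (rnorm_ge0 (f 0))); apply: opnorm_le1; rewrite rnorm0.
Qed.

Lemma opnormP (V W : normedModType C) (f : blin V W) (x : V) :
  rnorm (f x) <= opnorm f * rnorm x.
Proof.
have [->|x0] := eqVneq x 0; first by rewrite linear0 !rnorm0 mulr0.
have nx0 : 0 < rnorm x by rewrite rnorm_gt0.
have := @opnorm_le1 _ _ f ((rnorm x)^-1%:C *: x).
have ix0 : 0 <= (rnorm x)^-1 by rewrite invr_ge0 ltW.
rewrite linearZ/= !rnormZr// mulVf ?gt_eqF// => /(_ (lexx _)).
by rewrite mulrC ler_pdivrMr.
Qed.

Lemma opnorm_le (V W : normedModType C) (f : blin V W) (M : R) :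
  (forall x, rnorm x <= 1 -> rnorm (f x) <= M) -> opnorm f <= M.
Proof.
move=> fM; apply: ge_sup; first by case: (opnorm_has_sup f).
by move=> _ [x x1 <-]; exact: fM.
Qed.

Definition blin_norm (V W : normedModType C) (f : blin V W) : C :=
  (opnorm f)%:C.

Lemma blin_normD (V W : normedModType C) (f g : blin V W) :
  blin_norm (f + g) <= blin_norm f + blin_norm g.
Proof.
rewrite /blin_norm -rmorphD lecR; apply: opnorm_le => x x1.
by rewrite (le_trans (rnormD _ _))// lerD// opnorm_le1.
Qed.

Lemma opnormZ_le (V W : normedModType C) (a : C) (f : blin V W) :
  opnorm (a *: f : blin V W) <= rnorm (a : C^o) * opnorm f.
Proof.
apply: opnorm_le => x x1; rewrite rnormZ.
by rewrite ler_wpM2l ?rnorm_ge0// opnorm_le1.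
Qed.

Lemma blin_norm_eq0 (V W : normedModType C) (f : blin V W) :
  blin_norm f = 0 -> f = 0.
Proof.
move=> /complexI f0; apply: blin_ext => x; apply/eqP.
rewrite -rnorm_eq0 eq_le rnorm_ge0 andbT.
by rewrite (le_trans (opnormP f x))// f0 mul0r.
Qed.

Lemma blin_normZ (V W : normedModType C) (a : C) (f : blin V W) :
  blin_norm (a *: f) = `|a| * blin_norm f.
Proof.
have -> : `|a| = (rnorm (a : C^o))%:C by rewrite -rnormE.
rewrite /blin_norm -rmorphM; congr _%:C; apply/eqP; rewrite eq_le opnormZ_le andTb.
have [->|a0] := eqVneq a 0; first by rewrite rnorm0 mul0r; exact: opnorm_ge0.
have na0 : 0 < rnorm (a : C^o) by rewrite rnorm_gt0.
rewrite mulrC -ler_pdivlMr//; apply: opnorm_le => x x1; rewrite ler_pdivlMr// mulrC.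
by rewrite -rnormZ; exact: (@opnorm_le1 _ _ (a *: f : blin V W)).
Qed.

HB.instance Definition _ (V W : normedModType C) :=
  Lmodule_isNormed.Build C (blin V W)
    (@blin_normD V W) (@blin_normZ V W) (@blin_norm_eq0 V W).

Lemma blin_normE (V W : normedModType C) (f : blin V W) : `|f| = (opnorm f)%:C.
Proof. by []. Qed.

Lemma id_linear (V : normedModType C) : linear (@id V).
Proof. by []. Qed.

Definition blin_id (V : normedModType C) : blin V V :=
  mkblin (@id_linear V) (fun x => @cvg_id _ (nbhs x)).

Lemma comp_linear (U V W : normedModType C) (g : blin V W) (f : blin U V) :
  linear (g \o f).
Proof. by move=> a x y /=; rewrite !linearP. Qed.

Lemma comp_continuous (U V W : normedModType C) (g : blin V W) (f : blin U V) :
  continuous (g \o f).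
Proof.
have [_ cf] := blinP f; have [_ cg] := blinP g.
by move=> x; apply: continuous_comp; [exact: cf|exact: cg].
Qed.

Definition blin_comp (U V W : normedModType C) (g : blin V W) (f : blin U V) :
  blin U W := mkblin (@comp_linear U V W g f) (@comp_continuous U V W g f).

Lemma opnorm_comp (U V W : normedModType C) (g : blin V W) (f : blin U V) :
  opnorm (blin_comp g f) <= opnorm g * opnorm f.
Proof.
apply: opnorm_le => x x1; rewrite (le_trans (opnormP g (f x)))//.
by rewrite ler_wpM2l ?opnorm_ge0// opnorm_le1.
Qed.

Definition dual (X : normedModType C) : normedModType C := blin X C^o.

Definition precomp (X : normedModType C) (T : blin X X) (F : dual X) : dual X :=
  blin_comp F T.

Lemma precomp_linear (X : normedModType C) (T : blin X X) : linear (precomp T).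
Proof. by move=> a F G; exact: blin_ext. Qed.

Lemma precomp_continuous (X : normedModType C) (T : blin X X) :
  continuous (precomp T).
Proof.
pose P : {linear dual X -> dual X} := HB.pack (precomp T)
  (GRing.isLinear.Build C (dual X) (dual X) *:%R (precomp T)
     (@precomp_linear X T)).
apply: (@bounded_linear_continuous _ _ _ P); apply/bounded_funP => r.
exists (r * (opnorm T)%:C) => F Fr.
rewrite (@le_trans _ _ (`|F| * (opnorm T)%:C))//; last first.
  by rewrite ler_wpM2r// ler0c opnorm_ge0.
by rewrite !blin_normE -rmorphM lecR; exact: opnorm_comp.
Qed.

Definition adjoint (X : normedModType C) (T : blin X X) :
  blin (dual X) (dual X) :=
  mkblin (@precomp_linear X T) (@precomp_continuous X T).

Definition compact_operator (X : normedModType C) (T : blin X X) : Prop :=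
  precompact (T @` [set x | `|x| <= 1]).

Definition spectrum (X : normedModType C) (T : blin X X) : set C :=
  [set l | ~ exists S : blin X X,
     blin_comp S (l *: blin_id X - T) = blin_id X /\
     blin_comp (l *: blin_id X - T) S = blin_id X].

(* Closure of a set of bounded operators in the strong operator topology, which
   is the topology of pointwise convergence. *)
Definition banach_center (X : normedModType C) (A : set (blin X X)) : set (blin X X) :=
  [set z | closure ([set blin_val a | a in A] : set {ptws X -> X}) (z : X -> X)].

End BoundedOperators.
Arguments blin {R} V W.
Arguments blin_id {R} V.

Section BanachModules.
Context {R : realType}.
Local Notation C := R[i].

(* An isometric unital algebra homomorphism from C(K) to L(X); the values of m
   outside the continuous functions are irrelevant. For empty K the sup norm is
   sup set0 = 0. *)
Record banach_module (K : topologicalType) (X : normedModType C)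
    (m : (K -> C^o) -> blin X X) : Prop := BanachModule {
  module_linear : forall (a : C) (f g : K -> C^o),
    continuous f -> continuous g ->
    m (fun t => a * f t + g t) = a *: m f + m g ;
  module_mul : forall f g : K -> C^o, continuous f -> continuous g ->
    m (fun t => f t * g t) = blin_comp (m f) (m g) ;
  module_one : m (fun=> 1) = blin_id X ;
  module_isometry : forall f : K -> C^o, continuous f ->
    opnorm (m f) = sup [set rnorm (f t) | t in [set: K]] }.

Definition module_algebra (K : topologicalType) (X : normedModType C)
    (m : (K -> C^o) -> blin X X) : set (blin X X) :=
  [set m f | f in [set f : K -> C^o | continuous f]].

Definition module_pos (K : topologicalType) (X : normedModType C)
    (m : (K -> C^o) -> blin X X) : set (blin X X) :=
  [set m f | f in [set f : K -> C^o | continuous f /\ forall t, 0 <= f t]].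

Record character (X : normedModType C) (A : set (blin X X))
    (chi : blin X X -> C) : Prop := Character {
  character_linear : forall (a : C) z w, A z -> A w ->
    chi (a *: z + w) = a * chi z + chi w ;
  character_mul : forall z w, A z -> A w ->
    chi (blin_comp z w) = chi z * chi w ;
  character_one : chi (blin_id X) = 1 }.

(* A commutative operator algebra A of the form C(K') is identified with C(K')
   by taking for K' the space of characters of A, z in A being the function
   chi |-> chi z on K'; these are the nonnegative functions in A. *)
Definition gelfand_pos (X : normedModType C) (A : set (blin X X)) :
    set (blin X X) :=
  [set z | A z /\ forall chi, character A chi -> 0 <= chi z].

(* In what follows the algebra C(K), seen inside L(X), is given by the set A of
   its elements and the set P of its nonnegative elements. *)
Definition cyclic (X : normedModType C) (A : set (blin X X)) (x : X) : set X :=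
  closure [set (f : blin X X) x | f in A].

Definition cyclic_pos (X : normedModType C) (P : set (blin X X)) (x : X) :
    set X :=
  closure [set (f : blin X X) x | f in P].

Definition module_atom (X : normedModType C) (A : set (blin X X)) (x : X) : Prop :=
  exists e : X, e != 0 /\ cyclic A x = [set c *: e | c in [set: C]].

Section ComplexLattice.
(* Q is the positive cone of a complex Banach lattice E contained in V: the
   real part of E is Q - Q, its order is x <= y iff y - x in Q, and E is the
   complexification (Q - Q) + i (Q - Q). *)
Context {V : normedModType C}.
Implicit Types (Q S : set V) (x y z m : V).

Definition cone_real Q : set V := [set x - y | x in Q & y in Q].

Definition cone_le Q x y : Prop := Q (y - x).

Definition cone_sup Q S m : Prop :=
  [/\ cone_real Q m,
      forall x, S x -> cone_le Q x m &
      forall n, cone_real Q n -> (forall x, S x -> cone_le Q x n) ->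
        cone_le Q m n].

Definition cone_inf Q S m : Prop :=
  [/\ cone_real Q m,
      forall x, S x -> cone_le Q m x &
      forall n, cone_real Q n -> (forall x, S x -> cone_le Q n x) ->
        cone_le Q n m].

(* |a + i b| = sup {cos t a + sin t b : t real} for real a and b. *)
Definition modulus Q z m : Prop :=
  exists a b, [/\ cone_real Q a, cone_real Q b, z = a + 'i%C *: b &
    cone_sup Q [set (cos t)%:C *: a + (sin t)%:C *: b | t in [set: R]] m].

Definition lattice_disjoint Q x y : Prop :=
  exists m n, [/\ modulus Q x m, modulus Q y n & cone_inf Q [set m; n] 0].

End ComplexLattice.

Definition disjoint_elts (X : normedModType C) (A P : set (blin X X))
    (x1 x2 : X) : Prop :=
  [/\ cyclic A (x1 + x2) x1, cyclic A (x1 + x2) x2 &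
      lattice_disjoint (cyclic_pos P (x1 + x2)) x1 x2].

Definition disjointness_preserving (X : normedModType C)
    (A P : set (blin X X)) (T : blin X X) : Prop :=
  forall x1 x2, disjoint_elts A P x1 x2 -> disjoint_elts A P (T x1) (T x2).

(* The center of X' for the adjoint action f' F = F \o m f. *)
Definition dual_center (K : topologicalType) (X : normedModType C)
    (m : (K -> C^o) -> blin X X) : set (blin (dual X) (dual X)) :=
  banach_center [set adjoint z | z in module_algebra m].

End BanachModules.

(* Main.v *)
From HB Require Import structures.
From mathcomp Require Import all_boot all_order all_algebra.
From mathcomp Require Import complex.
From mathcomp Require Import all_classical all_reals all_analysis.
From mathcomp Require Import ring lra zify.
Require Import Defs.

Set Implicit Arguments.
Unset Strict Implicit.
Unset Printing Implicit Defensive.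

Import Order.TTheory GRing.Theory Num.Theory.
Import numFieldNormedType.Exports.

Local Open Scope classical_set_scope.
Local Open Scope ring_scope.
Local Open Scope complex_scope.

(** For [t] in [K] let [q_t z] be the infimum of [|f z|] over [0 <= f <= 1] with
    [f t = 1]; the functionals dominated by a multiple of [q_t] are the atoms of
    the dual module sitting at [t]. Disjointness preservation forces [q_t o T] to
    depend on a single fibre: [q_t (T z) <= |T| q_s z] for some [s = phi t], so
    the adjoint of [T] maps atoms at [t] to atoms at [phi t].

    Since [T] is compact, [lambda] has an eigenvector [x]. If all [q_t x] vanished,
    [x] could be cut into disjoint pieces with small images, and a choice of signs
    would make [sum +-T x_i] small against finitely many functionals although its
    norm is [|T x|]; compactness then gives [T x = 0]. So [q_t x <> 0] for some
    [t]. Localizing [x] along the orbit of [t] under [phi] and using compactness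
    once more shows that the orbit is finite, so [t] may be taken periodic, with
    least period [p]. Finally the Riesz theory of [lambda^-p T^p] for the seminorm
    [q_t] turns the eigenvector [x] into an eigenfunctional dominated by [q_t]. *)

(** * Hahn-Banach for sublinear functionals *)

Section HahnBanach.
Context {R : realType} {V : lmodType R[i]}.
Implicit Types (p q : V -> R) (x y : V).

(** The centre of [X'] is only known as a strong closure, so its lattice structure is hard to reach
    directly. Domination by some [q_t] circumvents this: it makes a functional an eigenvector of
    every [f'], with eigenvalue [f t], and this one-dimensional behaviour passes to the closure. All
    estimates can then be made on [X] with seminorms.

    An eigenfunctional of [T'] need not be an atom, and cutting it down to a point does not commute
    with [T']. For this reason the eigenvector of [T] is used first, to find the right point [t].
    Periodicity is what makes [S = lambda^-p T^p] act on the fibre at [t], and [S] is compact for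
    [q_t] because a bump at [t] turns [q_t]-bounded vectors into norm-bounded ones without changing
    them modulo [q_t]. Since [x] is fixed by [S] and not [q_t]-null, [1 - S] cannot have dense
    range, and Hahn-Banach applied to the distance from this range gives the functional. No
    completeness of the fibre is established, so the Riesz theory works with cluster points and
    reads every equation up to [q]-null vectors. The least period is taken so that the points of the
    orbit, hence the atoms, are distinct. *)

Definition sublinear p :=
  (forall x y, p (x + y) <= p x + p y) /\
  (forall (r : R) x, 0 < r -> p (r%:C *: x) <= r * p x).

Lemma sublinear0 p : sublinear p -> p 0 = 0.
Proof.
move=> [_ pZ]; have := pZ 2 0; have := pZ (2^-1) 0.
by rewrite !scaler0 invr_gt0 ltr0n => /(_ isT) ? /(_ isT); lra.
Qed.

(** Using the one-sided bound for [r^-1] too gives equality. The definition asks for the inequality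
    alone because that is what an infimum inherits at once. *)
Lemma sublinearZ p (r : R) x : sublinear p -> 0 <= r ->
  p (r%:C *: x) = r * p x.
Proof.
move=> sp; rewrite le_eqVlt => /predU1P[<-|r0].
  by rewrite scale0r mul0r sublinear0.
apply/eqP; rewrite eq_le sp.2//= -ler_pdivlMl//.
have := sp.2 r^-1 (r%:C *: x); rewrite invr_gt0 => /(_ r0).
rewrite scalerA -rmorphM/= mulVf ?gt_eqF// scale1r; exact.
Qed.

Lemma sublinearN p x : sublinear p -> - p (- x) <= p x.
Proof.
move=> sp; rewrite -subr_ge0 opprK -(sublinear0 sp) -[X in p X <= _](subrr x).
exact: sp.1.
Qed.

(** Zorn for the reversed pointwise order. A nonempty chain is bounded by its pointwise infimum,
    finite because every minorant of [p] is at least [- p (- x)]; subadditivity survives since of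
    two members of the chain the smaller one serves both summands. *)
Lemma minimal_sublinear p : sublinear p ->
  exists q, [/\ sublinear q, forall x, q x <= p x &
    forall q', sublinear q' -> (forall x, q' x <= q x) -> q' = q].
Proof.
move=> sp.
pose Q := {q | sublinear q /\ forall x, q x <= p x}.
pose r (s t : Q) := `[< forall x, sval t x <= sval s x >].
have : exists t, forall s, r t s -> s = t.
  apply: Zorn => [t|s t u /asboolP st /asboolP tu|s t /asboolP st /asboolP ts|].
  - by apply/asboolP.
  - by apply/asboolP => x; exact: le_trans (tu x) (st x).
  - case: s t st ts => [s ps] [t pt] st ts; apply: eq_exist.
    by apply/funext => x; apply/eqP; rewrite eq_le st ts.
  move=> A tA; have [[s0 As0]|A0] := pselect (A !=set0); last first.
    exists (exist _ p (conj sp (fun=> lexx _))) => s As.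
    by exfalso; apply: A0; exists s.
  pose v x := [set sval s x | s in A].
  have v0 x : v x !=set0 by exists (sval s0 x); exists s0.
  have lbv x : has_lbound (v x).
    exists (- p (- x)) => _ [[s [ss sp']] As <-] /=.
    by rewrite (le_trans _ (sublinearN x ss))// lerN2.
  have infle s x : A s -> inf (v x) <= sval s x.
    by move=> As; apply: ge_inf => //; exists s.
  have sinf : sublinear (fun x => inf (v x)).
    split=> [x y|a x a0].
      rewrite -lerBlDr; apply: lb_le_inf => // _ [s As <-].
      rewrite lerBlDr -lerBlDl; apply: lb_le_inf => // _ [t At <-].
      rewrite lerBlDl; case: (tA s t As At) => /asboolP st.
        rewrite (le_trans (infle _ _ At))// (le_trans ((svalP t).1.1 _ _))//.
        by rewrite lerD2r.
      rewrite (le_trans (infle _ _ As))// (le_trans ((svalP s).1.1 _ _))//.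
      by rewrite lerD2l.
    rewrite -ler_pdivrMl//; apply: lb_le_inf => // _ [s As <-].
    rewrite ler_pdivrMl// (le_trans (infle _ _ As))//.
    exact: (svalP s).1.2.
  have infp x : inf (v x) <= p x.
    exact: le_trans (infle s0 _ As0) ((svalP s0).2 _).
  exists (exist _ (fun x => inf (v x)) (conj sinf infp)) => s As.
  by apply/asboolP => x; exact: infle.
move=> [[q [sq qp]] qmin]; exists q; split=> // q' sq' q'q.
have q'p x : q' x <= p x by exact: le_trans (q'q x) (qp x).
suff /(congr1 sval) : exist _ q' (conj sq' q'p) = exist _ q (conj sq qp) :> Q by [].
by apply: qmin; exact/asboolP.
Qed.

(* [shave q y] is a sublinear minorant of [q]; when [q] is minimal it equals [q],
   and this makes [q] additive. *)
Let shave q y x := inf [set q (x + t%:C *: y) - t * q y | t in [set t | 0 <= t]].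

Let shave_lb q y x : sublinear q ->
  has_lbound [set q (x + t%:C *: y) - t * q y | t in [set t | 0 <= t]].
Proof.
move=> sq; exists (- q (- x)) => _ [t /= t0 <-].
rewrite -(sublinearZ _ sq)// lerBrDl lerBlDr.
by rewrite (le_trans _ (sq.1 _ _))// addrAC subrr add0r.
Qed.

Let shave_ne q y x :
  [set q (x + t%:C *: y) - t * q y | t in [set t | 0 <= t]] !=set0.
Proof. by exists (q (x + 0%:C *: y) - 0 * q y); exists 0 => /=. Qed.

Let shave_le q y x t : sublinear q -> 0 <= t ->
  shave q y x <= q (x + t%:C *: y) - t * q y.
Proof. by move=> sq t0; apply: (ge_inf (shave_lb y x sq)); exists t. Qed.

Let shave_le_self q y x : sublinear q -> shave q y x <= q x.
Proof.
move=> sq; apply: le_trans (shave_le y x sq (lexx 0)) _.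
by rewrite scale0r addr0 mul0r subr0.
Qed.

Let shave_sublinear q y : sublinear q -> sublinear (shave q y).
Proof.
move=> sq; split=> [x z|a x a0].
  rewrite -lerBlDr; apply: lb_le_inf => // _ [s /= s0 <-].
  rewrite lerBlDr -lerBlDl; apply: lb_le_inf => // _ [t /= t0 <-].
  rewrite lerBlDl.
  apply: (le_trans (shave_le y (x + z) sq (addr_ge0 s0 t0))).
  have -> : x + z + (s + t)%:C *: y = (x + s%:C *: y) + (z + t%:C *: y).
    by rewrite rmorphD/= scalerDl addrACA.
  by have := sq.1 (x + s%:C *: y) (z + t%:C *: y); lra.
rewrite -ler_pdivrMl//; apply: lb_le_inf => // _ [t /= t0 <-].
rewrite ler_pdivrMl//.
have := shave_le y (a%:C *: x) sq (mulr_ge0 (ltW a0) t0).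
rewrite rmorphM/= -scalerA -scalerDr (sublinearZ _ sq (ltW a0)).
by rewrite mulrBr mulrA.
Qed.

(** Minimizing below [shave p x0] instead of [p] makes the functional norm [x0]: taking [t = 1] at
    [- x0] gives [q (- x0) <= - p x0]. *)
Theorem real_hahn_banach p x0 : sublinear p ->
  exists f : V -> R, [/\ forall x y, f (x + y) = f x + f y,
    forall (r : R) x, f (r%:C *: x) = r * f x,
    forall x, f x <= p x & f x0 = p x0].
Proof.
move=> sp; have [q [sq qp qmin]] := minimal_sublinear (shave_sublinear x0 sp).
have qle x : q x <= p x by exact: le_trans (qp x) (shave_le_self _ _ sp).
have qD x y : q (x + y) = q x + q y.
  apply/eqP; rewrite eq_le sq.1/=.
  have eq_q := qmin _ (shave_sublinear y sq) (fun x => shave_le_self y x sq).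
  have := shave_le y x sq ler01; rewrite eq_q scale1r; lra.
have qN x : q (- x) = - q x.
  by apply/eqP; rewrite -subr_eq0 opprK addrC -qD subrr sublinear0.
exists q; split=> // [r x|].
  have [r0|/ltW r0] := leP 0 r; first exact: sublinearZ.
  rewrite -[r in LHS]opprK rmorphN/= scaleNr qN sublinearZ ?oppr_ge0//.
  by rewrite mulNr opprK.
apply/eqP; rewrite eq_le qle/=.
have := qp (- x0); have := shave_le x0 (- x0) sp ler01.
by rewrite scale1r addNr (sublinear0 sp) qN; lra.
Qed.

End HahnBanach.

(** * Real-valued norms over the complex numbers *)

Local Notation nc z := (rnorm (z : _[i]^o)).

Section ComplexNumbers.
Context {R : realType}.
Implicit Types (z w : R[i]) (r : R).

Lemma ncM z w : nc (z * w) = nc z * nc w.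
Proof. exact: (rnormZ (V := R[i]^o)). Qed.

Lemma nc_real r : nc r%:C = `|r|.
Proof. by rewrite /rnorm normc_def/= expr0n/= addr0 sqrtr_sqr. Qed.

Lemma nc1 : nc (1 : R[i]) = 1.
Proof. by rewrite (_ : 1 = 1%:C)// nc_real normr1. Qed.

Lemma nc_Re z : `|complex.Re z| <= nc z.
Proof.
rewrite /rnorm normc_def/= -sqrtr_sqr ler_sqrt ?lerDl ?sqr_ge0//.
by rewrite addr_ge0 ?sqr_ge0.
Qed.

Lemma nc_Im z : `|complex.Im z| <= nc z.
Proof.
rewrite /rnorm normc_def/= -sqrtr_sqr ler_sqrt ?lerDr ?sqr_ge0//.
by rewrite addr_ge0 ?sqr_ge0.
Qed.

Lemma nc_sqr z : nc z ^+ 2 = complex.Re z ^+ 2 + complex.Im z ^+ 2.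
Proof.
by rewrite /rnorm normc_def/= sqr_sqrtr// addr_ge0 ?sqr_ge0.
Qed.

Lemma nc_ReIm z : nc z <= `|complex.Re z| + `|complex.Im z|.
Proof.
rewrite -ler_sqr ?nnegrE ?rnorm_ge0 ?addr_ge0// nc_sqr sqrrD.
rewrite -[complex.Re z ^+ 2]real_normK ?num_real// -[complex.Im z ^+ 2]real_normK ?num_real//.
by rewrite addrAC lerDl mulrn_wge0 ?mulr_ge0.
Qed.

Lemma nc_eq0 z : (nc z == 0) = (z == 0).
Proof. exact: (rnorm_eq0 (z : R[i]^o)). Qed.

Lemma ncV z : nc z^-1 = (nc z)^-1.
Proof.
have [->|z0] := eqVneq z 0; first by rewrite invr0 rnorm0 invr0.
apply: (mulfI (x := nc z)); first by rewrite nc_eq0.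
by rewrite -ncM !mulfV ?nc_eq0// nc1.
Qed.

Lemma ex_phase z : exists2 c : R[i], nc c = 1 & c * z = (nc z)%:C.
Proof.
have [->|z0] := eqVneq z 0.
  by exists 1; rewrite ?nc1// rnorm0 mulr0.
exists (z^-1 * (nc z)%:C).
  by rewrite ncM ncV nc_real ger0_norm ?rnorm_ge0// mulVf ?nc_eq0.
by rewrite mulrAC mulVf// mul1r.
Qed.

Lemma ge0_real z : 0 <= z -> z = (complex.Re z)%:C.
Proof. by move=> z0; rewrite RRe_real// ger0_real. Qed.

Lemma ge0_Re z : 0 <= z -> 0 <= complex.Re z.
Proof. by move=> z0; rewrite -ler0c -ge0_real. Qed.

End ComplexNumbers.

Section RealNorm.
Context {R : realType}.
Implicit Types V : normedModType R[i].

Lemma rnormN V (x : V) : rnorm (- x) = rnorm x.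
Proof. by rewrite /rnorm normrN. Qed.

Lemma rnormB V (x y : V) : rnorm (x - y) = rnorm (y - x).
Proof. by rewrite -opprB rnormN. Qed.

Lemma rnorm_triB V (x y z : V) : rnorm (x - z) <= rnorm (x - y) + rnorm (y - z).
Proof. by rewrite (le_trans _ (rnormD _ _))// addrA subrK. Qed.

Lemma ler_rnormB V (x y : V) : rnorm x <= rnorm (x - y) + rnorm y.
Proof. by rewrite (le_trans _ (rnormD _ _))// subrK. Qed.

Lemma gt0_realC (e : R[i]) : 0 < e -> exists2 r : R, 0 < r & e = r%:C.
Proof.
move=> e0; exists (complex.Re e); first by rewrite -ltcR -ge0_real ?ltW.
by rewrite -ge0_real ?ltW.
Qed.

Lemma rnorm_ball V (x y : V) (e : R) : ball x e%:C y <-> rnorm (x - y) < e.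
Proof. by rewrite -ball_normE /ball_/= rnormE ltcR. Qed.

Lemma cvg_rnormP V {T : Type} (F : set_system T) {FF : Filter F} (f : T -> V) (l : V) :
  f @ F --> l <-> forall e : R, 0 < e -> \forall t \near F, rnorm (l - f t) < e.
Proof.
split=> [/cvgrPdist_lt fl e e0|fl].
  have := fl e%:C; rewrite ltcR => /(_ e0); apply: filterS => t.
  by rewrite rnormE ltcR.
apply/cvgrPdist_lt => _ /gt0_realC[e e0 ->].
by apply: filterS (fl e e0) => t; rewrite rnormE ltcR.
Qed.

Lemma closure_rnormP V (A : set V) (x : V) :
  closure A x <-> forall e : R, 0 < e -> exists2 y, A y & rnorm (x - y) < e.
Proof.
split=> [clA e e0|clA B /nbhs_ballP[_ /gt0_realC[e e0 ->]] xB].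
  have : nbhs x (ball x e%:C) by apply: nbhsx_ballx; rewrite ltcR.
  by move=> /clA[y [Ay /rnorm_ball xy]]; exists y.
have [y Ay xy] := clA e e0; exists y; split=> //; apply: xB.
exact/rnorm_ball.
Qed.

End RealNorm.

Section Continuity.
Context {R : realType} {K : topologicalType}.

Lemma continuous_rnormP (V : normedModType R[i]) (f : K -> V) :
  continuous f <-> forall t (e : R), 0 < e -> \forall s \near t, rnorm (f t - f s) < e.
Proof.
by split=> cf t; [exact/cvg_rnormP/cf|apply/cvg_rnormP => e; exact: cf].
Qed.

Lemma continuous_real (f : K -> R) : continuous f ->
  continuous (fun t => (f t)%:C : R[i]^o).
Proof.
move=> cf; apply/continuous_rnormP => t e e0.
have /cvgrPdist_lt/(_ _ e0) := cf t; apply: filterS => s.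
by rewrite -rmorphB/= nc_real.
Qed.

Lemma continuous_lip (V : normedModType R[i]) (g : V -> R) (f : K -> V) :
  (forall x y, `|g x - g y| <= rnorm (x - y)) ->
  continuous f -> continuous (g \o f).
Proof.
move=> gl /continuous_rnormP cf t; apply/cvgrPdist_lt => e e0.
by apply: filterS (cf t e e0) => s; apply: le_lt_trans (gl _ _).
Qed.

Lemma continuous_Re (f : K -> R[i]^o) : continuous f ->
  continuous (fun t => complex.Re (f t)).
Proof.
apply: (@continuous_lip R[i]^o (@complex.Re R)) => x y.
by rewrite -raddfB nc_Re.
Qed.

Lemma continuous_Im (f : K -> R[i]^o) : continuous f ->
  continuous (fun t => complex.Im (f t)).
Proof.
apply: (@continuous_lip R[i]^o (@complex.Im R)) => x y.
by rewrite -raddfB nc_Im.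
Qed.

Lemma continuous_nc (f : K -> R[i]^o) : continuous f ->
  continuous (fun t => nc (f t)).
Proof.
apply: (@continuous_lip R[i]^o (@rnorm R R[i]^o)) => x y.
have := ler_rnormB x y; have := ler_rnormB y x; rewrite (rnormB y x) ler_norml.
by move=> xy yx; apply/andP; split; lra.
Qed.

End Continuity.

(** * Complex seminorms and the complex Hahn-Banach theorem *)

Section Seminorm.
Context {R : realType} {V : lmodType R[i]}.
Implicit Types (q : V -> R).

Definition seminorm q :=
  (forall x y, q (x + y) <= q x + q y) /\ (forall (a : R[i]) x, q (a *: x) = nc a * q x).

Lemma seminorm0 q : seminorm q -> q 0 = 0.
Proof. by case=> _ qZ; rewrite -(scale0r 0) qZ rnorm0 mul0r. Qed.

Lemma seminormN q x : seminorm q -> q (- x) = q x.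
Proof.
by case=> _ qZ; rewrite -scaleN1r qZ (rnormN (1 : R[i]^o)) nc1 mul1r.
Qed.

Lemma seminormB q x y : seminorm q -> q (x - y) = q (y - x).
Proof. by move=> sq; rewrite -seminormN// opprB. Qed.

Lemma seminorm_ge0 q x : seminorm q -> 0 <= q x.
Proof.
by move=> sq; have := sq.1 x (- x); rewrite subrr seminorm0// seminormN//; lra.
Qed.

Lemma seminorm_triB q x y z : seminorm q -> q (x - z) <= q (x - y) + q (y - z).
Proof. by move=> sq; rewrite (le_trans _ (sq.1 _ _))// addrA subrK. Qed.

Lemma seminorm_leB q x y : seminorm q -> q x <= q (x - y) + q y.
Proof. by move=> sq; rewrite (le_trans _ (sq.1 _ _))// subrK. Qed.

Lemma seminormZr q (r : R) x : seminorm q -> 0 <= r -> q (r%:C *: x) = r * q x.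
Proof. by move=> sq r0; rewrite sq.2 nc_real ger0_norm. Qed.

(** The complexification [f x - i f (i x)] of a real functional. Rotating [F x] onto the positive
    axis reduces its bound to that of [f]; at [x0] the real part already reaches [q x0], so the
    imaginary part vanishes. *)
Theorem complex_hahn_banach q x0 : seminorm q ->
  exists F : V -> R[i]^o, [/\ linear F, forall x, nc (F x) <= q x &
    F x0 = (q x0)%:C].
Proof.
move=> sq.
have [] := @real_hahn_banach R V q x0.
  by split=> [|r x r0]; [exact: sq.1|rewrite seminormZr// ltW].
move=> f [fD fZ fq fx0].
pose F x : R[i]^o := f x +i* (- f ('i *: x)).
have FD x y : F (x + y) = F x + F y.
  by apply/eqP; rewrite eq_complex/= scalerDr !fD opprD !eqxx.
have fN x : f (- x) = - f x.
  by rewrite -[- x]scaleN1r (_ : -1 = (-1)%:C :> R[i]) ?fZ ?mulN1r ?rmorphN1.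
have FZ a x : F (a *: x) = a * F x.
  have fa y : f (a *: y) = complex.Re a * f y + complex.Im a * f ('i *: y).
    by rewrite {1}[a]complexE scalerDl fD fZ (mulrC 'i%C) -scalerA fZ.
  apply/eqP; rewrite eq_complex/= scalerA (mulrC 'i%C) -scalerA !fa.
  have -> : f ('i *: ('i *: x)) = - f x.
    by rewrite scalerA -expr2 sqr_i scaleN1r fN.
  case: a {fa} => a b /=; apply/andP; split; apply/eqP; ring.
have Fq x : nc (F x) <= q x.
  have [c c1 cF] := ex_phase (F x).
  have : complex.Re (F (c *: x)) <= q (c *: x) by exact: fq.
  by rewrite FZ cF/= sq.2 c1 mul1r.
exists F; split=> // [a x y|]; first by rewrite FD FZ.
have := Fq x0; rewrite -ler_sqr ?nnegrE ?rnorm_ge0 ?seminorm_ge0// nc_sqr/= fx0.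
rewrite gerDl => fi; apply/eqP; rewrite eq_complex/= fx0 eqxx/=.
by rewrite -sqrf_eq0 eq_le fi sqr_ge0.
Qed.

End Seminorm.

Lemma seminorm_rnorm (R : realType) (V : normedModType R[i]) : seminorm (@rnorm R V).
Proof. by split=> [x y|a x]; [exact: rnormD|exact: rnormZ]. Qed.

(** * Riesz theory relative to a seminorm *)

Lemma le0_eps (R : realType) (x : R) : (forall e : R, 0 < e -> x <= e) -> x <= 0.
Proof.
move=> xe; rewrite leNgt; apply/negP => x0.
by have := xe (x / 2); rewrite divr_gt0// => /(_ isT); lra.
Qed.

Section Riesz.
Context {R : realType} {V : lmodType R[i]}.
Variables (q : V -> R) (S : {linear V -> V}) (c : R).
Hypothesis sq : seminorm q.
Hypothesis Sc : forall u, q (S u) <= c * q u.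
(** Compactness as a cluster point of the images. [V] is neither separated nor complete for [q], so
    equalities below hold only up to [q]-null vectors, and these cluster points replace limits. *)
Hypothesis Scompact : forall (u : nat -> V) (M : R), (forall n, q (u n) <= M) ->
  exists w, forall (e : R) N, 0 < e -> exists2 n, (N <= n)%N & q (w - S (u n)) < e.

Let A u := u - S u.

Let AD : {morph A : u v / u + v}.
Proof. by move=> u v; rewrite /A linearD opprD addrACA. Qed.

Let AZ a : {morph A : u / a *: u}.
Proof. by move=> u; rewrite /A linearZ scalerBr. Qed.

Let AN : {morph A : u / - u}.
Proof. by move=> u; rewrite -scaleN1r AZ scaleN1r. Qed.

Let AB : {morph A : u v / u - v}.
Proof. by move=> u v; rewrite AD AN. Qed.

Let A0 : A 0 = 0. Proof. by rewrite /A linear0 subrr. Qed.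

Let iA0 n : iter n A 0 = 0. Proof. by elim: n => [//|n IH] /=; rewrite IH A0. Qed.

Let iAD n : {morph iter n A : u v / u + v}.
Proof. by elim: n => // n IH u v /=; rewrite IH AD. Qed.

Let iAZ n a : {morph iter n A : u / a *: u}.
Proof. by elim: n => // n IH u /=; rewrite IH AZ. Qed.

Let iAB n : {morph iter n A : u v / u - v}.
Proof. by elim: n => // n IH u v /=; rewrite IH AB. Qed.

Let b : R := 1 + `|c|.

Let b_gt0 : 0 < b. Proof. by rewrite ltr_wpDr. Qed.

Let q_ge0 u : 0 <= q u := seminorm_ge0 u sq.

Let qA u : q (A u) <= b * q u.
Proof.
rewrite /A (le_trans (sq.1 _ _))// (seminormN _ sq) mulrDl mul1r lerD2l.
by rewrite (le_trans (Sc u))// ler_wpM2r// ler_norm.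
Qed.

Let qiA n u : q (iter n A u) <= b ^+ n * q u.
Proof.
elim: n => [|n IH] /=; first by rewrite mul1r.
by rewrite exprS -mulrA (le_trans (qA _))// ler_pM2l.
Qed.

Definition subspace (L : set V) :=
  [/\ L 0, forall u v, L u -> L v -> L (u + v) & forall a u, L u -> L (a *: u)].

(** Take [l0] within a factor 2 of the distance from [y] to [L] and rescale by the inverse distance.
    The explicit form [t (y - l0)] lets callers see in which larger subspace the vector lies. *)
Lemma riesz_lemma (L : set V) y (d : R) : subspace L -> 0 < d ->
  (forall l, L l -> d <= q (y - l)) ->
  exists (t : R) l0, [/\ 0 < t, L l0, q (t%:C *: (y - l0)) <= 2 &
    forall l, L l -> 1 <= q (t%:C *: (y - l0) - l)].
Proof.
move=> [L0 LD LZ] d0 dL; set D := [set q (y - l) | l in L].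
have hD : has_inf D.
  by split; [exists (q (y - 0)); exists 0|exists d => _ [l Ll <-]; exact: dL].
have D0 : 0 < inf D.
  by apply: (lt_le_trans d0); apply: lb_le_inf; [case: hD|move=> _ [l Ll <-]; exact: dL].
have [_ [l0 Ll0 <-] yl0] := inf_adherent D0 hD.
have t0 : 0 <= (inf D)^-1 by rewrite invr_ge0 ltW.
exists (inf D)^-1, l0; split => //; first by rewrite invr_gt0.
  by rewrite seminormZr// ler_pdivrMl//; lra.
move=> l Ll; have -> : (inf D)^-1%:C *: (y - l0) - l =
    (inf D)^-1%:C *: (y - (l0 + (inf D)%:C *: l)).
  rewrite opprD addrA [in RHS]scalerBr; congr (_ - _).
  by rewrite scalerA -rmorphM/= mulVf ?gt_eqF// scale1r.
rewrite seminormZr// ler_pdivlMl// mulr1.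
apply: ge_inf; first by case: hD.
by exists (l0 + (inf D)%:C *: l) => //; apply: LD => //; exact: LZ.
Qed.

(** Common engine for ascending kernels and descending ranges. Pick almost orthogonal unit-size
    [z n] in [M n] over [L n]. If [M j] lies in [L i], then [S (z i) - S (z j)] is [z i] minus an
    element of [L i], so the images are 1-separated, while two of them lie within 1/2 of a cluster
    point. *)
Lemma riesz_chain (L M : nat -> set V) (y : nat -> V) (d : nat -> R) :
  (forall n, subspace (L n)) -> (forall n, subspace (M n)) ->
  (forall n, L n `<=` M n) -> (forall n, M n (y n)) ->
  (forall n, 0 < d n) -> (forall n l, L n l -> d n <= q (y n - l)) ->
  (forall n u, M n u -> L n (A u)) ->
  (forall n m, (n < m)%N -> M n `<=` L m \/ M m `<=` L n) -> False.
Proof.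
move=> sL sM LM My d0 dL AM MLt.
have ML n m : n != m -> M n `<=` L m \/ M m `<=` L n.
  by rewrite neq_ltn => /orP[/MLt//|/MLt[]]; [right|left].
have ex_z n : exists z, [/\ M n z, q z <= 2 & forall l, L n l -> 1 <= q (z - l)].
  have [t [l0 [t0 Ll0 z2 zl]]] := riesz_lemma (sL n) (d0 n) (@dL n).
  exists (t%:C *: (y n - l0)); split=> //; have [_ MD MZ] := sM n.
  by apply: (MZ _ _); apply: MD => //; rewrite -[- l0]scaleN1r; apply: (MZ _ _); exact: LM.
have [z zP] := choice ex_z.
have [|w wz] := @Scompact z 2; first by move=> n; case: (zP n).
have h : 0 < 2^-1 :> R by rewrite invr_gt0 ltr0n.
have [n _ wn] := wz _ 0 h; have [m nm wm] := wz _ n.+1 h.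
have far i j : M j `<=` L i -> 1 <= q (S (z i) - S (z j)).
  move=> ji; have [Mi _ zi] := zP i; have [Mj _ _] := zP j.
  have [L0 LD LZ] := sL i.
  have -> : S (z i) - S (z j) = z i - (A (z i) + z j - A (z j)).
    by rewrite /A (opprB (z j)) addrACA subrr addr0 opprD addrA subKr.
  apply: zi; apply: (LD _ _); first by apply: (LD _ _); [exact: AM|exact: ji].
  by rewrite -scaleN1r; apply: LZ; have [_ LDj LZj] := sL j; apply: ji; apply: LM; exact: AM.
have : q (S (z n) - S (z m)) < 1.
  have := seminorm_triB (S (z n)) w (S (z m)) sq; rewrite (seminormB _ w)//.
  lra.
have nm' : n != m by rewrite ltn_eqF.
by case: (ML _ _ nm') => [/far|/far]; [rewrite (seminormB _ _ sq)|]; lra.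
Qed.

Let kerA n : set V := [set u | q (iter n A u) = 0].

Let kerA_subspace n : subspace (kerA n).
Proof.
rewrite /kerA; split=> [|u v u0 v0|a u u0] /=.
- by rewrite iA0 seminorm0.
- by apply/eqP; rewrite eq_le q_ge0 andbT iAD (le_trans (sq.1 _ _))// u0 v0 addr0.
- by rewrite iAZ sq.2 u0 mulr0.
Qed.

(** Otherwise there are bounded [v n] at distance at least 1 from the kernel with [A (v n)] tending
    to 0. As [v = A v + S v], a cluster point of [S (v n)] is one of [v n]; it lies in the kernel,
    which is absurd. *)
Lemma bounded_below_mod_kernel :
  exists2 C : R, 0 < C & forall u, exists2 k, q (A k) = 0 & q (u - k) <= C * q (A u).
Proof.
apply: contrapT => nC.
have ex_v n : exists v, [/\ q v <= 2, q (A v) <= 2 / n.+1%:R &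
    forall k, kerA 1 k -> 1 <= q (v - k)].
  have [u ku] : exists u, forall k, kerA 1 k -> n.+1%:R * q (A u) < q (u - k).
    apply: contrapT => nu; apply: nC; exists n.+1%:R; first by rewrite ltr0n.
    move=> u; apply: contrapT => nk; apply: nu; exists u => k k0.
    by rewrite ltNge; apply/negP => uk; apply: nk; exists k.
  have Au0 : 0 < n.+1%:R * q (A u).
    rewrite mulr_gt0 ?ltr0n// lt_def q_ge0 andbT; apply/eqP => Au0.
    by have := ku u Au0; rewrite subrr seminorm0// Au0 mulr0 ltxx.
  have [|t [l [t0 kl v2 vk]]] := riesz_lemma (y := u) (kerA_subspace 1) Au0.
    by move=> l /ku/ltW.
  exists (t%:C *: (u - l)); split=> //.
  rewrite ler_pdivlMr ?ltr0n// (le_trans _ v2)// AZ !seminormZr ?(ltW t0)//.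
  rewrite -mulrA ler_pM2l// mulrC (le_trans _ (ltW (ku _ kl)))// ler_pM2l ?ltr0n//.
  by rewrite AB (le_trans (sq.1 _ _))// (seminormN _ sq) (kl : q (A l) = 0) addr0.
have [v vP] := choice ex_v.
have [|w wv] := @Scompact v 2; first by move=> n; case: (vP n).
have near e : 0 < e -> exists2 n, q (A (v n)) < e & q (w - v n) < e.
  move=> e0; have e40 : 0 < e / 2 by rewrite divr_gt0.
  have [n nN wn] := wv _ (Num.truncn (2 / (e / 2))) e40.
  have Av : q (A (v n)) < e / 2.
    have [_ Avn _] := vP n; rewrite (le_lt_trans Avn)// ltr_pdivrMr ?ltr0n//.
    rewrite -ltr_pdivrMl// mulrC (lt_le_trans (truncnS_gt _))//.
    by rewrite ler_nat ltnS.
  exists n; first by rewrite (lt_trans Av)// ltr_pdivrMr// ltr_pMr// ltr1n.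
  rewrite (le_lt_trans (seminorm_triB _ (S (v n)) _ sq))// (seminormB (S _) _ sq).
  by rewrite -/(A (v n)); lra.
have Aw : q (A w) = 0.
  apply/eqP; rewrite eq_le q_ge0 andbT; apply: le0_eps => e e0.
  have [|n An wn] := near (e / (1 + b)).
    by rewrite divr_gt0// addr_gt0.
  rewrite (le_trans (seminorm_leB _ (A (v n)) sq))// -AB.
  rewrite (le_trans (lerD (qA _) (lexx _)))//.
  have : (1 + b) * (e / (1 + b)) = e by rewrite mulrC divfK// gt_eqF// addr_gt0.
  have : b * q (w - v n) <= b * (e / (1 + b)) by rewrite ler_pM2l// ltW.
  rewrite mulrDl mul1r; lra.
have [n _ wn] := near 1 ltr01.
by have [_ _ /(_ _ Aw)] := vP n; rewrite (seminormB _ _ sq); lra.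
Qed.

(** Subtracting kernel vectors keeps the approximate preimages bounded, so their images under [S]
    cluster. *)
Lemma range_closed v :
  (forall e : R, 0 < e -> exists u, q (A u - v) < e) -> exists u, q (A u - v) = 0.
Proof.
move=> uv; have [C C0 kC] := bounded_below_mod_kernel.
have ex_u n : exists u, q (A u - v) < n.+1%:R^-1 /\ q u <= C * (q v + 1).
  have [|u uvn] := uv n.+1%:R^-1; first by rewrite invr_gt0 ltr0n.
  have [k k0 uk] := kC u; exists (u - k); split.
    rewrite (le_lt_trans _ uvn)// AB addrAC (le_trans (sq.1 _ _))//.
    by rewrite (seminormN _ sq) k0 addr0.
  rewrite (le_trans uk)// ler_pM2l// (le_trans (seminorm_leB _ v sq))//.
  rewrite addrC lerD2l (le_trans (ltW uvn))// invf_le1 ?ltr0n//.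
  by rewrite ler1n.
have [u uP] := choice ex_u.
have [|w wu] := @Scompact u (C * (q v + 1)); first by move=> n; case: (uP n).
(* From [u n = A (u n) + S (u n)] with [A (u n)] near [v] and [S (u n)] near [w]. *)
exists (v + w); apply/eqP; rewrite eq_le q_ge0 andbT; apply: le0_eps => e e0.
(* One error [d] is counted directly, two more pass through [A] and cost a factor [b] each. *)
pose d := e / (1 + b + b).
have b3 : 0 < 1 + b + b by have := b_gt0; lra.
have d0 : 0 < d by rewrite divr_gt0.
have [n nN wn] := wu _ (Num.truncn d^-1) d0.
have un : q (A (u n) - v) < d.
  have [un _] := uP n; rewrite (lt_le_trans un)// invf_ple ?posrE ?ltr0n//.
  by rewrite (le_trans (ltW (truncnS_gt _)))// ler_nat ltnS.
have -> : A (v + w) - v = A ((v - A (u n)) + (w - S (u n))) + (A (u n) - v).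
  have -> : v - A (u n) + (w - S (u n)) = v + w - u n.
    by rewrite /A opprB addrACA [S _ - _ - _]addrAC subrr sub0r.
  by rewrite AB addrA subrK.
rewrite (le_trans (sq.1 _ _))//.
have := qA (v - A (u n) + (w - S (u n))); have := sq.1 (v - A (u n)) (w - S (u n)).
rewrite (seminormB v _ sq) => h1 h2.
have : b * q (v - A (u n) + (w - S (u n))) <= b * (d + d).
  by rewrite ler_pM2l//; lra.
have : d * (1 + b + b) = e by rewrite /d divfK// gt_eqF.
by lra.
Qed.

(** Dense range is full range modulo [q]. Iterated preimages [y n] of a kernel vector [x] lie in the
    kernel of [A^(n+1)] and, because [A^n (y n)] is [x], at distance at least [q x / b^n] from the
    kernel of [A^n]; the kernels then grow forever. *)
Lemma dense_range_injective :
  (forall v (e : R), 0 < e -> exists u, q (A u - v) < e) ->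
  forall x, q (A x) = 0 -> q x = 0.
Proof.
move=> dense x Ax; apply/eqP; rewrite eq_le q_ge0 andbT leNgt; apply/negP => x0.
have [f fP] := choice (fun v => range_closed (dense v)).
have qeq u v : q (u - v) = 0 -> q u = q v.
  move=> uv; apply/eqP; rewrite eq_le.
  have := seminorm_leB u v sq; have := seminorm_leB v u sq.
  by rewrite (seminormB v) ?uv// => *; apply/andP; split; lra.
pose y n := iter n f x.
have Ay n : q (iter n A (y n) - x) = 0.
  elim: n => [|n IH]; first by rewrite subrr seminorm0.
  rewrite iterSr/=; apply/eqP; rewrite eq_le q_ge0 andbT.
  rewrite (le_trans (seminorm_triB _ (iter n A (y n)) _ sq))// IH addr0 -iAB.
  by rewrite (le_trans (qiA _ _))// fP mulr0.
apply: (@riesz_chain kerA (fun n => kerA n.+1) y (fun n => q x / b ^+ n)) => //.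
- by move=> n u /= u0; apply/eqP; rewrite /kerA/= eq_le q_ge0 andbT (le_trans (qA _))// u0 mulr0.
- move=> n; rewrite /kerA/=; apply/eqP; rewrite eq_le q_ge0 andbT.
  rewrite (le_trans (seminorm_leB _ (A x) sq))// Ax addr0 -AB.
  by rewrite (le_trans (qA _))// Ay mulr0.
- by move=> n; rewrite divr_gt0// exprn_gt0.
- move=> n l l0; rewrite ler_pdivrMr ?exprn_gt0// mulrC.
  rewrite (le_trans _ (qiA _ _))// iAB.
  rewrite -(qeq _ _ (Ay n)) (le_trans (seminorm_leB _ (iter n A l) sq))//.
  by rewrite (l0 : q _ = 0) addr0.
- by move=> n u; rewrite /kerA/= -iterSr.
move=> n m nm; left => u; rewrite /kerA/= => u0.
apply/eqP; rewrite eq_le q_ge0 andbT -(subnK nm) iterD.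
by rewrite (le_trans (qiA _ _))//= u0 mulr0.
Qed.

(** A vector [v] at distance [e] from the range gives [A^n v] at distance at least [e / C^n] from
    the range of [A^(n+1)], so the ranges shrink forever. *)
Lemma injective_dense_range C : 0 < C -> (forall u, q u <= C * q (A u)) ->
  forall v (e : R), 0 < e -> exists u, q (A u - v) < e.
Proof.
move=> C0 qC v e e0; apply: contrapT => nu.
have far u : e <= q (v - A u).
  by rewrite (seminormB _ _ sq) leNgt; apply/negP => ue; apply: nu; exists u.
have qiC n u : q u <= C ^+ n * q (iter n A u).
  elim: n => [|n IH]; first by rewrite mul1r.
  by rewrite (le_trans IH)// exprSr -mulrA ler_pM2l ?exprn_gt0.
pose L n := range (iter n A).
have sL n : subspace (L n).
  split=> [|_ _ [u _ <-] [w _ <-]|a _ [u _ <-]].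
  - by exists 0.
  - by exists (u + w); rewrite ?iAD.
  - by exists (a *: u); rewrite ?iAZ.
have LS n m : (n <= m)%N -> L m `<=` L n.
  by move=> nm _ [u _ <-]; exists (iter (m - n) A u) => //; rewrite -iterD subnKC.
apply: (@riesz_chain (fun n => L n.+1) L (fun n => iter n A v)
  (fun n => e / C ^+ n)) => //.
- by move=> n; exact: LS.
- by move=> n; exists v.
- by move=> n; rewrite divr_gt0// exprn_gt0.
- move=> n _ [u _ <-]; rewrite ler_pdivrMr ?exprn_gt0// mulrC.
  by rewrite iterSr -iAB (le_trans _ (qiC n _)).
- by move=> n _ [u _ <-]; exists u.
by move=> n m nm; right; exact: LS.
Qed.

(** The fixed vector [x] forbids dense range. The distance to the range of [A] is then a nonzero
    seminorm below [q] that vanishes on this range, and a functional dominated by it satisfies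
    [F (S u) = F u]. *)
Theorem fixed_functional x : q x != 0 -> q (S x - x) = 0 ->
  exists F : V -> R[i]^o, [/\ linear F, forall u, nc (F u) <= q u,
    forall u, F (S u) = F u & exists u, F u != 0].
Proof.
move=> x0 Sx.
have [v [d d0 vd]] : exists v, exists2 d, 0 < d & forall u, d <= q (v - A u).
  apply: contrapT => nv; move/eqP: x0; apply.
  apply: dense_range_injective; last by rewrite /A (seminormB _ _ sq).
  move=> v e e0; apply: contrapT => nu; apply: nv; exists v, e => // u.
  by rewrite (seminormB _ _ sq) leNgt; apply/negP => ue; apply: nu; exists u.
pose D u := [set q (u - A z) | z in [set: V]].
have lbD u : has_lbound (D u) by exists 0 => _ [z _ <-].
have neD u : D u !=set0 by exists (q (u - A 0)); exists 0.
pose p u := inf (D u).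
have ple u z : p u <= q (u - A z) by apply: ge_inf => //; exists z.
have pZ a u : a != 0 -> p (a *: u) <= nc a * p u.
  move=> a0; have na0 : 0 < nc a by rewrite rnorm_gt0.
  rewrite -ler_pdivrMl//; apply: lb_le_inf => // _ [z _ <-].
  by rewrite ler_pdivrMl// (le_trans (ple _ (a *: z)))// AZ -scalerBr sq.2.
have p_ge0 u : 0 <= p u by apply: lb_le_inf => // _ [z _ <-].
have sp : seminorm p.
  split=> [u w|a u].
    rewrite -lerBlDr; apply: lb_le_inf => // _ [z _ <-].
    rewrite lerBlDr -lerBlDl; apply: lb_le_inf => // _ [z' _ <-].
    rewrite lerBlDl (le_trans (ple _ (z + z')))// AD opprD addrACA.
    exact: sq.1.
  have [->|a0] := eqVneq a 0.
    rewrite scale0r rnorm0 mul0r; apply/eqP; rewrite eq_le p_ge0 andbT.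
    by rewrite (le_trans (ple _ 0))// A0 subrr seminorm0.
  apply/eqP; rewrite eq_le pZ//=.
  have := pZ a^-1 (a *: u); rewrite invr_eq0 => /(_ a0).
  by rewrite scalerA mulVf// scale1r ncV ler_pdivlMl// rnorm_gt0.
have [F [lF Fp Fv]] := complex_hahn_banach v sp.
have pq u : p u <= q u by rewrite (le_trans (ple _ 0))// A0 subr0.
pose G : {linear V -> R[i]^o} := HB.pack F (GRing.isLinear.Build _ _ _ _ F lF).
exists F; split => //.
- by move=> u; rewrite (le_trans (Fp u)).
- move=> u; apply/esym/eqP; rewrite -subr_eq0 -[F u - _](raddfB G).
  rewrite -nc_eq0 eq_le rnorm_ge0 andbT (le_trans (Fp _))//.
  by rewrite (le_trans (ple _ u))// subrr seminorm0.
- exists v; rewrite Fv (inj_eq (@complexI R)) gt_eqF// (lt_le_trans d0)//.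
  by apply: lb_le_inf => // _ [z _ <-].
Qed.

End Riesz.

(** * Compact operators *)

(** The near-covering form of compactness, applied to the filter of properties of lists that hold
    for all lists containing some fixed one. *)
Lemma compact_finite (K : topologicalType) (A : set K) (I : Type) (U : I -> set K) :
  compact A -> (forall x, A x -> exists i, nbhs x (U i)) ->
  exists l : list I, forall x, A x -> exists2 i, List.In i l & U i x.
Proof.
move=> /compact_near_coveringP cA AU.
pose F : set_system (list I) := [set P | exists l0, forall l,
  (forall i, List.In i l0 -> List.In i l) -> P l].
have FF : Filter F.
  split=> [|P Q [l0 Pl0] [l1 Ql1]|P Q PQ [l0 Pl0]].
  - by exists nil.
  - exists (l0 ++ l1) => l ll; split.
      by apply: Pl0 => i il; apply: ll; apply/List.in_or_app; left.
    by apply: Ql1 => i il; apply: ll; apply/List.in_or_app; right.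
  - by exists l0 => l /Pl0/PQ.
have [|l0 cov] := cA _ F (fun l x => exists2 i, List.In i l & U i x) FF.
  move=> x /AU[i Ui].
  exists (U i, [set l | List.In i l]) => /=; last first.
    by case=> y l [/= Uiy il]; exists i.
  by split=> //; exists [:: i] => l; apply; left.
by exists l0; apply: cov.
Qed.

Section CompactOperators.
Context {R : realType} {X : normedModType R[i]}.
Variable T : blin X X.
Hypothesis compactT : compact_operator T.

Lemma rnorm_le1 (x : X) : (`|x| <= 1) = (rnorm x <= 1).
Proof. by rewrite rnormE -(lecR _ 1). Qed.

(** The scale [|M| + 1] is positive for every real [M], so no sign condition on the bound is
    needed. *)
Let scale_ball (M : R) (x : X) : rnorm x <= M ->
  T x = (`|M| + 1)%:C *: T ((`|M| + 1)^-1%:C *: x) /\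
  (T @` [set x | `|x| <= 1]) (T ((`|M| + 1)^-1%:C *: x)).
Proof.
move=> xM; have M0 : 0 < `|M| + 1 by rewrite ltr_wpDl.
split; first by rewrite linearZ scalerA -rmorphM/= divff ?gt_eqF// scale1r.
exists ((`|M| + 1)^-1%:C *: x) => //=.
rewrite rnorm_le1 rnormZr ?invr_ge0 ?(ltW M0)// ler_pdivrMl// mulr1.
by rewrite (le_trans xM)// (le_trans (ler_norm _))// lerDl.
Qed.

Lemma compact_operator_cluster (u : nat -> X) (M : R) :
  (forall n, rnorm (u n) <= M) ->
  exists w, forall (e : R) N, 0 < e -> exists2 n, (N <= n)%N & rnorm (w - T (u n)) < e.
Proof.
move=> uM; have M0 : 0 < `|M| + 1 by rewrite ltr_wpDl.
pose v n := T ((`|M| + 1)^-1%:C *: u n).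
have := compactT; rewrite /compact_operator precompactE.
move=> /(_ (v @ \oo) _) [|w [_ wv]].
  by exists 0%N => // n _ /=; apply: subset_closure; case: (scale_ball (uM n)).
exists ((`|M| + 1)%:C *: w) => e N e0.
have e1 : 0 < e / (`|M| + 1) by rewrite divr_gt0.
have [||_ [[n Nn <-] /rnorm_ball wvn]] := wv [set v n | n in [set n | (N <= n)%N]]
    (ball w (e / (`|M| + 1))%:C).
- by exists N => // n Nn; exists n.
- by apply: nbhsx_ballx; rewrite ltcR.
exists n => //; have [-> _] := scale_ball (uM n).
by rewrite -scalerBr rnormZr ?(ltW M0)// mulrC -ltr_pdivlMr.
Qed.

Lemma compact_operator_net (M e : R) : 0 < e -> exists l : list X,
  forall x, rnorm x <= M -> exists2 y, List.In y l & rnorm (T x - y) < e.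
Proof.
move=> e0; have M0 : 0 < `|M| + 1 by rewrite ltr_wpDl.
have := compactT; rewrite /compact_operator precompactE => cT.
have e1 : 0 < e / (`|M| + 1) by rewrite divr_gt0.
have [|l lP] := @compact_finite _ _ X (fun y => ball y (e / (`|M| + 1))%:C) cT.
  by move=> x _; exists x; apply: nbhsx_ballx; rewrite ltcR.
exists (List.map (fun y => (`|M| + 1)%:C *: y) l) => x xM.
have [-> Tx] := scale_ball xM.
have [y yl /rnorm_ball yx] := lP _ (subset_closure Tx).
exists ((`|M| + 1)%:C *: y); first exact: List.in_map.
by rewrite -scalerBr rnormZr ?(ltW M0)// rnormB mulrC -ltr_pdivlMr.
Qed.

End CompactOperators.

Section Eigenvector.
Context {R : realType} {X : completeNormedModType R[i]}.

Lemma bounded_blin (V W : normedModType R[i]) (S : V -> W) (C : R) : linear S ->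
  (forall x, rnorm (S x) <= C * rnorm x) -> exists f : blin V W, f =1 S.
Proof.
move=> lS SC.
pose P : {linear V -> W} := HB.pack S (GRing.isLinear.Build _ _ _ _ S lS).
have cS : continuous S.
  apply: (@bounded_linear_continuous _ _ _ P); apply/bounded_funP => r.
  exists (`|C| * complex.Re `|r|)%:C => x xr.
  rewrite rnormE lecR (le_trans (SC x))//.
  rewrite (le_trans (ler_wpM2r (rnorm_ge0 _) (ler_norm C)))// ler_wpM2l//.
  rewrite -lecR -rnormE (le_trans xr)// RRe_real ?normr_real//.
  by rewrite real_ler_norm// ger0_real// (le_trans _ xr).
by exists (mkblin lS cS).
Qed.

(** Fredholm alternative: without eigenvectors [1 - l^-1 T] is bounded below, so its range is dense
    and closed, and the lower bound [C] makes the inverse continuous. *)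
Lemma spectrum_eigenvector (T : blin X X) (l : R[i]) : compact_operator T ->
  spectrum T l -> l != 0 -> exists2 x : X, x != 0 & T x = l *: x.
Proof.
move=> cT sT l0; apply: contrapT => nx; apply: sT.
have Sl : linear (fun x : X => l^-1 *: T x).
  by move=> a x y; rewrite linearP scalerDr !scalerA mulrC.
pose S : {linear X -> X} := HB.pack (fun x : X => l^-1 *: T x)
  (GRing.isLinear.Build _ _ _ _ (fun x : X => l^-1 *: T x) Sl).
have sn := @seminorm_rnorm R X.
have Sc u : rnorm (S u) <= nc l^-1 * opnorm T * rnorm u.
  by rewrite rnormZ -mulrA ler_wpM2l ?rnorm_ge0// opnormP.
have Scp (u : nat -> X) (M : R) : (forall n, rnorm (u n) <= M) ->
    exists w, forall (e : R) N, 0 < e -> exists2 n, (N <= n)%N & rnorm (w - S (u n)) < e.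
  move=> uM; have [w wu] := compact_operator_cluster cT uM.
  have l1 : 0 < nc l^-1 by rewrite rnorm_gt0 invr_eq0.
  exists (l^-1 *: w) => e N e0.
  have [|n Nn wn] := wu (e / nc l^-1) N; first by rewrite divr_gt0.
  by exists n => //; rewrite -scalerBr rnormZ mulrC -ltr_pdivlMr.
have kerS k : rnorm (k - S k) = 0 -> k = 0.
  move/eqP; rewrite rnorm_eq0 subr_eq0 => /eqP kS; apply: contrapT => /eqP k0.
  by apply: nx; exists k => //; rewrite {2}kS scalerA mulfV// scale1r.
have [C C0 kC] := bounded_below_mod_kernel sn Sc Scp.
have qC u : rnorm u <= C * rnorm (u - S u).
  by have [k /kerS ->] := kC u; rewrite subr0.
have surj v : exists u, u - S u = v.
  have [u uv] := range_closed sn Sc Scp (injective_dense_range sn Scp C0 qC v).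
  by exists u; apply/eqP; rewrite -subr_eq0 -rnorm_eq0 uv.
have [f fP] := choice surj.
have inj u v : u - S u = v - S v -> u = v.
  move=> uv; apply/eqP; rewrite -subr_eq0; apply/eqP; apply: kerS.
  have -> : u - v - S (u - v) = (u - S u) - (v - S v).
    by rewrite linearB !opprB !addrA addrAC (addrAC u) [RHS]addrAC.
  by rewrite uv subrr rnorm0.
have lf : linear f.
  move=> a u v; apply: inj; rewrite fP linearP opprD addrACA -scalerBr.
  by rewrite !fP.
have [g gf] : exists g : blin X X, g =1 f.
  by apply: (bounded_blin (C := C) lf) => x; rewrite (le_trans (qC _))// fP.
have lS u : l *: u - T u = l *: (u - S u).
  by rewrite scalerBr scalerA mulfV// scale1r.
exists (l^-1 *: g); split; apply: blin_ext => u /=.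
  have fZ a x : f (a *: x) = a *: f x.
    by have := lf a x 0; rewrite addr0 (_ : f 0 = 0) ?addr0//;
       apply: inj; rewrite fP linear0 subrr.
  rewrite -[LHS]/(l^-1 *: g (l *: u - T u)) gf lS.
  rewrite (_ : f _ = l *: u) ?scalerA ?mulVf// ?scale1r//.
  by rewrite fZ; congr (_ *: _); apply: inj; rewrite fP.
rewrite -[LHS]/(l *: (l^-1 *: g u) - T (l^-1 *: g u)) gf lS.
have -> : S (l^-1 *: f u) = l^-1 *: S (f u) by rewrite linearZ.
rewrite -scalerBr fP.
by rewrite scalerA mulfV// scale1r.
Qed.

End Eigenvector.

(** * The action of continuous functions *)

Section ContinuousFunctions.
Context {K : topologicalType}.

Lemma cfD {F : numFieldType} {V : normedModType F} (f g : K -> V) :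
  continuous f -> continuous g -> continuous (fun t => f t + g t).
Proof. by move=> cf cg t; apply: cvgD; [exact: cf|exact: cg]. Qed.

Lemma cfB {F : numFieldType} {V : normedModType F} (f g : K -> V) :
  continuous f -> continuous g -> continuous (fun t => f t - g t).
Proof. by move=> cf cg t; apply: cvgB; [exact: cf|exact: cg]. Qed.

Lemma cfN {F : numFieldType} {V : normedModType F} (f : K -> V) :
  continuous f -> continuous (fun t => - f t).
Proof. by move=> cf t; apply: cvgN; exact: cf. Qed.

Lemma cfM {F : numFieldType} (f g : K -> F^o) :
  continuous f -> continuous g -> continuous (fun t => f t * g t : F^o).
Proof. by move=> cf cg t; apply: cvgM; [exact: cf|exact: cg]. Qed.

Lemma cfV {F : numFieldType} (f : K -> F^o) :
  (forall t, f t != 0) -> continuous f -> continuous (fun t => (f t)^-1 : F^o).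
Proof. by move=> f0 cf t; apply: cvgV; [exact: f0|exact: cf]. Qed.

Context {R : realType}.

Lemma cfmin (f g : K -> R) :
  continuous f -> continuous g -> continuous (fun t => Num.min (f t) (g t)).
Proof. by move=> cf cg t; apply: continuous_min; [exact: cf|exact: cg]. Qed.

Lemma cfmax (f g : K -> R) :
  continuous f -> continuous g -> continuous (fun t => Num.max (f t) (g t)).
Proof. by move=> cf cg t; apply: continuous_max; [exact: cf|exact: cg]. Qed.

Lemma cfnorm (f : K -> R) : continuous f -> continuous (fun t => `|f t|).
Proof. by move=> cf t; apply: cvg_norm; exact: cf. Qed.

Lemma cfconj (f : K -> R[i]^o) : continuous f ->
  continuous (fun t => (f t)^* : R[i]^o)%C.
Proof.
move=> /continuous_rnormP cf; apply/continuous_rnormP => t e e0.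
apply: filterS (cf t e e0) => s.
by rewrite -rmorphB/= /rnorm normcJ.
Qed.

Lemma cfDC (f g : K -> R[i]^o) :
  continuous f -> continuous g -> continuous (fun t => f t + g t).
Proof. exact: cfD. Qed.

Lemma cfBC (f g : K -> R[i]^o) :
  continuous f -> continuous g -> continuous (fun t => f t - g t).
Proof. exact: cfB. Qed.

Lemma cfMC (f g : K -> R[i]^o) :
  continuous f -> continuous g -> continuous (fun t => f t * g t : R[i]^o).
Proof. exact: cfM. Qed.

End ContinuousFunctions.

(* Goals are matched syntactically: unification against hypotheses or against
   the wrong closure lemma unfolds the complex numbers and does not return. *)
Ltac cont := lazymatch goal with
  | H : continuous ?h |- continuous ?h => exact H
  | H : continuous ?h |- continuous (fun t => ?h t) => exact H
  | |- continuous (fun t => @?a t + - @?b t) =>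
      first [refine (@cfB _ _ _ a b _ _) | refine (@cfBC _ _ a b _ _)]; cont
  | |- continuous (fun t => @?a t + @?b t) =>
      first [refine (@cfD _ _ _ a b _ _) | refine (@cfDC _ _ a b _ _)]; cont
  | |- continuous (fun t => - @?a t) =>
      first [by move=> ?; exact: cst_continuous | refine (@cfN _ _ _ a _); cont]
  | |- continuous (fun t => @?a t * @?b t) =>
      first [refine (@cfM _ _ a b _ _) | refine (@cfMC _ _ a b _ _)]; cont
  | |- continuous (fun t => Num.min (@?a t) (@?b t)) => refine (@cfmin _ _ a b _ _); cont
  | |- continuous (fun t => Num.max (@?a t) (@?b t)) => refine (@cfmax _ _ a b _ _); cont
  | |- continuous (fun t => `|@?a t|) => refine (@cfnorm _ _ a _); cont
  | |- continuous (fun t => @?a t ^+ 2) => refine (@cfM _ _ a a _ _); cont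
  | |- continuous (fun t => (@?a t)%:C) => refine (@continuous_real _ _ a _); cont
  | |- continuous (fun t => complex.Re (@?a t)) => refine (@continuous_Re _ _ a _); cont
  | |- continuous (fun t => complex.Im (@?a t)) => refine (@continuous_Im _ _ a _); cont
  | |- continuous (fun t => rnorm (@?a t)) => refine (@continuous_nc _ _ a _); cont
  | |- continuous (fun t => ?c) => move=> ?; exact: cst_continuous
  end.

Lemma blinDE (R : realType) (V W : normedModType R[i]) (f g : blin V W) x :
  (f + g) x = f x + g x.
Proof. by []. Qed.

Lemma blinZE (R : realType) (V W : normedModType R[i]) (a : R[i]) (f : blin V W) x :
  (a *: f) x = a *: f x.
Proof. by []. Qed.

Section BlinLinear.
Context {R : realType} {V W : normedModType R[i]}.
Implicit Type f : blin V W.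

Lemma blinD f x y : f (x + y) = f x + f y. Proof. exact: linearD. Qed.
Lemma blinB f x y : f (x - y) = f x - f y. Proof. exact: linearB. Qed.
Lemma blinN f x : f (- x) = - f x. Proof. exact: linearN. Qed.
Lemma blinZ f a x : f (a *: x) = a *: f x. Proof. exact: linearZ. Qed.
Lemma blin0 f : f 0 = 0. Proof. exact: linear0. Qed.

End BlinLinear.

Section Module.
Context {R : realType} {K : topologicalType} {X : completeNormedModType R[i]}.
Variable m : (K -> R[i]^o) -> blin X X.
Hypothesis hm : banach_module m.
Implicit Types (f g : K -> R[i]^o) (p r : K -> R) (x w : X).

Lemma actD f g x : continuous f -> continuous g ->
  m (fun t => f t + g t) x = m f x + m g x.
Proof.
move=> cf cg; have -> : (fun t => f t + g t) = (fun t => 1 * f t + g t : R[i]^o).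
  by apply/funext => t; rewrite mul1r.
by rewrite (module_linear hm _ cf cg) blinDE blinZE scale1r.
Qed.

Lemma act0 x : m (fun=> 0) x = 0.
Proof.
have -> : (fun=> 0) = (fun t : K => -1 * 0 + 0 : R[i]^o).
  by apply/funext => t; rewrite mulr0 addr0.
by rewrite (module_linear hm); [rewrite scaleN1r addNr|cont..].
Qed.

Lemma actZ (a : R[i]) f x : continuous f -> m (fun t => a * f t) x = a *: m f x.
Proof.
move=> cf; have -> : (fun t => a * f t) = (fun t : K => a * f t + 0 : R[i]^o).
  by apply/funext => t; rewrite addr0.
rewrite (module_linear hm); [|cont..].
by rewrite blinDE blinZE act0 addr0.
Qed.

Lemma actB f g x : continuous f -> continuous g ->
  m (fun t => f t - g t) x = m f x - m g x.
Proof.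
move=> cf cg; have -> : (fun t => f t - g t) = (fun t => f t + -1 * g t : R[i]^o).
  by apply/funext => t; rewrite mulN1r.
rewrite actD; [|cont..]; rewrite actZ; [|cont]; by rewrite scaleN1r.
Qed.

Lemma actM f g x : continuous f -> continuous g ->
  m (fun t => f t * g t) x = m f (m g x).
Proof. by move=> cf cg; rewrite (module_mul hm cf cg). Qed.

Lemma act1 x : m (fun=> 1) x = x. Proof. by rewrite (module_one hm). Qed.

Lemma act_le f (c : R) x : continuous f -> 0 <= c -> (forall t, nc (f t) <= c) ->
  rnorm (m f x) <= c * rnorm x.
Proof.
move=> cf c0 fc; rewrite (le_trans (opnormP _ _))// ler_wpM2r ?rnorm_ge0//.
rewrite (module_isometry hm cf).
have [[t _]|K0] := pselect ([set: K] !=set0).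
  by apply: ge_sup; [exists (nc (f t)); exists t|move=> _ [s _ <-]].
(* For empty [K] the supremum is [sup set0 = 0], and [0 <= c] suffices. *)
rewrite (_ : [set _ | _ in _] = set0) ?sup0//.
by rewrite -subset0 => y [t]; case: K0; exists t.
Qed.

(* [f] is the uniform limit of [h g] with [h = f g^* / (|g|^2 + d^2)], |h| <= 1. *)
Lemma act_mono f g w : continuous f -> continuous g ->
  (forall t, nc (f t) <= nc (g t)) -> rnorm (m f w) <= rnorm (m g w).
Proof.
move=> cf cg fg; rewrite -subr_le0; apply: le0_eps => e e0.
pose d := e / (rnorm w + 1).
have w1 : 0 < rnorm w + 1 by rewrite ltr_wpDl ?rnorm_ge0.
have d0 : 0 < d by rewrite divr_gt0.
pose D t : R := nc (g t) ^+ 2 + d ^+ 2.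
have D0 t : 0 < D t by rewrite ltr_wpDl ?sqr_ge0 ?exprn_gt0.
pose h t : R[i]^o := (f t * (g t)^*%C) * ((D t)^-1)%:C.
have ch : continuous h.
  have cJ := cfconj cg; have cD : continuous D by rewrite /D; cont.
  have cDV : continuous (fun t => (D t)^-1).
    by apply: (@cfV _ R) => // t; rewrite gt_eqF.
  by rewrite /h; cont.
have ncJ z : nc (z^*%C) = nc z by rewrite /rnorm normcJ.
have nch t : nc (h t) = nc (f t) * nc (g t) / D t.
  by rewrite /h !ncM ncJ nc_real ger0_norm// invr_ge0 ltW.
have h1 t : nc (h t) <= 1.
  rewrite nch ler_pdivrMr// mul1r /D.
  rewrite (le_trans (ler_wpM2r (rnorm_ge0 _) (fg t)))// -expr2 lerDl.
  by rewrite sqr_ge0.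
have hgf t : nc (f t - h t * g t) <= d.
  have -> : f t - h t * g t = f t * (d ^+ 2 / D t)%:C.
    have -> : h t * g t = f t * (nc (g t) ^+ 2 / D t)%:C.
      by rewrite /h rmorphM/= rmorphXn/= -(rnormE (g t)) (sqr_normc (g t)); ring.
    rewrite -[X in X - _]mulr1 -mulrBr -(rmorph1 (real_complex R)) -rmorphB/=.
    congr (_ * _%:C); rewrite -[X in X - _](@divff _ (D t)) ?gt_eqF//.
    by rewrite -mulrBl /D addrAC subrr add0r.
  rewrite ncM nc_real ger0_norm ?divr_ge0 ?sqr_ge0 ?(ltW (D0 t))//.
  rewrite mulrA ler_pdivrMr// (le_trans (ler_wpM2r (sqr_ge0 _) (fg t)))//.
  (* This is [d |g| <= |g|^2 + d^2], multiplied by [d]. *)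
  have : 0 <= d * (nc (g t) ^+ 2 - nc (g t) * d + d ^+ 2).
    apply: mulr_ge0; first exact: ltW.
    by have := sqr_ge0 (nc (g t) - d / 2); have := sqr_ge0 d; lra.
  by rewrite /D; lra.
have -> : m f w = m (fun t => f t - h t * g t) w + m (fun t => h t * g t) w.
  rewrite -actD; [|cont..].
  by congr (m _ w); apply/funext => t; rewrite subrK.
rewrite lerBlDr (le_trans (rnormD _ _))// lerD//.
  rewrite (@le_trans _ _ (d * rnorm w))//.
    by apply: act_le; [cont|exact: ltW|exact: hgf].
  by rewrite /d mulrAC ler_pdivrMr// ler_pM2l// lerDl.
by rewrite (actM _ ch cg) (le_trans (act_le _ ch ler01 h1))// mul1r.
Qed.

(** The sum [g1 + g2] could cancel; replacing both by their moduli first makes [act_mono] applicable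
    to the sum. *)
Lemma act_le_add f g1 g2 w : continuous f -> continuous g1 -> continuous g2 ->
  (forall t, nc (f t) <= nc (g1 t) + nc (g2 t)) ->
  rnorm (m f w) <= rnorm (m g1 w) + rnorm (m g2 w).
Proof.
move=> cf cg1 cg2 fg.
pose a1 t : R[i]^o := (nc (g1 t))%:C; pose a2 t : R[i]^o := (nc (g2 t))%:C.
have ca1 : continuous a1 by rewrite /a1; cont.
have ca2 : continuous a2 by rewrite /a2; cont.
apply: (@le_trans _ _ (rnorm (m (fun t => a1 t + a2 t) w))).
  apply: act_mono; [exact: cf|cont|].
  by move=> t; rewrite /a1 /a2 -rmorphD/= nc_real ger0_norm ?addr_ge0 ?rnorm_ge0.
rewrite (actD _ ca1 ca2) (le_trans (rnormD _ _))// lerD//.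
  by apply: (act_mono _ ca1 cg1) => t; rewrite nc_real ger0_norm ?rnorm_ge0.
by apply: (act_mono _ ca2 cg2) => t; rewrite nc_real ger0_norm ?rnorm_ge0.
Qed.

Definition real_act p : blin X X := m (fun t => (p t)%:C).

Lemma real_actD p r x : continuous p -> continuous r ->
  real_act (fun t => p t + r t) x = real_act p x + real_act r x.
Proof.
move=> cp cr; rewrite /real_act -actD; [|cont..].
by congr (m _ x); apply/funext => t; rewrite rmorphD.
Qed.

Lemma real_actB p r x : continuous p -> continuous r ->
  real_act (fun t => p t - r t) x = real_act p x - real_act r x.
Proof.
move=> cp cr; rewrite /real_act -actB; [|cont..].
by congr (m _ x); apply/funext => t; rewrite rmorphB.
Qed.

Lemma real_actM p r x : continuous p -> continuous r ->
  real_act (fun t => p t * r t) x = real_act p (real_act r x).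
Proof.
move=> cp cr; rewrite /real_act -actM; [|cont..].
by congr (m _ x); apply/funext => t; rewrite rmorphM.
Qed.

Lemma real_actZ (a : R) p x : continuous p -> real_act (fun t => a * p t) x = a%:C *: real_act p x.
Proof.
move=> cp; rewrite /real_act -actZ; [|cont].
by congr (m _ x); apply/funext => t; rewrite rmorphM.
Qed.

Lemma real_act1 x : real_act (fun=> 1) x = x. Proof. exact: act1. Qed.

Lemma real_act0 x : real_act (fun=> 0) x = 0. Proof. exact: act0. Qed.

Lemma real_act_le1 p x : continuous p -> (forall t, 0 <= p t <= 1) ->
  rnorm (real_act p x) <= rnorm x.
Proof.
move=> cp p01; rewrite -[leRHS]mul1r; apply: act_le; [cont|exact: ler01|].
by move=> t; have /andP[p0 p1] := p01 t; rewrite nc_real ger0_norm.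
Qed.

Lemma real_act_mono p r w : continuous p -> continuous r ->
  (forall t, `|p t| <= `|r t|) -> rnorm (real_act p w) <= rnorm (real_act r w).
Proof. by move=> cp cr pr; apply: act_mono; [cont..|move=> t; rewrite !nc_real; exact: pr]. Qed.

Lemma real_act_le_add p r1 r2 w : continuous p -> continuous r1 -> continuous r2 ->
  (forall t, `|p t| <= `|r1 t| + `|r2 t|) ->
  rnorm (real_act p w) <= rnorm (real_act r1 w) + rnorm (real_act r2 w).
Proof. by move=> cp c1 c2 pr; apply: act_le_add; [cont..|move=> t; rewrite !nc_real; exact: pr]. Qed.

End Module.

(** * Disjointness in cyclic subspaces *)

Lemma rnorm_eq0_eps (R : realType) (V : normedModType R[i]) (x : V) :
  (forall e : R, 0 < e -> rnorm x <= e) -> x = 0.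
Proof.
move=> xe; apply/eqP; rewrite -rnorm_eq0 eq_le rnorm_ge0 andbT.
exact: le0_eps.
Qed.

Lemma complete_seq (R : realType) (V : completeNormedModType R[i]) (u : nat -> V) (C : R) :
  (forall k j, rnorm (u k - u j) <= C / k.+1%:R + C / j.+1%:R) ->
  exists l, forall k, rnorm (l - u k) <= C / k.+1%:R.
Proof.
move=> uC.
have C0 : 0 <= C by have := le_trans (rnorm_ge0 _) (uC 0%N 0%N); rewrite !divr1; lra.
have small (e : R) : 0 < e -> exists N, forall k, (N <= k)%N -> C / k.+1%:R < e.
  move=> e0; exists (Num.truncn (C / e)) => k Nk.
  rewrite ltr_pdivrMr ?ltr0n// -ltr_pdivrMl// mulrC (lt_le_trans (truncnS_gt _))//.
  by rewrite ler_nat ltnS.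
have : cauchy (u @ \oo).
  apply/cauchy_ballP => _ /gt0_realC[e e0 ->].
  have [N Nk] := small (e / 2) (divr_gt0 e0 (ltr0Sn _ 1)).
  pose U := [set u k | k in [set k | (N <= k)%N]].
  exists (U, U) => /=; first by split; exists N => // k Nk'; exists k.
  case=> _ _ [/= [k kN <-] [j jN <-]]; apply/rnorm_ball.
  by rewrite (le_lt_trans (uC k j))// [e]splitr ltrD ?Nk.
move=> /cauchy_cvg/cvg_ex[l /cvg_rnormP ul]; exists l => k.
rewrite -subr_le0; apply: le0_eps => e e0; rewrite lerBlDr.
have [N Nk] := small (e / 2) (divr_gt0 e0 (ltr0Sn _ 1)).
have [M _ Mu] := ul (e / 2) (divr_gt0 e0 (ltr0Sn _ 1)).
have := Mu (maxn N M) (leq_maxr _ _); have := Nk (maxn N M) (leq_maxl _ _).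
rewrite /= => h1 h2.
have := rnorm_triB l (u (maxn N M)) (u k); have := uC (maxn N M) k.
by move: (C / _) (C / _) h1 => c1 c2; lra.
Qed.

Lemma subr_swap (V : zmodType) (n h a p : V) : n - (h - a) = (p - h) - (p - n - a).
Proof.
rewrite (opprB (p - n)) (opprB p n) [RHS]addrC [RHS]addrA -(addrA a) subrK.
by rewrite opprB addrA [n + a]addrC.
Qed.

Lemma subr_telescope (V : zmodType) (M a q s : V) : M - a - q + (a - s) = M - (s + q).
Proof. by rewrite addrA (addrAC M) subrK opprD addrA addrAC. Qed.

Lemma subr_cross (V : zmodType) (M a q s : V) : M - (q - s) = (M + a - q) - (a - s).
Proof. by rewrite (opprB a) (opprB q) (addrAC M) addrACA subrr addr0 addrA addrAC. Qed.

Lemma subr_parallel (V : zmodType) (M l x y : V) : M - l - (x - y) = (M - x) - (l - y).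
Proof. by rewrite !opprB [y - _]addrC addrACA [- l + _]addrC. Qed.

(** With zero imaginary part the family is [cos t * u]: it stays below [u] because [1 - cos t >= 0],
    and [t = 0] attains [u]. *)
Lemma modulus_self (R : realType) (V : normedModType R[i]) (Q : set V) (u : V) :
  Q 0 -> (forall r : R, 0 <= r -> Q (r%:C *: u)) -> modulus Q u u.
Proof.
move=> Q0 Qr.
have Qu : Q u by have := Qr 1 ler01; rewrite scale1r.
have real_of v : Q v -> cone_real Q v by move=> Qv; exists v => //; exists 0; rewrite ?subr0.
exists u, 0; rewrite scaler0 addr0; split=> //; [exact: real_of|exact: real_of|].
split; first exact: real_of.
  move=> _ [t _ <-]; rewrite scaler0 addr0 /cone_le.
  have -> : u - (cos t)%:C *: u = (1 - cos t)%:C *: u.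
    by rewrite rmorphB scalerBl scale1r.
  by apply: Qr; rewrite subr_ge0 cos_le1.
by move=> n _; apply; exists 0 => //; rewrite cos0 scale1r scaler0 addr0.
Qed.

Lemma ler_dist_min (R : realDomainType) (a b c d : R) :
  `|Num.min `|a| `|b| - Num.min `|c| `|d| | <= `|a - c| + `|b - d|.
Proof.
have := ler_dist_dist a c; have := ler_dist_dist b d.
move: `|a| `|b| `|c| `|d| `|a - c| `|b - d| => {}a {}b {}c {}d x y.
rewrite !ler_norml; have [?|?] := leP a b; have [?|?] := leP c d; lra.
Qed.

Section Disjointness.
Context {R : realType} {K : topologicalType} {X : completeNormedModType R[i]}.
Variable m : (K -> R[i]^o) -> blin X X.
Hypothesis hm : banach_module m.
Implicit Types (f g : K -> R[i]^o) (p r h : K -> R) (x y w : X).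
Local Notation ma := (real_act m).
Local Notation A := (module_algebra m).
Local Notation P := (module_pos m).
Local Notation Q := (cyclic_pos (module_pos m)).

Lemma cyclic_posP w u : Q w u <-> forall e : R, 0 < e ->
  exists p, [/\ continuous p, forall t, 0 <= p t & rnorm (u - ma p w) < e].
Proof.
split=> [/closure_rnormP Qu e e0|Qu].
  have [_ [_ [f [cf f0] <-] <-] uf] := Qu e e0.
  exists (fun t => complex.Re (f t)); split; first by cont.
    by move=> t; exact: ge0_Re.
  rewrite (_ : ma _ = m f)//; congr (m _); apply/funext => t.
  by rewrite [RHS]ge0_real.
apply/closure_rnormP => e e0; have [p [cp p0 up]] := Qu e e0.
exists (ma p w) => //; exists (ma p) => //; exists (fun t => (p t)%:C) => //.
by split=> [|t]; [cont|rewrite ler0c].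
Qed.

Lemma cyclic_pos_real_act w p : continuous p -> (forall t, 0 <= p t) -> Q w (ma p w).
Proof. by move=> cp p0; apply/cyclic_posP => e e0; exists p; rewrite subrr rnorm0. Qed.

Lemma cyclic_pos0 w : Q w 0.
Proof. by rewrite -(real_act0 hm w); apply: cyclic_pos_real_act => //; cont. Qed.

Lemma cyclic_posZ w u (a : R) : 0 <= a -> Q w u -> Q w (a%:C *: u).
Proof.
move=> a0 /cyclic_posP Qu; apply/cyclic_posP => e e0.
have a1 : 0 < a + 1 by lra.
have [p [cp p0 up]] := Qu (e / (a + 1)) (divr_gt0 e0 a1).
exists (fun t => a * p t); split; [cont|by move=> t; rewrite mulr_ge0|].
rewrite (real_actZ hm _ _ cp) -scalerBr rnormZr//.
rewrite (le_lt_trans (ler_wpM2l a0 (ltW up)))// mulrCA gtr_pMr// ltr_pdivrMr//; lra.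
Qed.

(** If [u] is near [p w] and [- u] near [r w], then [(p + r) w] is near 0 and dominates [p w], since
    [0 <= p <= p + r]. *)
Lemma cyclic_pos_antisym w u : Q w u -> Q w (- u) -> u = 0.
Proof.
move=> /cyclic_posP Qu /cyclic_posP QNu; apply: rnorm_eq0_eps => e e0.
have e3 : 0 < e / 3 by rewrite divr_gt0.
have [p [cp p0 up]] := Qu _ e3; have [r [cr r0 ur]] := QNu _ e3.
have : rnorm (ma p w) <= rnorm (ma (fun t => p t + r t) w).
  apply: real_act_mono => //; first by cont.
  by move=> t; rewrite !ger0_norm ?addr_ge0// lerDl.
rewrite (real_actD hm _ cp cr) => pr.
have := rnormD (ma p w - u) (ma r w + u); rewrite addrACA addNr addr0.
have -> : rnorm (ma r w + u) = rnorm (- u - ma r w) by rewrite -rnormN opprD addrC.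
rewrite (rnormB _ u).
by have := ler_rnormB u (ma p w); lra.
Qed.

Lemma cone_real_approx w u : cone_real (Q w) u -> forall e : R, 0 < e ->
  exists2 p, continuous p & rnorm (u - ma p w) < e.
Proof.
move=> [u1 /cyclic_posP Qu1 [u2 /cyclic_posP Qu2 <-]] e e0.
have e2 : 0 < e / 2 by rewrite divr_gt0.
have [p [cp p0 up]] := Qu1 _ e2; have [r [cr r0 ur]] := Qu2 _ e2.
exists (fun t => p t - r t); first by cont.
rewrite (real_actB hm _ cp cr).
have -> : u1 - u2 - (ma p w - ma r w) = (u1 - ma p w) - (u2 - ma r w).
  by rewrite !opprB [ma r w - _]addrC addrACA [- u2 + _]addrC.
by have := rnormD (u1 - ma p w) (- (u2 - ma r w)); rewrite rnormN; lra.
Qed.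

Lemma cone_real_pos w u : Q w u -> cone_real (Q w) u.
Proof. by move=> Qu; exists u => //; exists 0; [exact: cyclic_pos0|rewrite subr0]. Qed.

Lemma modulus_pos w u : Q w u -> modulus (Q w) u u.
Proof.
by move=> Qu; apply: modulus_self => [|r r0]; [exact: cyclic_pos0|exact: cyclic_posZ].
Qed.

(** Truncating a steep multiple, [h = min 1 (k p)], approximates the indicator of [p > 0]. It kills
    [r y], and [(1 - h) p <= 1 / k]; [k] is chosen to make [|x| / k < e]. *)
Lemma approx_component p r x y (e : R) : 0 < e ->
  continuous p -> continuous r -> (forall t, 0 <= p t) -> (forall t, p t * r t = 0) ->
  exists h : K -> R, [/\ continuous h, forall t, 0 <= h t, forall t, p t = 0 -> h t = 0 &
    rnorm (ma p x - ma h (ma p x + ma r y)) < e].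
Proof.
move=> e0 cp cr p0 pr0.
pose k := (rnorm x + 1) / e.
have k0 : 0 < k by rewrite divr_gt0// ltr_wpDl ?rnorm_ge0.
pose h t := Num.min 1 (k * p t).
have ch : continuous h by rewrite /h; cont.
exists h; split=> //.
- by move=> t; rewrite /h le_min ler01 mulr_ge0// ltW.
- by move=> t; rewrite /h => ->; rewrite mulr0 min_r.
have -> : ma h (ma p x + ma r y) = ma (fun t => h t * p t) x.
  rewrite blinD -(real_actM hm _ ch cp) -(real_actM hm _ ch cr) [X in _ + X](_ : _ = 0) ?addr0//.
  rewrite (_ : (fun t => _) = (fun=> 0)) ?(real_act0 hm)//; apply/funext => t.
  have /eqP := pr0 t; rewrite mulf_eq0 => /orP[/eqP pt0|/eqP ->]; last by rewrite mulr0.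
  by rewrite /h pt0 mulr0 min_r// mul0r.
rewrite -(real_actB hm); [|cont..].
apply: (@le_lt_trans _ _ (k^-1 * rnorm x)).
  apply: (act_le hm); [cont|by rewrite invr_ge0 ltW|move=> t].
  rewrite nc_real /h.
  have [kp|kp] := leP 1 (k * p t); first by rewrite mul1r subrr normr0 invr_ge0 ltW.
  rewrite ger0_norm; last first.
    by rewrite -{1}[p t]mul1r -mulrBl mulr_ge0// subr_ge0 ltW.
  rewrite -[k^-1]mulr1 ler_pdivlMl//.
  by have := sqr_ge0 (k * p t - 1 / 2); lra.
rewrite /k invf_div mulrAC ltr_pdivrMr ?ltr_wpDl ?rnorm_ge0//.
by rewrite ltr_pM2l// ltrDl.
Qed.

(** The point is that a common lower bound [n] of the two vectors is at most 0. They are near [h w]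
    and [k w], where at each point [h] or [k] vanishes, and [n] is near both [(h - a) w] and
    [(k - b) w] with [a, b >= 0]. So [n] is near [min (h - a) (k - b) w], and this minimum is
    nowhere positive. *)
Lemma disjoint_real_act p r x y : continuous p -> continuous r ->
  (forall t, 0 <= p t) -> (forall t, 0 <= r t) -> (forall t, p t * r t = 0) ->
  disjoint_elts A P (ma p x) (ma r y).
Proof.
move=> cp cr p0 r0 pr0; rewrite /disjoint_elts.
set w := ma p x + ma r y.
have rp0 t : r t * p t = 0 by rewrite mulrC.
have hp (e : R) : 0 < e -> exists h : K -> R, [/\ continuous h, forall t, 0 <= h t,
    forall t, p t = 0 -> h t = 0 & rnorm (ma p x - ma h w) < e].
  by move=> e0; exact: approx_component.
have hr (e : R) : 0 < e -> exists h : K -> R, [/\ continuous h, forall t, 0 <= h t,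
    forall t, r t = 0 -> h t = 0 & rnorm (ma r y - ma h w) < e].
  by move=> e0; rewrite /w addrC; exact: approx_component.
have Qp : Q w (ma p x).
  by apply/cyclic_posP => e /hp[h [ch h0 _ wh]]; exists h.
have Qr : Q w (ma r y).
  by apply/cyclic_posP => e /hr[h [ch h0 _ wh]]; exists h.
have PA : P `<=` A by move=> _ [f [cf _] <-]; exists f.
have QA u : Q w u -> cyclic A w u.
  by apply: closure_subset => _ [f /PA Af <-]; exists f.
split; [exact: QA|exact: QA|].
exists (ma p x), (ma r y); split; [exact: modulus_pos|exact: modulus_pos|].
split; first exact/cone_real_pos/cyclic_pos0.
  by move=> _ [->|->]; rewrite /cone_le subr0.
move=> n _ nlb; rewrite /cone_le sub0r.
have /cyclic_posP np := nlb _ (or_introl erefl).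
have /cyclic_posP nr := nlb _ (or_intror erefl).
apply/cyclic_posP => e e0; have e6 : 0 < e / 6 by rewrite divr_gt0.
have [h [ch h0 hp0 wh]] := hp _ e6; have [k [ck k0 kr0 wk]] := hr _ e6.
have [a [ca a0 na]] := np _ e6; have [b [cb b0 nb]] := nr _ e6.
pose c t := h t - a t; pose d t := k t - b t.
have cc : continuous c by rewrite /c; cont.
have cd : continuous d by rewrite /d; cont.
exists (fun t => - Num.min (c t) (d t)); split; first by cont.
  move=> t; rewrite oppr_ge0 ge_min /c /d.
  have /eqP := pr0 t; rewrite mulf_eq0 => /orP[/eqP/hp0->|/eqP/kr0->].
    by rewrite sub0r oppr_le0 a0.
  by rewrite sub0r oppr_le0 b0 orbT.
have near_n u q1 q2 : continuous q1 -> continuous q2 ->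
    rnorm (u - ma q1 w) < e / 6 -> rnorm (u - n - ma q2 w) < e / 6 ->
    rnorm (n - ma (fun t => q1 t - q2 t) w) < e / 3.
  move=> c1 c2 u1 u2; rewrite (real_actB hm _ c1 c2) (subr_swap _ _ _ u).
  by have := rnormD (u - ma q1 w) (- (u - n - ma q2 w)); rewrite rnormN; lra.
have nc : rnorm (n - ma c w) < e / 3 by exact: near_n wh na.
have nd : rnorm (n - ma d w) < e / 3 by exact: near_n wk nb.
have mN : ma (fun t => - Num.min (c t) (d t)) w = - ma (fun t => Num.min (c t) (d t)) w.
  rewrite -scaleN1r -(rmorphN1 (real_complex R)) -(real_actZ hm); [|cont].
  by congr (Defs.blin_val (real_act m _) w); apply/funext => t; rewrite mulN1r.
rewrite mN opprK addrC -opprB rnormN.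
have := rnorm_triB n (ma c w) (ma (fun t => Num.min (c t) (d t)) w).
rewrite -(real_actB hm); [|cont..].
have : rnorm (ma (fun t => c t - Num.min (c t) (d t)) w) <= rnorm (ma (fun t => c t - d t) w).
  apply: (real_act_mono hm); [cont|cont|move=> t].
  by have [_|_] := leP (c t) (d t); rewrite ?subrr ?normr0 ?normr_ge0.
rewrite (real_actB hm _ cc cd).
have := rnorm_triB (ma c w) n (ma d w); rewrite (rnormB _ n); lra.
Qed.

(** The vectors [min |pk| |rk| w] converge to some [l], in effect the infimum of [|a|] and [|c|]. It
    lies below [M] and [N], so [l <= 0], and [l >= 0] by construction; the estimate follows because
    the minimum is 1-Lipschitz in each argument. *)
Lemma disjoint_lower_bound w a c M N p r :
  cone_real (Q w) a -> cone_real (Q w) c ->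
  Q w (M - a) -> Q w (M + a) -> Q w (N - c) -> Q w (N + c) ->
  cone_inf (Q w) [set M; N] 0 -> continuous p -> continuous r ->
  rnorm (ma (fun t => Num.min `|p t| `|r t|) w) <= rnorm (a - ma p w) + rnorm (c - ma r w).
Proof.
move=> /cone_real_approx ra /cone_real_approx rc Ma Na Mc Nc [_ _ inf0] cp cr.
have inv0 k : 0 < k.+1%:R^-1 :> R by rewrite invr_gt0 ltr0n.
have [pk /all_and2[cpk apk]] := choice (fun k =>
  let: ex_intro2 p cp ap := ra _ (inv0 k) in ex_intro _ p (conj cp ap)).
have [rk /all_and2[crk ark]] := choice (fun k =>
  let: ex_intro2 p cp ap := rc _ (inv0 k) in ex_intro _ p (conj cp ap)).
pose mn (p1 r1 : K -> R) t := Num.min `|p1 t| `|r1 t|.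
have cmn p1 r1 : continuous p1 -> continuous r1 -> continuous (mn p1 r1).
  by move=> c1 c2; rewrite /mn; cont.
have mn0 p1 r1 t : 0 <= mn p1 r1 t by rewrite /mn le_min !normr_ge0.
have mnB p1 r1 p2 r2 : continuous p1 -> continuous r1 -> continuous p2 -> continuous r2 ->
    rnorm (ma (mn p1 r1) w - ma (mn p2 r2) w) <=
    rnorm (ma p1 w - ma p2 w) + rnorm (ma r1 w - ma r2 w).
  move=> c1 d1 c2 d2; have e1 := cmn _ _ c1 d1; have e2 := cmn _ _ c2 d2.
  rewrite -(real_actB hm _ e1 e2) -(real_actB hm _ c1 c2) -(real_actB hm _ d1 d2).
  apply: (real_act_le_add hm); [cont|cont|cont|move=> t].
  exact: ler_dist_min.
have [|l lk] := @complete_seq _ _ (fun k => ma (mn (pk k) (rk k)) w) 2.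
  move=> k j; apply: (le_trans (mnB _ _ _ _ (cpk k) (crk k) (cpk j) (crk j))).
  have := rnorm_triB (ma (pk k) w) a (ma (pk j) w).
  have := rnorm_triB (ma (rk k) w) c (ma (rk j) w).
  rewrite (rnormB _ a) (rnormB _ c).
  have := apk k; have := apk j; have := ark k; have := ark j.
  by move: (k.+1%:R^-1) (j.+1%:R^-1) => vk vj; lra.
have small (e : R) : 0 < e -> exists k, k.+1%:R^-1 < e.
  move=> e0; exists (Num.truncn e^-1).
  by rewrite invf_plt ?posrE ?ltr0n// truncnS_gt.
have Ql : Q w l.
  apply/cyclic_posP => e e0; have [k ke] := small (e / 2) (divr_gt0 e0 (ltr0Sn _ 1)).
  exists (mn (pk k) (rk k)); split; [exact: cmn|exact: mn0|].
  by rewrite (le_lt_trans (lk k))//; move: (k.+1%:R^-1) ke => v; lra.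
have lower M' a' (sk : nat -> K -> R) : Q w (M' - a') -> Q w (M' + a') ->
   (forall k, continuous (sk k)) -> (forall k, rnorm (a' - ma (sk k) w) < k.+1%:R^-1) ->
   (forall k t, mn (pk k) (rk k) t <= `|sk k t|) -> Q w (M' - l).
  move=> /cyclic_posP Q1 /cyclic_posP Q2 csk ask sle.
  apply/cyclic_posP => e e0; have e9 : 0 < e / 9 by rewrite divr_gt0.
  have [k ke] := small _ e9.
  have [q1 [c1 q10 M1]] := Q1 _ e9; have [q2 [c2 q20 M2]] := Q2 _ e9.
  have cs := csk k; have cm := cmn _ _ (cpk k) (crk k).
  (* Both [u w] and [v w] approximate [M'], hence so does [max u v] applied to [w]; and
     [max u v >= |sk|] because [q1, q2 >= 0]. *)
  pose u t := sk k t + q1 t; pose v t := q2 t - sk k t.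
  have cu : continuous u by rewrite /u; cont.
  have cv : continuous v by rewrite /v; cont.
  exists (fun t => Num.max (u t) (v t) - mn (pk k) (rk k) t); split; first by cont.
    move=> t; rewrite subr_ge0 (le_trans (sle k t))// /u /v.
    have := q10 t; have := q20 t.
    by have [?|?] := leP (sk k t + q1 t) (q2 t - sk k t); rewrite ler_norml; lra.
  have Mu : rnorm (M' - ma u w) < 2 * (e / 9).
    rewrite /u (real_actD hm _ cs c1).
    have := rnormD (M' - a' - ma q1 w) (a' - ma (sk k) w).
    rewrite (subr_telescope M' a').
    have := ask k; move: (k.+1%:R^-1) ke => v1; lra.
  have Mv : rnorm (M' - ma v w) < 2 * (e / 9).
    rewrite /v (real_actB hm _ c2 cs) (subr_cross M' a').
    have := rnormD (M' + a' - ma q2 w) (- (a' - ma (sk k) w)); rewrite rnormN.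
    have := ask k; move: (k.+1%:R^-1) ke => v1; lra.
  rewrite (real_actB hm); [|cont..].
  rewrite subr_parallel.
  have := rnormD (M' - ma (fun t => Num.max (u t) (v t)) w)
    (- (l - ma (mn (pk k) (rk k)) w)); rewrite rnormN.
  have := rnorm_triB M' (ma u w) (ma (fun t => Num.max (u t) (v t)) w).
  rewrite -(real_actB hm _ cu); [|cont].
  have : rnorm (ma (fun t => u t - Num.max (u t) (v t)) w) <=
      rnorm (ma (fun t => u t - v t) w).
    apply: (real_act_mono hm); [cont|cont|move=> t].
    by have [_|_] := leP (u t) (v t); rewrite ?subrr ?normr0 ?normr_ge0.
  rewrite (real_actB hm _ cu cv).
  have := rnorm_triB (ma u w) M' (ma v w); rewrite (rnormB _ M').
  by have := lk k; move: (k.+1%:R^-1) ke => v1; lra.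
have l0 : l = 0.
  apply: (@cyclic_pos_antisym w) => //; have := inf0 l (cone_real_pos Ql).
  rewrite /cone_le sub0r; apply => _ [->|->].
    by apply: (lower M a pk) => // k t; rewrite /mn ge_min lexx.
  by apply: (lower N c rk) => // k t; rewrite /mn ge_min lexx orbT.
rewrite -subr_le0; apply: le0_eps => e e0.
have [k ke] := small (e / 4) (divr_gt0 e0 (ltr0Sn _ 3)).
have := mnB _ _ _ _ cp cr (cpk k) (crk k).
have := ler_rnormB (ma (mn p r) w) (ma (mn (pk k) (rk k)) w).
have := lk k; rewrite l0 sub0r rnormN.
have := rnorm_triB (ma p w) a (ma (pk k) w).
have := rnorm_triB (ma r w) c (ma (rk k) w).
rewrite (rnormB _ a) (rnormB _ c).
have := apk k; have := ark k; rewrite /mn.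
by move: (k.+1%:R^-1) ke => v; lra.
Qed.

End Disjointness.

Lemma ler_minDl (R : realDomainType) (a b x : R) : 0 <= a -> 0 <= b -> 0 <= x ->
  Num.min (a + b) x <= Num.min a x + Num.min b x.
Proof.
move=> a0 b0 x0; rewrite ge_min.
by have [?|?] := leP a x; have [?|?] := leP b x; apply/orP;
  [left|right|right|right]; lra.
Qed.

Lemma ler_minDr (R : realDomainType) (a b x : R) : 0 <= a -> 0 <= b -> 0 <= x ->
  Num.min x (a + b) <= Num.min x a + Num.min x b.
Proof. by move=> *; rewrite !(minC x) ler_minDl. Qed.

Section DisjointApprox.
Context {R : realType} {K : topologicalType} {X : completeNormedModType R[i]}.
Variable m : (K -> R[i]^o) -> blin X X.
Hypothesis hm : banach_module m.
Implicit Types (f g : K -> R[i]^o) (p r h : K -> R) (x y w : X).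
Local Notation ma := (real_act m).
Local Notation A := (module_algebra m).
Local Notation P := (module_pos m).
Local Notation Q := (cyclic_pos (module_pos m)).

(** Only the angles [0], [pi], [pi / 2] and [- pi / 2] of the supremum are used. *)
Lemma modulus_bounds (Q0 : set X) z M : modulus Q0 z M -> exists a b,
  [/\ cone_real Q0 a, cone_real Q0 b, z = a + 'i%C *: b &
     [/\ Q0 (M - a), Q0 (M + a), Q0 (M - b) & Q0 (M + b)]].
Proof.
move=> [a [b [ra rb -> [_ Mub _]]]]; exists a, b; split=> //.
have Q1 t : Q0 (M - ((cos t)%:C *: a + (sin t)%:C *: b)) by apply: Mub; exists t.
split.
- by have := Q1 0; rewrite cos0 sin0 scale1r scale0r addr0.
- by have := Q1 pi; rewrite cospi sinpi scale0r addr0 rmorphN1 scaleN1r opprK.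
- by have := Q1 (pi / 2); rewrite cos_pihalf sin_pihalf scale0r add0r scale1r.
- have := Q1 (- (pi / 2)); rewrite cosN sinN cos_pihalf sin_pihalf scale0r add0r.
  by rewrite rmorphN1 scaleN1r opprK.
Qed.

(** Real and imaginary parts give four real pairs, and [min (a + b) (c + d)] is at most the sum of
    the four minima. Each of these contributes less than [2 e / 9]. *)
Lemma disjoint_approx y1 y2 (e : R) : disjoint_elts A P y1 y2 -> 0 < e ->
  exists f g, [/\ continuous f, continuous g,
    rnorm (y1 - m f (y1 + y2)) < e, rnorm (y2 - m g (y1 + y2)) < e &
    rnorm (ma (fun t => Num.min (nc (f t)) (nc (g t))) (y1 + y2)) < e].
Proof.
set w := y1 + y2 => -[_ _ [M [N [modM modN infMN]]]] e0.
have [a [b [ra rb y1E [Ma Ma' Mb Mb']]]] := modulus_bounds modM.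
have [c [d [rc rd y2E [Nc Nc' Nd Nd']]]] := modulus_bounds modN.
have d0 : 0 < e / 9 by rewrite divr_gt0.
have [pa ca wa] := cone_real_approx hm ra d0; have [pb cb wb] := cone_real_approx hm rb d0.
have [pc cc wc] := cone_real_approx hm rc d0; have [pd cd wd] := cone_real_approx hm rd d0.
have minac := disjoint_lower_bound hm ra rc Ma Ma' Nc Nc' infMN ca cc.
have minad := disjoint_lower_bound hm ra rd Ma Ma' Nd Nd' infMN ca cd.
have minbc := disjoint_lower_bound hm rb rc Mb Mb' Nc Nc' infMN cb cc.
have minbd := disjoint_lower_bound hm rb rd Mb Mb' Nd Nd' infMN cb cd.
have i1 : nc ('i%C : R[i]) = 1 by rewrite /rnorm normc_def/= expr0n/= expr1n add0r sqrtr1.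
pose cpx (p q : K -> R) (t : K) : R[i]^o := (p t)%:C + 'i%C * (q t)%:C.
have ccpx p q : continuous p -> continuous q -> continuous (cpx p q).
  by move=> cp cq; rewrite /cpx; cont.
have cpx_w p q z u v : continuous p -> continuous q -> z = u + 'i%C *: v ->
    rnorm (u - ma p w) < e / 9 -> rnorm (v - ma q w) < e / 9 ->
    rnorm (z - m (cpx p q) w) < e.
  move=> cp cq -> up vq; rewrite (actD hm); [|cont..]; rewrite (actZ hm); [|cont].
  rewrite -/(ma p) -/(ma q) opprD addrACA -scalerBr.
  by rewrite (le_lt_trans (rnormD _ _))// rnormZ i1 mul1r; lra.
have cpxle p q t : nc (cpx p q t) <= `|p t| + `|q t|.
  by rewrite (le_trans (nc_ReIm _))// /cpx/=; simpc.
exists (cpx pa pb), (cpx pc pd); split.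
- exact: ccpx.
- exact: ccpx.
- exact: (cpx_w _ _ _ _ _ _ _ y1E).
- exact: (cpx_w _ _ _ _ _ _ _ y2E).
have cab := ccpx _ _ ca cb; have ccd := ccpx _ _ cc cd.
pose mn (p q : K -> R) t := Num.min `|p t| `|q t|.
have cmn p q : continuous p -> continuous q -> continuous (mn p q).
  by move=> cp cq; rewrite /mn; cont.
have c1 := cmn _ _ ca cc; have c2 := cmn _ _ ca cd.
have c3 := cmn _ _ cb cc; have c4 := cmn _ _ cb cd.
have : rnorm (ma (fun t => Num.min (nc (cpx pa pb t)) (nc (cpx pc pd t))) w) <=
    rnorm (ma (fun t => mn pa pc t + mn pa pd t + mn pb pc t + mn pb pd t) w).
  apply: (real_act_mono hm); [cont|cont|move=> t].
  have := cpxle pa pb t; have := cpxle pc pd t; rewrite /mn.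
  have := rnorm_ge0 (cpx pa pb t : R[i]^o); have := rnorm_ge0 (cpx pc pd t : R[i]^o).
  move: (nc (cpx _ _ _)) (nc (cpx _ _ _)) (normr_ge0 (pa t)) (normr_ge0 (pb t))
    (normr_ge0 (pc t)) (normr_ge0 (pd t)).
  move: `|pa t| `|pb t| `|pc t| `|pd t| => u1 u2 u3 u4 v1 v2 h1 h2 h3 h4 h5 h6 h7 h8.
  rewrite [leLHS]ger0_norm ?le_min ?h5 ?h6// [leRHS]ger0_norm; last first.
    by rewrite !addr_ge0// le_min ?h1 ?h2 ?h3 ?h4.
  apply: (@le_trans _ _ (Num.min (u1 + u2) (u3 + u4))); first exact: le_min2.
  rewrite (le_trans (ler_minDl _ _ _))// ?addr_ge0// -addrA.
  by rewrite lerD// ler_minDr.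
rewrite (real_actD hm); [|cont..]; rewrite (real_actD hm); [|cont..]; rewrite (real_actD hm); [|cont..].
have := rnormD (ma (mn pa pc) w + ma (mn pa pd) w + ma (mn pb pc) w) (ma (mn pb pd) w).
have := rnormD (ma (mn pa pc) w + ma (mn pa pd) w) (ma (mn pb pc) w).
have := rnormD (ma (mn pa pc) w) (ma (mn pa pd) w).
by move: minac minad minbc minbd; rewrite /mn; lra.
Qed.

(** Pointwise [|f - g| <= |f + g| + 2 min |f| |g|], and the last term acts by a small amount. This
    is how disjointness enters the estimates on [T]: signs do not matter. *)
Lemma disjoint_rnormB y1 y2 : disjoint_elts A P y1 y2 ->
  rnorm (y1 - y2) <= rnorm (y1 + y2).
Proof.
move=> dy; rewrite -subr_le0; apply: le0_eps => e e0.
have d0 : 0 < e / 6 by rewrite divr_gt0.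
have [f [g [cf cg yf yg minfg]]] := disjoint_approx dy d0.
set w := y1 + y2 in yf yg minfg *.
pose mn t := Num.min (nc (f t)) (nc (g t)).
have cmn : continuous mn by rewrite /mn; cont.
have : rnorm (m (fun t => f t - g t) w) <= rnorm (m (fun t => f t + g t) w) +
    rnorm (m (fun t => (2 * mn t)%:C) w).
  apply: (act_le_add hm); [cont|cont|cont|move=> t].
  rewrite nc_real ger0_norm; last by rewrite mulr_ge0// le_min !rnorm_ge0.
  have := rnormD (f t - g t + (g t + g t) : R[i]^o) (- (g t + g t)).
  have := rnormD (f t + g t : R[i]^o) (- (g t + g t)).
  have := rnormD (- (f t + g t) : R[i]^o) (f t + f t).
  rewrite !rnormN; have := rnormD (f t : R[i]^o) (f t); have := rnormD (g t : R[i]^o) (g t).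
  rewrite (_ : f t + g t - (g t + g t) = f t - g t); last by ring.
  rewrite (_ : - (f t + g t) + (f t + f t) = f t - g t); last by ring.
  by rewrite /mn; have [?|?] := leP (nc (f t)) (nc (g t)); lra.
rewrite (actB hm _ cf cg) (actD hm _ cf cg) -/(ma _) (real_actZ hm _ _ cmn) rnormZr// -/w.
have := rnormD (y1 - y2 - (m f w - m g w)) (m f w - m g w); rewrite subrK subr_parallel.
have := rnormD (y1 - m f w) (- (y2 - m g w)); rewrite rnormN.
have := ler_rnormB (m f w + m g w) w; rewrite (rnormB _ w).
rewrite {2}/w opprD addrACA.
have := rnormD (y1 - m f w) (y2 - m g w).
by rewrite /mn; lra.
Qed.

End DisjointApprox.

(** * Fibres of the module *)

Section Fibres.
Context {R : realType} {K : topologicalType} {X : completeNormedModType R[i]}.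
Hypotheses (compactK : compact [set: K]) (hausdorffK : hausdorff_space K).
Variable m : (K -> R[i]^o) -> blin X X.
Hypothesis hm : banach_module m.
Implicit Types (f g : K -> R[i]^o) (p r h : K -> R) (x y w z : X) (t s : K).
Local Notation ma := (real_act m).
Local Notation A := (module_algebra m).
Local Notation P := (module_pos m).

Definition bump t p := [/\ continuous p, forall s, 0 <= p s <= 1 & p t = 1].

Lemma ex_bump t (U : set K) : nbhs t U ->
  exists2 p, bump t p & forall s, ~ U s -> p s = 0.
Proof.
move=> tU.
have creg : completely_regular_space K.
  apply: (@normal_completely_regular R); first exact: compact_normal.
  exact/hausdorff_accessible.
have sep : uniform_separator [set t] (~` U°).
  apply: creg; first by apply: open_closedC; exact: open_interior.
  by move=> /(_ tU).
have [f [cf f01 f0 f1]] := (@uniform_separatorP _ R _ _).1 sep.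
exists (fun s => 1 - f s).
  split; first by cont.
    move=> s; have /= := f01 (f s) (ex_intro2 _ _ s I erefl).
    by rewrite in_itv/= => /andP[? ?]; apply/andP; split; lra.
  by rewrite (_ : f t = 0) ?subr0//; apply: f0; exists t.
move=> s Us; rewrite (_ : f s = 1) ?subrr//; apply: f1; exists s => //=.
by move/interior_subset.
Qed.

(** This is the norm of the quotient of [X] by the closed span of all [f u] with [f t = 0]. *)
Definition fibre_norm t z := inf [set rnorm (ma p z) | p in bump t].
Local Notation q := fibre_norm.

Lemma bump_cst1 t : bump t (fun=> 1).
Proof. by split=> //; [cont|move=> s; rewrite ler01 lexx]. Qed.

Lemma bumpM t p r : bump t p -> bump t r -> bump t (fun s => p s * r s).
Proof.
move=> [cp p01 pt] [cr r01 rt]; split; first by cont.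
  move=> s; have /andP[p0 p1] := p01 s; have /andP[r0 r1] := r01 s.
  by rewrite mulr_ge0//= mulr_ile1.
by rewrite pt rt mulr1.
Qed.

Let q_set0 t z : [set rnorm (ma p z) | p in bump t] !=set0.
Proof. by exists (rnorm (ma (fun=> 1) z)); exists (fun=> 1) => //; exact: bump_cst1. Qed.

Let q_lb t z : has_lbound [set rnorm (ma p z) | p in bump t].
Proof. by exists 0 => _ [p _ <-]; exact: rnorm_ge0. Qed.

Lemma fibre_norm_le t p z : bump t p -> q t z <= rnorm (ma p z).
Proof. by move=> tp; apply: (ge_inf (q_lb t z)); exists p. Qed.

Lemma fibre_norm_le_rnorm t z : q t z <= rnorm z.
Proof. by rewrite -[in leRHS](real_act1 hm z); apply: fibre_norm_le; exact: bump_cst1. Qed.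

Lemma fibre_norm_lt t z (e : R) : q t z < e -> exists2 p, bump t p & rnorm (ma p z) < e.
Proof.
move=> qe; have e0 : 0 < e - q t z by rewrite subr_gt0.
have [_ [p tp <-] pe] := inf_adherent e0 (conj (q_set0 t z) (q_lb t z)).
by exists p => //; rewrite addrC subrK in pe.
Qed.

(** A product of bumps is a bump that lowers both norms, so one bump serves both summands. *)
Lemma fibre_seminorm t : seminorm (q t).
Proof.
have qZ a z : a != 0 -> q t (a *: z) <= nc a * q t z.
  move=> a0; have na0 : 0 < nc a by rewrite rnorm_gt0.
  rewrite -ler_pdivrMl//; apply: lb_le_inf => // _ [p tp <-].
  by rewrite ler_pdivrMl// (le_trans (fibre_norm_le _ tp))// blinZ rnormZ.
have q0 z : 0 <= q t z by apply: lb_le_inf => // _ [p _ <-]; exact: rnorm_ge0.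
split=> [x y|a z].
  rewrite -lerBlDr; apply: lb_le_inf => // _ [p tp <-].
  rewrite lerBlDr -lerBlDl; apply: lb_le_inf => // _ [r tr <-].
  rewrite lerBlDl (le_trans (fibre_norm_le _ (bumpM tp tr)))//.
  case: (tp) (tr) => cp p01 _ [cr r01 _].
  rewrite blinD (le_trans (rnormD _ _))// lerD//.
    rewrite (_ : (fun s => p s * r s) = (fun s => r s * p s)); last first.
      by apply/funext => s; rewrite mulrC.
    by rewrite (real_actM hm _ cr cp); apply: (real_act_le1 hm).
  by rewrite (real_actM hm _ cp cr); apply: (real_act_le1 hm).
have [->|a0] := eqVneq a 0.
  rewrite scale0r rnorm0 mul0r; apply/eqP; rewrite eq_le q0 andbT.
  by rewrite (le_trans (fibre_norm_le_rnorm _ _))// rnorm0.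
apply/eqP; rewrite eq_le qZ//=.
have := qZ a^-1 (a *: z); rewrite invr_eq0 => /(_ a0).
by rewrite scalerA mulVf// scale1r ncV ler_pdivlMl// rnorm_gt0.
Qed.
Local Notation sq t := (fibre_seminorm t).

Lemma fibre_norm_vanish t f z : continuous f -> f t = 0 -> q t (m f z) = 0.
Proof.
move=> cf ft; apply/eqP; rewrite eq_le (seminorm_ge0 _ (sq t)) andbT.
apply: le0_eps => e e0; pose d := e / (rnorm z + 1).
have z1 : 0 < rnorm z + 1 by rewrite ltr_wpDl ?rnorm_ge0.
have d0 : 0 < d by rewrite divr_gt0.
have [|p tp pU] := @ex_bump t [set s | nc (f s) < d].
  have /continuous_rnormP/(_ t d d0) := cf; apply: filterS => s.
  by rewrite ft sub0r rnormN.
have [cp p01 _] := tp.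
rewrite (le_trans (fibre_norm_le _ tp))// /real_act -(actM hm); [|cont..].
apply: (@le_trans _ _ (d * rnorm z)).
  apply: (act_le hm); [cont|exact: ltW|move=> s].
  rewrite ncM nc_real; have /andP[p0 p1] := p01 s; rewrite ger0_norm//.
  have [fs|nfs] := pselect (nc (f s) < d).
    by rewrite (le_trans (ler_wpM2r (rnorm_ge0 _) p1))// mul1r ltW.
  by rewrite pU// mul0r ltW.
by rewrite /d mulrAC ler_pdivrMr// ler_pM2l// lerDl.
Qed.

Lemma seminorm_eqB (q0 : X -> R) x y : seminorm q0 -> q0 (x - y) = 0 -> q0 x = q0 y.
Proof.
move=> s0 xy; have := seminorm_leB x y s0; have := seminorm_leB y x s0.
by rewrite (seminormB y _ s0) xy !add0r => yx yx'; apply/eqP; rewrite eq_le yx yx'.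
Qed.

Lemma fibre_normZ t f z : continuous f -> q t (m f z) = nc (f t) * q t z.
Proof.
move=> cf; rewrite -(sq t).2; apply: (seminorm_eqB (sq t)).
have -> : m f z - f t *: z = m (fun s => f s - f t * 1) z.
  rewrite (actB hm); [|cont..]; rewrite (actZ hm); [|cont]; by rewrite (act1 hm).
by rewrite fibre_norm_vanish; [|cont|rewrite mulr1 subrr].
Qed.

(** [q t] turns the action of [f] into multiplication by [|f t|], so the small minimum of [|f|] and
    [|g|] makes the smaller of [q t y1] and [q t y2] small. *)
Lemma fibre_norm_disjoint t y1 y2 : disjoint_elts A P y1 y2 ->
  q t y1 = 0 \/ q t y2 = 0.
Proof.
move=> dy; apply: contrapT => /not_orP[/eqP q1 /eqP q2].
have {}q1 : 0 < q t y1 by rewrite lt_def q1 (seminorm_ge0 _ (sq t)).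
have {}q2 : 0 < q t y2 by rewrite lt_def q2 (seminorm_ge0 _ (sq t)).
pose e := Num.min (q t y1) (q t y2) / 4.
have e0 : 0 < e by rewrite divr_gt0// lt_min q1 q2.
have [f [g [cf cg yf yg mfg]]] := disjoint_approx hm dy e0.
set w := y1 + y2 in yf yg mfg.
have := seminorm_leB y1 (m f w) (sq t); have := fibre_norm_le_rnorm t (y1 - m f w).
have := seminorm_leB y2 (m g w) (sq t); have := fibre_norm_le_rnorm t (y2 - m g w).
have := fibre_norm_le_rnorm t (ma (fun t => Num.min (nc (f t)) (nc (g t))) w).
rewrite /real_act !fibre_normZ; [|cont..].
rewrite nc_real ger0_norm ?le_min ?rnorm_ge0//.
move: yf yg mfg e0; rewrite /e.
by have [?|?] := leP (q t y1) (q t y2); have [?|?] := leP (nc (f t)) (nc (g t)); lra.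
Qed.

Variable T : blin X X.
Hypothesis disjT : disjointness_preserving A P T.

Lemma fibre_norm_image_disjoint t p r x y : continuous p -> continuous r ->
  (forall s, 0 <= p s) -> (forall s, 0 <= r s) -> (forall s, p s * r s = 0) ->
  q t (T (ma p x)) = 0 \/ q t (T (ma r y)) = 0.
Proof. by move=> *; apply/fibre_norm_disjoint/disjT/disjoint_real_act. Qed.

(** The map from [X] to the fibre at [t] induced by [T] factors through the fibre at [s]. This is
    [s = phi t] as a relation, before any choice of [phi]. *)
Definition linked t s := forall f u, continuous f -> f s = 0 -> q t (T (m f u)) = 0.

Lemma fibre_norm_image_le t x : q t (T x) <= opnorm T * rnorm x.
Proof. by rewrite (le_trans (fibre_norm_le_rnorm _ _))// opnormP. Qed.

Lemma linked_bump t s p u : linked t s -> bump s p -> q t (T u) = q t (T (ma p u)).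
Proof.
move=> ts [cp _ ps]; apply: (seminorm_eqB (sq t)); rewrite -blinB.
have -> : u - ma p u = m (fun s => (1 - p s)%:C) u.
  by rewrite -/(ma _) (real_actB hm) ?(real_act1 hm)//; cont.
by apply: ts; [cont|rewrite ps subrr].
Qed.

Lemma linked_fibre_norm t s u : linked t s -> q t (T u) <= opnorm T * q s u.
Proof.
move=> ts; rewrite -subr_le0; apply: le0_eps => e e0.
have o1 : 0 < opnorm T + 1 by rewrite ltr_wpDl ?opnorm_ge0.
have [|p sp pe] := @fibre_norm_lt s u (q s u + e / (opnorm T + 1)).
  by rewrite ltrDl divr_gt0.
rewrite (linked_bump _ ts sp) lerBlDr (le_trans (fibre_norm_image_le _ _))//.
rewrite (le_trans (ler_wpM2l (opnorm_ge0 _) (ltW pe)))// mulrDr addrC lerD2r.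
by rewrite mulrA ler_pdivrMr// mulrC ler_pM2l// lerDl.
Qed.

(* If every point had a neighbourhood on which [q t o T] vanishes, a partition
   of unity would make it vanish; disjointness leaves at most one other point. *)
Lemma ex_linked t u : q t (T u) != 0 -> exists s, linked t s.
Proof.
move=> tu0.
have [s sP] : exists s, forall U, nbhs s U ->
    exists p x, [/\ continuous p, forall s, 0 <= p s, forall s, ~ U s -> p s = 0 &
      q t (T (ma p x)) != 0].
  apply: contrapT => ns; move/eqP: tu0; apply.
  pose small p := (continuous p /\ forall s, 0 <= p s) /\
    forall r x, continuous r -> (forall s, 0 <= r s) -> (forall s, p s = 0 -> r s = 0) ->
      q t (T (ma r x)) = 0.
  have [s _|l lP] := @compact_finite K setT {p | small p} (fun i s => 0 < sval i s) compactK.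
    have [U [sU nU]] : exists U, nbhs s U /\ forall r x, continuous r ->
        (forall s, 0 <= r s) -> (forall s, ~ U s -> r s = 0) -> q t (T (ma r x)) = 0.
      apply: contrapT => nU; apply: ns; exists s => U sU; apply: contrapT => np.
      apply: nU; exists U; split=> // r x cr r0 rU; apply/eqP/negP => /negP rx.
      by apply: np; exists r, x.
    have [p [cp p01 ps] pU] := ex_bump sU.
    have sp : small p.
      split; first by split=> // s'; case/andP: (p01 s').
      by move=> r x cr r0 rp; apply: nU => // s' /pU/rp.
    exists (exist _ p sp) => /=.
    have /cvgrPdist_lt/(_ 1 ltr01) := cp s; apply: filterS => s'.
    by rewrite ps ltr_norml; lra.
  pose sum := fix sum (l : list {p | small p}) s : R :=
    if l is p :: l' then sval p s + sum l' s else 0.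
  have csum l' : continuous (sum l').
    elim: l' => [|[p [[cp p0] sp]] l' IH] /=; cont.
  have sum0 l' s : 0 <= sum l' s.
    by elim: l' => //= p l' IH; rewrite addr_ge0//; case: (svalP p) => -[].
  have sum_gt0 s : 0 < sum l s.
    have [p pl ps] := lP s I; elim: l pl {lP} => //= p' l' IH [->|/IH h].
      exact: ltr_wpDr.
    by rewrite ltr_wpDl//; case: (svalP p') => -[].
  (* With [r] the inverse of [sum l] this is the partition of unity. *)
  have qsum r l' x : continuous r -> (forall s, 0 <= r s) ->
      q t (T (ma (fun s => sum l' s * r s) x)) = 0.
    move=> cr r0; elim: l' => [|p l' IH] /=.
      rewrite (_ : (fun s => _) = fun=> 0); last by apply/funext => s; rewrite mul0r.
      by rewrite (real_act0 hm) blin0 (seminorm0 (sq t)).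
    have [[cp p0] sp] := svalP p; have cl := csum l'.
    rewrite (_ : (fun s => _) = fun s => sval p s * r s + sum l' s * r s); last first.
      by apply/funext => s; rewrite mulrDl.
    rewrite (real_actD hm); [|cont..]; rewrite blinD.
    apply/eqP; rewrite eq_le (seminorm_ge0 _ (sq t)) andbT.
    rewrite (le_trans ((sq t).1 _ _))// IH addr0 sp//; first by cont.
      by move=> s; rewrite mulr_ge0.
    by move=> s ->; rewrite mul0r.
  have cl := csum l.
  have cV : continuous (fun s => (sum l s)^-1).
    by apply: (@cfV _ R) => // s; rewrite gt_eqF.
  have := qsum (fun s => (sum l s)^-1) l u cV; rewrite (_ : (fun s => _) = fun=> 1).
    by rewrite (real_act1 hm); apply => s; rewrite invr_ge0 ltW.
  by apply/funext => s; rewrite mulfV// gt_eqF.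
exists s => f u' cf fs.
(* A function vanishing near [s] is disjoint from some [p] supported near [s] whose image [q t]
   sees, so its own image is not seen. *)
have near0 r x : continuous r -> (forall s, 0 <= r s) ->
    (\forall s' \near s, r s' = 0) -> q t (T (ma r x)) = 0.
  move=> cr r0 /sP[p [y [cp p0 pr /negP py]]].
  case: (@fibre_norm_image_disjoint t p r y x) => // [s'|/eqP//].
  have [->|/pr ->] := pselect (r s' = 0); by rewrite ?mulr0 ?mul0r.
apply/eqP; rewrite eq_le (seminorm_ge0 _ (sq t)) andbT.
apply: le0_eps => e e0; pose c := opnorm T * (rnorm u') + 1.
have c1 : 0 < c by rewrite ltr_wpDl// mulr_ge0 ?rnorm_ge0 ?opnorm_ge0.
have d0 : 0 < e / c by rewrite divr_gt0.
have [|p [cp p01 ps] pU] := @ex_bump s [set s | nc (f s) < e / c].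
  have /continuous_rnormP/(_ s _ d0) := cf; apply: filterS => s'.
  by rewrite fs sub0r rnormN.
(* [b] is 1 near [s], so [near0] handles [1 - b]; and [b] vanishes with [p], that is where [f] is
   not small. *)
pose b s' := Num.min 1 (2 * p s').
have cb : continuous b by rewrite /b; cont.
have b0 s' : 0 <= b s' by rewrite /b le_min ler01 mulr_ge0//; case/andP: (p01 s').
have b1 s' : b s' <= 1 by rewrite /b ge_min lexx.
have -> : m f u' = ma (fun s => 1 - b s) (m f u') + m (fun s => (b s)%:C * f s) u'.
  by rewrite (actM hm); [rewrite (real_actB hm); [rewrite (real_act1 hm) subrK|cont..]|cont..].
rewrite blinD (le_trans ((sq t).1 _ _))// near0 ?add0r; first last.
- have /cvgrPdist_lt/(_ (1/2)) := cp s; rewrite divr_gt0// => /(_ isT).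
  apply: filterS => s'; rewrite ps ltr_norml /b => ?.
  by have [?|?] := leP 1 (2 * p s'); lra.
- by move=> s'; rewrite subr_ge0.
- cont.
rewrite (le_trans (fibre_norm_image_le _ _))//.
apply: (@le_trans _ _ (opnorm T * (e / c * rnorm u'))).
  rewrite ler_wpM2l ?opnorm_ge0//; apply: (act_le hm); [cont|exact: ltW|move=> s'].
  rewrite ncM nc_real ger0_norm//.
  have [fs'|nfs] := pselect (nc (f s') < e / c).
    by rewrite (le_trans (ler_wpM2r (rnorm_ge0 _) (b1 s')))// mul1r ltW.
  by rewrite /b pU// mulr0 min_r// mul0r ltW.
rewrite mulrCA mulrAC ler_pdivrMr// ler_pM2l// /c.
lra.
Qed.

End Fibres.

(** * Images of non-atomic vectors *)

Lemma ex_norming (R : realType) (V : normedModType R[i]) (y : V) :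
  exists H : {linear V -> R[i]^o}, (forall x, nc (H x) <= rnorm x) /\
    H y = (rnorm y)%:C.
Proof.
have [F [lF Fle Fy]] := complex_hahn_banach y (@seminorm_rnorm R V).
pose H : {linear V -> R[i]^o} := HB.pack F (GRing.isLinear.Build _ _ _ _ F lF).
by exists H.
Qed.

(** Two ramps of slope [2 / (b - a)] separated at the midpoint: disjoint, and with sum 1 except
    where [a < g < b]. *)
Lemma ex_ramps (R : realType) (K : topologicalType) (g : K -> R) (a b : R) :
  a < b -> continuous g -> exists h h' : K -> R,
  [/\ continuous h, continuous h', forall s, 0 <= h s & forall s, 0 <= h' s] /\
  [/\ forall s, h s * h' s = 0, forall s, h s + h' s <= 1,
    forall s, g s <= a -> h s = 0 /\ h' s = 1 &
    forall s, b <= g s -> h s = 1 /\ h' s = 0].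
Proof.
move=> ab cg; pose c := (a + b) / 2; pose d := 2 / (b - a).
have d0 : 0 < d by rewrite divr_gt0// subr_gt0.
have dE : d * (b - a) = 2 by rewrite /d divfK// gt_eqF// subr_gt0.
pose h s := Num.max 0 (Num.min 1 (d * (g s - c))).
pose h' s := Num.max 0 (Num.min 1 (d * (c - g s))).
have hneg s : g s <= c -> h s = 0.
  move=> gc; rewrite /h max_l// ge_min; apply/orP; right.
  by rewrite pmulr_rle0// subr_le0.
have h'neg s : c <= g s -> h' s = 0.
  move=> gc; rewrite /h' max_l// ge_min; apply/orP; right.
  by rewrite pmulr_rle0// subr_le0.
have h_le1 s : h s <= 1 by rewrite /h ge_max ler01 ge_min lexx.
have h'_le1 s : h' s <= 1 by rewrite /h' ge_max ler01 ge_min lexx.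
exists h, h'; split; first split.
- by rewrite /h; cont.
- by rewrite /h'; cont.
- by move=> s; rewrite /h le_max lexx.
- by move=> s; rewrite /h' le_max lexx.
split.
- move=> s; have [/hneg->|/ltW/h'neg->] := leP (g s) c; by rewrite ?mul0r ?mulr0.
- by move=> s; have [/hneg->|/ltW/h'neg->] := leP (g s) c; rewrite ?add0r ?addr0.
- move=> s ga; split; first by apply: hneg; rewrite /c; lra.
  rewrite /h' min_l ?max_r//.
  by rewrite -(ler_pM2l d0) in ga; rewrite /c; lra.
- move=> s gb; split; last by apply: h'neg; rewrite /c; lra.
  rewrite /h min_l ?max_r//.
  by rewrite -(ler_pM2l d0) in gb; rewrite /c; lra.
Qed.

Section NonAtomic.
Context {R : realType} {K : topologicalType} {X : completeNormedModType R[i]}.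
Hypotheses (compactK : compact [set: K]) (hausdorffK : hausdorff_space K).
Variable m : (K -> R[i]^o) -> blin X X.
Hypothesis hm : banach_module m.
Variable T : blin X X.
Hypothesis compactT : compact_operator T.
Hypothesis disjT :
  disjointness_preserving (module_algebra m) (module_pos m) T.
Implicit Types (g p r h : K -> R) (x y w z : X) (t s : K).
Local Notation ma := (real_act m).

Lemma image_rnormB p r x y : continuous p -> continuous r ->
  (forall s, 0 <= p s) -> (forall s, 0 <= r s) -> (forall s, p s * r s = 0) ->
  rnorm (T (ma p x) - T (ma r y)) <= rnorm (T (ma p x) + T (ma r y)).
Proof. by move=> *; apply: (disjoint_rnormB hm); apply/disjT/disjoint_real_act. Qed.

Lemma image_rnormD p r x y : continuous p -> continuous r ->
  (forall s, 0 <= p s) -> (forall s, 0 <= r s) -> (forall s, p s * r s = 0) ->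
  rnorm (T (ma p x) + T (ma r y)) <= rnorm (T (ma p x) - T (ma r y)).
Proof.
move=> cp cr p0 r0 pr; have := @image_rnormB p r x (- y) cp cr p0 r0 pr.
by rewrite !blinN opprK.
Qed.

(** Write [2 u = (u + v) + (u - v)]. Images of disjointly supported vectors are thus as far apart as
    they are long, which compactness restricts. *)
Lemma image_rnorm_le p r x y : continuous p -> continuous r ->
  (forall s, 0 <= p s) -> (forall s, 0 <= r s) -> (forall s, p s * r s = 0) ->
  rnorm (T (ma p x)) <= rnorm (T (ma p x) - T (ma r y)).
Proof.
move=> cp cr p0 r0 pr; have := image_rnormD x y cp cr p0 r0 pr.
set u := T _; set v := T (ma r y) => uv.
have := rnormD (u + v) (u - v); rewrite addrACA subrr addr0 -mulr2n -scaler_nat.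
rewrite -(rmorph_nat (real_complex R)) rnormZr//; lra.
Qed.

Variable x0 : X.

(** The losses of the cuts at the levels between [1 / (j + 2)] and [1 / (j + 1)] have disjoint
    supports. If each cut lost more than [e], the images of these losses would be [e]-separated,
    against compactness of [T]. *)
Lemma ex_cut (g : K -> R) (e : R) : continuous g -> (forall s, 0 <= g s <= 1) -> 0 < e ->
  exists h h' : K -> R,
  [/\ continuous h, continuous h', forall s, 0 <= h s & forall s, 0 <= h' s] /\
  [/\ forall s, h s * h' s = 0, forall s, h s + h' s <= 1,
    forall s, g s = 0 -> h s = 0, forall s, g s = 1 -> h' s = 0 &
    forall f : K -> R, continuous f -> (forall s, 0 <= f s <= 1) ->
      rnorm (T (ma (fun s => f s * (1 - h s - h' s)) x0)) <= e].
Proof.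
move=> cg g01 e0; pose b j : R := j.+1%:R^-1.
have b0 j : 0 < b j by rewrite invr_gt0 ltr0n.
have bS j : b j.+1 < b j by rewrite ltf_pV2 ?posrE ?ltr0n// ltr_nat.
have b_anti i j : (i < j)%N -> b j <= b i.+1.
  by move=> ij; rewrite lef_pV2 ?posrE ?ltr0n// ler_nat.
have b1 j : b j <= 1 by rewrite invf_le1 ?ltr0n// ler1n.
have /choice[hh /choice[hh' hP]] := fun j => ex_ramps (bS j) cg.
apply: contrapT => nh.
have ex_f j : exists f : K -> R, [/\ continuous f, forall s, 0 <= f s <= 1 &
    e < rnorm (T (ma (fun s => f s * (1 - hh j s - hh' j s)) x0))].
  have [[ch ch' h0 h0'] [hh0 hh1 ha hb]] := hP j.
  apply: contrapT => nf; apply: nh; exists (hh j), (hh' j); split=> //; split=> //.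
  - by move=> s gs; have [|//] := ha s; rewrite gs ltW.
  - by move=> s gs; have [|//] := hb s; rewrite gs.
  - move=> f cf f01; rewrite leNgt; apply/negP => fe; apply: nf.
    by exists f.
have [f fP] := choice ex_f.
pose r j s := f j s * (1 - hh j s - hh' j s).
have cr j : continuous (r j).
  have [[ch ch' _ _] _] := hP j; have [cf _ _] := fP j.
  by rewrite /r; cont.
have r0 j s : 0 <= r j s.
  have [_ [_ /(_ s) hh1 _ _]] := hP j; have [_ /(_ s)/andP[f0 f1] _] := fP j.
  by rewrite /r mulr_ge0// -addrA -opprD subr_ge0.
have r1 j s : r j s <= 1.
  have [[_ _ /(_ s) h0 /(_ s) h0'] [_ /(_ s) hh1 _ _]] := hP j.
  have [_ /(_ s)/andP[f0 f1] _] := fP j.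
  by rewrite /r mulr_ile1//; lra.
have rE j s : g s <= b j.+1 \/ b j <= g s -> r j s = 0.
  have [_ [_ _ ha hb]] := hP j; rewrite /r.
  by case=> [/ha|/hb] [-> ->]; rewrite ?subr0 ?sub0r ?subrr mulr0.
have rr i j s : (i < j)%N -> r i s * r j s = 0.
  move=> ij; have [gi|gi] := leP (g s) (b i.+1); first by rewrite rE ?mul0r//; left.
  rewrite [X in _ * X]rE ?mulr0//; right.
  by rewrite (le_trans (b_anti _ _ ij))// ltW.
have [|w wP] := compact_operator_cluster compactT (u := fun j => ma (r j) x0) (M := rnorm x0).
  by move=> j; apply: (real_act_le1 hm) => // s; rewrite r0 r1.
have e2 : 0 < e / 2 by rewrite divr_gt0.
have [i _ wi] := wP _ 0%N e2; have [j ij wj] := wP _ i.+1 e2.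
have [_ _ fi] := fP i.
have := image_rnorm_le x0 x0 (cr i) (cr j) (r0 i) (r0 j) (fun s => rr i j s ij).
have := rnorm_triB (T (ma (r i) x0)) w (T (ma (r j) x0)).
by rewrite (rnormB _ w); move: fi; rewrite -/(r i); lra.
Qed.

Fixpoint sumf (l : seq (K -> R)) s : R := if l is p :: l' then p s + sumf l' s else 0.

(** For nonnegative functions, being disjoint from the sum of the tail amounts to pairwise
    disjointness. *)
Fixpoint pieces (e : R) (l : seq (K -> R)) : Prop :=
  if l is p :: l' then
    [/\ continuous p, forall s, 0 <= p s, forall s, p s * sumf l' s = 0,
      rnorm (T (ma p x0)) <= e & pieces e l']
  else True.

Lemma continuous_sumf e l : pieces e l -> continuous (sumf l).
Proof.
by elim: l => [|p l IH] /=; [move=> _; cont|move=> [cp _ _ _ /IH cl]; cont].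
Qed.

Lemma sumf_ge0 e l s : pieces e l -> 0 <= sumf l s.
Proof. by elim: l => //= p l IH [_ p0 _ _ /IH]; exact: addr_ge0. Qed.

(** Each [g] cuts the current remainder [r]: [r h] becomes a new piece, [r h'] remains and dies
    where [g = 1], and the cut loses at most [e]. *)
Lemma ex_pieces (e0 e : R) (gs : seq (K -> R)) : 0 < e ->
  (forall g, List.In g gs -> [/\ continuous g, forall s, 0 <= g s <= 1 &
    forall f : K -> R, continuous f -> (forall s, 0 <= f s <= 1) ->
      (forall s, g s = 0 -> f s = 0) -> rnorm (T (ma f x0)) <= e0]) ->
  exists fs r, [/\ pieces e0 fs, continuous r & forall s, 0 <= r s] /\
    [/\ forall s, r s * sumf fs s = 0, forall s, sumf fs s + r s <= 1,
    forall g s, List.In g gs -> g s = 1 -> r s = 0 &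
    rnorm (T (ma (fun s => 1 - sumf fs s - r s) x0)) <= (size gs)%:R * e].
Proof.
move=> e_gt0; elim: gs => [|g gs IH] gP.
  exists [::], (fun=> 1); split; first by split=> //; cont.
  split=> /= [s|s|//|]; first by rewrite mulr0.
    by rewrite add0r.
  by rewrite (_ : (fun=> _) = fun=> 0) ?(real_act0 hm) ?blin0 ?rnorm0 ?mul0r//;
    apply/funext => s; rewrite subr0 subrr.
have [|fs [r [[pfs cr r0] [rfs fsr rg err]]]] := IH.
  by move=> g' g'gs; apply: gP; right.
have [cg g01 gsmall] := gP g (or_introl erefl).
have [h [h' [[ch ch' h0 h0'] [hh0 hh1 gh gh' herr]]]] := ex_cut cg g01 e_gt0.
have cfs := continuous_sumf pfs; have fs0 s := sumf_ge0 s pfs.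
have r1 s : r s <= 1 by have := fs0 s; have := fsr s; lra.
exists ((fun s => r s * h s) :: fs), (fun s => r s * h' s); split; split.
- split=> //; first by cont.
  + by move=> s; rewrite mulr_ge0.
  + by move=> s; rewrite mulrAC rfs mul0r.
  + apply: gsmall => [|s|s /gh ->]; last by rewrite mulr0.
      by cont.
    rewrite mulr_ge0//= mulr_ile1//.
    by have := hh1 s; have := h0' s; lra.
- by cont.
- by move=> s; rewrite mulr_ge0.
- move=> s /=; rewrite mulrDr mulrACA [h' s * _]mulrC hh0 mulr0 add0r.
  by rewrite mulrAC rfs mul0r.
- move=> s /=; rewrite (le_trans _ (fsr s))// addrAC addrC lerD2l -mulrDr.
  by rewrite ler_piMr.
- move=> g' s [<- /gh' ->|g'gs /(rg _ _ g'gs) ->]; by rewrite ?mulr0 ?mul0r.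
rewrite /= (_ : (fun s => _) = fun s => (1 - sumf fs s - r s) + r s * (1 - h s - h' s)).
  rewrite (real_actD hm); [|cont..]; rewrite blinD (le_trans (rnormD _ _))//.
  by rewrite -natr1 mulrDl mul1r lerD// herr// => s; rewrite r0 r1.
by apply/funext => s; ring.
Qed.

(** Signs are chosen greedily: by the parallelogram law one of [u + y], [u - y] does not exceed the
    sum of the squares. [p] and [r] collect the pieces with sign plus and minus. *)
Lemma balanced_signs e l (Hs : seq {linear X -> R[i]^o}) : pieces e l ->
  exists p r, [/\ continuous p, continuous r, forall s, 0 <= p s & forall s, 0 <= r s] /\
   [/\ forall s, p s * r s = 0, forall s, p s + r s = sumf l s &
    \sum_(H <- Hs) nc (H (T (ma p x0) - T (ma r x0))) ^+ 2 <=
    \sum_(H <- Hs) \sum_(v <- l) nc (H (T (ma v x0))) ^+ 2].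
Proof.
elim: l => [_|v l IH /= [cv v0 vl _ pl]].
  exists (fun=> 0), (fun=> 0); split; split=> //; rewrite ?mulr0 ?addr0//; first by cont.
  by cont.
  rewrite subrr; apply: ler_sum => H _.
  by rewrite linear0 rnorm0 big_nil expr0n.
have [p [r [[cp cr p0 r0] [pr prl le_sum]]]] := IH pl.
set u := T (ma p x0) - T (ma r x0) in le_sum; set y := T (ma v x0).
have vpr s : v s * p s = 0 /\ v s * r s = 0.
  have /eqP := vl s; rewrite mulf_eq0 => /orP[/eqP->|/eqP ls]; first by rewrite !mul0r.
  by have := prl s; have := p0 s; have := r0 s; rewrite ls => *; split;
    [rewrite (_ : p s = 0)|rewrite (_ : r s = 0)]; rewrite ?mulr0//; lra.
have para : \sum_(H <- Hs) nc (H (u + y)) ^+ 2 + \sum_(H <- Hs) nc (H (u - y)) ^+ 2 =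
    2 * (\sum_(H <- Hs) nc (H u) ^+ 2 + \sum_(H <- Hs) nc (H y) ^+ 2).
  rewrite -!big_split/= mulr_sumr; apply: eq_bigr => H _.
  by rewrite linearD linearB !nc_sqr !raddfD !raddfN /=; ring.
have sum_v : \sum_(H <- Hs) \sum_(v' <- v :: l) nc (H (T (ma v' x0))) ^+ 2 =
    \sum_(H <- Hs) nc (H y) ^+ 2 + \sum_(H <- Hs) \sum_(v' <- l) nc (H (T (ma v' x0))) ^+ 2.
  by rewrite -big_split; apply: eq_bigr => H _; rewrite big_cons.
have [le1|lt1] := leP (\sum_(H <- Hs) nc (H (u + y)) ^+ 2)
    (\sum_(H <- Hs) nc (H u) ^+ 2 + \sum_(H <- Hs) nc (H y) ^+ 2).
  exists (fun s => v s + p s), r; split; split=> //; first by cont.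
  - by move=> s; rewrite addr_ge0.
  - by move=> s; rewrite mulrDl pr addr0; case: (vpr s).
  - by move=> s; rewrite -addrA prl.
  rewrite (real_actD hm _ cv cp) blinD -/y -addrA -/u addrC sum_v.
  by rewrite (le_trans le1)// addrC lerD2l.
exists p, (fun s => v s + r s); split; split=> //; first by cont.
- by move=> s; rewrite addr_ge0.
- by move=> s; rewrite mulrDr pr addr0 mulrC; case: (vpr s).
- by move=> s; rewrite addrCA prl.
rewrite (real_actD hm _ cv cr) blinD -/y opprD addrCA -/u addrC sum_v.
by move: lt1 para le_sum; lra.
Qed.

(** The squares are bounded by the largest term times the sum. With suitable phases the sum is
    [H (T (f x0))] for one function [f] of modulus at most 1, since the pieces add up to at most
    1. *)
Lemma sum_pieces_le e l (H : {linear X -> R[i]^o}) : pieces e l -> 0 <= e ->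
  (forall s, sumf l s <= 1) -> (forall y, nc (H y) <= rnorm y) ->
  \sum_(v <- l) nc (H (T (ma v x0))) ^+ 2 <= e * (opnorm T * rnorm x0).
Proof.
move=> pl e0 l1 Hle.
have [f [cf fl Hf]] : exists f, [/\ continuous f, forall s, nc (f s) <= sumf l s &
    H (T (m f x0)) = (\sum_(v <- l) nc (H (T (ma v x0))))%:C].
  elim: l pl {l1} => [_|v l IH /= [cv v0 _ _ /IH[f [cf fl Hf]]]].
    exists (fun=> 0); split; first by cont.
      by move=> s; rewrite rnorm0.
    by rewrite (act0 hm) blin0 linear0 big_nil.
  have [c c1 cH] := ex_phase (H (T (ma v x0))).
  exists (fun s => c * (v s)%:C + f s); split; first by cont.
    move=> s; rewrite (le_trans (rnormD _ _))// lerD// ncM c1 mul1r nc_real ger0_norm//.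
  rewrite (actD hm); [|cont..]; rewrite (actZ hm); [|cont].
  by rewrite blinD blinZ linearD linearZ/= Hf big_cons rmorphD/= -cH.
have sum_le : \sum_(v <- l) nc (H (T (ma v x0))) <= opnorm T * rnorm x0.
  apply: (@le_trans _ _ (nc (H (T (m f x0))))).
    by rewrite Hf nc_real ler_norm.
  rewrite (le_trans (Hle _))// (le_trans (opnormP _ _))// ler_wpM2l ?opnorm_ge0//.
  rewrite -[leRHS]mul1r; apply: (act_le hm) => // s.
  exact: le_trans (fl s) (l1 s).
apply: le_trans (ler_wpM2l e0 sum_le); rewrite mulr_sumr.
elim: l pl {l1 fl Hf sum_le} => [_|v l IH /= [_ _ _ ve /IH le_l]]; first by rewrite !big_nil.
rewrite !big_cons lerD// expr2 ler_wpM2r ?rnorm_ge0//.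
exact: le_trans (Hle _) ve.
Qed.

End NonAtomic.

Lemma sum_le_card (R : realDomainType) (I : Type) (s : seq I) (F : I -> R) (c : R) :
  (forall i, List.In i s -> F i <= c) -> \sum_(i <- s) F i <= (size s)%:R * c.
Proof.
elim: s => [|i s IH] sc; first by rewrite big_nil mul0r.
rewrite big_cons /= -natr1 mulrDl mul1r addrC lerD//; last by apply: sc; left.
by apply: IH => j js; apply: sc; right.
Qed.

Lemma le_sum_In (R : realDomainType) (I : Type) (s : seq I) (F : I -> R) i :
  (forall j, 0 <= F j) -> List.In i s -> F i <= \sum_(j <- s) F j.
Proof.
move=> F0; elim: s => //= j s IH [->|/IH le_i].
  by rewrite big_cons lerDl sumr_ge0.
by rewrite big_cons (le_trans le_i)// lerDr.
Qed.

Section NonAtomicImage.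
Context {R : realType} {K : topologicalType} {X : completeNormedModType R[i]}.
Hypotheses (compactK : compact [set: K]) (hausdorffK : hausdorff_space K).
Variable m : (K -> R[i]^o) -> blin X X.
Hypothesis hm : banach_module m.
Variable T : blin X X.
Hypothesis compactT : compact_operator T.
Hypothesis disjT :
  disjointness_preserving (module_algebra m) (module_pos m) T.
Implicit Types (g p r h : K -> R) (x y w z : X) (t s : K).
Local Notation ma := (real_act m).
Local Notation q := (fibre_norm m).

Lemma ex_small_cover x (e0 : R) : (forall t, q t x = 0) -> 0 < e0 ->
  exists gs : seq (K -> R), (forall s, exists2 g, List.In g gs & g s = 1) /\
  forall g, List.In g gs -> [/\ continuous g, forall s, 0 <= g s <= 1 &
    forall f : K -> R, continuous f -> (forall s, 0 <= f s <= 1) ->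
      (forall s, g s = 0 -> f s = 0) -> rnorm (T (ma f x)) <= e0].
Proof.
move=> qx e00.
pose small g := [/\ continuous g, forall s, 0 <= g s <= 1 &
    forall f : K -> R, continuous f -> (forall s, 0 <= f s <= 1) ->
      (forall s, g s = 0 -> f s = 0) -> rnorm (T (ma f x)) <= e0].
have [t _|l lP] := @compact_finite K setT {g | small g} (fun i s => sval i s = 1) compactK.
  have o1 : 0 < opnorm T + 1 by rewrite ltr_wpDl ?opnorm_ge0.
  have d0 : 0 < e0 / (opnorm T + 1) / 3 by rewrite !divr_gt0.
  have [|p [cp p01 pt] px] := @fibre_norm_lt R K X m t x (e0 / (opnorm T + 1) / 3).
    by rewrite qx.
  (* [g] is 1 where [p >= 2/3], a neighbourhood of [t], and vanishes where [3 p <= 1]. So [f <= 3 p]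
     for every [f] supported by [g]. *)
  pose g s := Num.max 0 (Num.min 1 (3 * p s - 1)).
  have cg : continuous g by rewrite /g; cont.
  have sg : small g.
    split=> // [s|f cf f01 gf].
      by rewrite /g le_max lexx ge_max ler01 ge_min lexx.
    have fp : rnorm (ma f x) <= rnorm (ma (fun s => 3 * p s) x).
      apply: (real_act_mono hm); [cont|cont|move=> s].
      have /andP[f0 f1] := f01 s; have /andP[p0 p1] := p01 s.
      rewrite !ger0_norm ?mulr_ge0//.
      have [p3|p3] := leP (3 * p s) 1; last by rewrite (le_trans f1)// ltW.
      by rewrite gf ?mulr_ge0// /g max_l// ge_min; apply/orP; right; lra.
    rewrite (le_trans (opnormP _ _))//.
    rewrite (le_trans (ler_wpM2l (opnorm_ge0 _) fp))// (real_actZ hm _ _ cp) rnormZr//.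
    have : 3 * rnorm (ma p x) <= e0 / (opnorm T + 1) by lra.
    move=> /(ler_wpM2l (opnorm_ge0 T)) /le_trans; apply.
    by rewrite mulrA ler_pdivrMr// mulrC ler_pM2l// lerDl.
  exists (exist _ g sg) => /=.
  have /cvgrPdist_lt/(_ (1 / 3)) := cp t; rewrite divr_gt0// => /(_ isT).
  apply: filterS => s; rewrite pt ltr_norml => ?.
  by rewrite /g min_l ?max_r//; lra.
exists (List.map (fun i => sval i) l); split.
  by move=> s; have [i il <-] := lP s I; exists (sval i) => //; exact: List.in_map.
by move=> g /List.in_map_iff[i [<- _]]; exact: (svalP i).
Qed.

(* Split [1 = sum f_i] into disjoint pieces with [T (f_i x)] small. Suitable signs
   make [T (sum +-f_i x)] almost vanish on finitely many functionals that norm a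
   net of the image of a ball, although its norm is that of [T x]. *)
Theorem nonatomic_image_eq0 x : (forall t, q t x = 0) -> T x = 0.
Proof.
move=> qx; apply/eqP; rewrite -rnorm_eq0 eq_le rnorm_ge0 andbT leNgt.
(* The estimates below give [rnorm (T x) < 4 e]. *)
apply/negP => Tx0; pose e := rnorm (T x) / 8.
have e_gt0 : 0 < e by rewrite divr_gt0.
have [l lP] := compact_operator_net compactT (rnorm x) e_gt0.
have [hf hfP] := choice (@ex_norming R X).
pose Hs := List.map hf l; pose C := opnorm T * rnorm x.
have C0 : 0 <= C by rewrite mulr_ge0 ?opnorm_ge0 ?rnorm_ge0.
pose D := (size Hs)%:R * C + 1.
have D0 : 0 < D by rewrite ltr_wpDl// mulr_ge0.
(* Makes the total of squares, at most [size Hs * e0 * C], no larger than [e ^+ 2]. The net must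
   come before the cover, since [e0] depends on its size. *)
pose e0 := e ^+ 2 / D.
have e00 : 0 < e0 by rewrite divr_gt0// exprn_gt0.
have [gs [gcov gsP]] := ex_small_cover qx e00.
pose n1 : R := (size gs)%:R + 1.
have n10 : 0 < n1 by rewrite ltr_wpDl.
have e1 : 0 < e / n1 by rewrite divr_gt0.
have [fs [r [[pfs cr r0] [_ fsr rg err]]]] := ex_pieces hm compactT disjT e1 gsP.
(* The sets where some [g] equals 1 exhaust [K], so nothing remains after all cuts. *)
have rE s : r s = 0 by have [g ggs gs1] := gcov s; exact: (rg g).
have cfs := continuous_sumf pfs.
have fs1 s : sumf fs s <= 1 by have := fsr s; rewrite rE addr0.
have errx : rnorm (T x - T (ma (sumf fs) x)) <= e.
  have -> : T x - T (ma (sumf fs) x) = T (ma (fun s => 1 - sumf fs s - r s) x).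
    rewrite -blinB; congr (T _).
    rewrite (_ : (fun s => 1 - _ - _) = (fun s => 1 - sumf fs s)); last first.
      by apply/funext => s; rewrite rE subr0.
    by rewrite (real_actB hm); [rewrite (real_act1 hm)|cont..].
  rewrite (le_trans err)// mulrA ler_pdivrMr// mulrC ler_pM2l// /n1.
  by rewrite lerDl.
have [p [p' [[cp cp' p0 p0'] [pp ps le_sum]]]] := balanced_signs hm Hs pfs.
set u := T (ma p x) - T (ma p' x) in le_sum.
have uD : rnorm (T (ma (sumf fs) x)) <= rnorm u.
  have <- : T (ma p x) + T (ma p' x) = T (ma (sumf fs) x).
    rewrite -blinD -(real_actD hm _ cp cp'); congr (T (_ x)); congr (ma _).
    exact/funext.
  exact: (image_rnormD hm disjT).
have [y yl yu] : exists2 y, List.In y l & rnorm (u - y) < e.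
  rewrite /u -blinB -(real_actB hm _ cp cp'); apply: lP.
  rewrite -[leRHS](congr1 rnorm (real_act1 hm x)); apply: (real_act_mono hm); [cont|cont|move=> s].
  rewrite normr1; have := fs1 s; rewrite -ps; have := p0 s; have := p0' s.
  by rewrite ler_norml; lra.
have [Hle Hy] := hfP y.
have HsP H : List.In H Hs -> forall z, nc (H z) <= rnorm z.
  by move=> /List.in_map_iff[z [<- _]]; have [] := hfP z.
have Hu : nc (hf y u) ^+ 2 <= e ^+ 2.
  have le1 : nc (hf y u) ^+ 2 <= \sum_(H <- Hs) nc (H u) ^+ 2.
    apply: (@le_sum_In _ _ _ (fun H : {linear X -> R[i]^o} => nc (H u) ^+ 2)).
      by move=> H; rewrite sqr_ge0.
    exact: List.in_map.
  have le2 : \sum_(H <- Hs) \sum_(v <- fs) nc (H (T (ma v x))) ^+ 2 <=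
      (size Hs)%:R * (e0 * C).
    apply: sum_le_card => H /HsP Hle'.
    by apply: (sum_pieces_le hm pfs) => //; exact: ltW.
  rewrite (le_trans le1)// (le_trans le_sum)// (le_trans le2)//.
  rewrite mulrCA /e0 mulrAC ler_pdivrMr// ler_pM2l ?exprn_gt0//.
  by rewrite /D lerDl.
have {}Hu : nc (hf y u) <= e.
  by move: Hu; rewrite ler_sqr ?nnegrE ?rnorm_ge0// ltW.
have : rnorm y <= nc (hf y u) + rnorm (u - y).
  rewrite -(ger0_norm (rnorm_ge0 y)) -nc_real -Hy.
  have -> : hf y y = hf y u - hf y (u - y) by rewrite -linearB subKr.
  by rewrite (le_trans (rnormD _ _))// rnormN lerD2l.
have := ler_rnormB u y; have := ler_rnormB (T x) (T (ma (sumf fs) x)).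
have : 8 * e = rnorm (T x) by rewrite /e mulrC divfK.
lra.
Qed.

End NonAtomicImage.

(** * Orbits of points *)

Section Orbits.
Context {R : realType} {K : topologicalType} {X : completeNormedModType R[i]}.
Hypotheses (compactK : compact [set: K]) (hausdorffK : hausdorff_space K).
Variable m : (K -> R[i]^o) -> blin X X.
Hypothesis hm : banach_module m.
Variable T : blin X X.
Hypothesis compactT : compact_operator T.
Hypothesis disjT :
  disjointness_preserving (module_algebra m) (module_pos m) T.
Variables (l : R[i]) (x : X).
Hypotheses (l0 : l != 0) (Tx : T x = l *: x).
Implicit Types (p r h : K -> R) (t s : K).
Local Notation ma := (real_act m).
Local Notation q := (fibre_norm m).
Local Notation sq t := (fibre_seminorm hm t).

Lemma ex_bump_avoid s (f : nat -> K) n : (forall j, (j < n)%N -> f j <> s) ->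
  exists2 p : K -> R, bump s p & forall j, (j < n)%N -> p (f j) = 0.
Proof.
elim: n => [|n IH] fs; first by exists (fun=> 1); [exact: bump_cst1|].
have [|p sp pf] := IH; first by move=> j jn; apply: fs; exact: ltnW.
have [|r sr rf] := @ex_bump R K compactK hausdorffK s (~` [set f n]).
  apply: open_nbhs_nbhs; split; last by move=> /= sf; exact: (fs n).
  by apply: closed_openC; apply: accessible_closed_set1; exact: hausdorff_accessible.
exists (fun t => p t * r t); first exact: bumpM.
move=> j; rewrite ltnS leq_eqVlt => /predU1P[->|/pf ->]; last by rewrite mul0r.
by rewrite rf ?mulr0// => /(_ erefl).
Qed.

Let nl_gt0 : 0 < nc l. Proof. by rewrite rnorm_gt0. Qed.

Let qTx t : q t (T x) = nc l * q t x. Proof. by rewrite Tx (sq t).2. Qed.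

Section Orbit.
Variable tau : nat -> K.
Hypothesis tau_linked : forall n, linked m T (tau n) (tau n.+1).
Hypothesis tau_gt0 : forall n, 0 < q (tau n) x.

(* If the orbit were infinite, [q (tau n) x] would have to grow: otherwise
   localizing [x] at infinitely many [tau n.+1] gives a bounded sequence whose
   image under [T] is separated. *)
Lemma orbit_not_injective : exists i j, (i < j)%N /\ tau i = tau j.
Proof.
apply: contrapT => ninj.
have tau_inj i j : (i < j)%N -> tau i <> tau j by move=> ij eq; apply: ninj; exists i, j.
pose c n := q (tau n) x.
have often N : exists n, (N <= n)%N /\ c n.+1 < 2 * c n.
  apply: contrapT => nN.
  (* Repeated doubling would give [2^k]; linear growth already exceeds [rnorm x], which bounds every
     [c n]. *)
  have grow k : k%:R * c N <= c (N + k)%N.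
    have dbl n : (N <= n)%N -> 2 * c n <= c n.+1.
      by move=> Nn; rewrite leNgt; apply/negP => lt; apply: nN; exists n.
    suff : k.+1%:R * c N <= c (N + k)%N.
      by apply: le_trans; rewrite ler_pM2r ?tau_gt0// ler_nat.
    elim: k => [|k IH]; first by rewrite addn0 mul1r.
    rewrite addnS (le_trans _ (dbl _ (leq_addr _ _)))//.
    rewrite (le_trans _ (ler_wpM2l _ IH))// mulrA ler_pM2r ?tau_gt0//.
    by rewrite -natrM ler_nat mul2n -addnn addSnnS leq_addl.
  have cN := tau_gt0 N; have := grow (Num.truncn (rnorm x / c N)).+1.
  rewrite leNgt => /negP; apply.
  apply: (le_lt_trans (fibre_norm_le_rnorm hm _ _)).
  by rewrite -ltr_pdivrMr// truncnS_gt.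
have [g gP] := choice often.
(* Restarting at the successor makes [sigma] strictly increasing, as [g n >= n] only. *)
pose sigma := fix sigma k := if k is k'.+1 then g (sigma k').+1 else g 0%N.
have sigma_lt i j : (i < j)%N -> (sigma i < sigma j)%N.
  elim: j => // j IH; rewrite ltnS leq_eqVlt /= => /predU1P[->|/IH ij].
    by case: (gP (sigma j).+1).
  by apply: (ltn_trans ij); case: (gP (sigma j).+1).
have sigma_c k : c (sigma k).+1 < 2 * c (sigma k).
  by case: k => [|k] /=; [case: (gP 0%N)|case: (gP (sigma k).+1)].
have ex_p k : exists p : K -> R, [/\ bump (tau (sigma k).+1) p, rnorm (ma p x) <= 2 * c (sigma k) &
    forall j, (j < sigma k)%N -> p (tau j.+1) = 0].
  have [p1 p1b p1x] := fibre_norm_lt (sigma_c k).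
  have [|p2 p2b p20] := @ex_bump_avoid (tau (sigma k).+1) (fun j => tau j.+1) (sigma k).
    by move=> j jk; exact: tau_inj.
  exists (fun s => p2 s * p1 s); split; first exact: bumpM.
    have [c1 _ _] := p1b; have [c2 p201 _] := p2b.
    by rewrite (real_actM hm _ c2 c1) (le_trans _ (ltW p1x))//; apply: (real_act_le1 hm).
  by move=> j /p20 ->; rewrite mul0r.
have [p pP] := choice ex_p.
have cV k : 0 <= (c k)^-1 by rewrite invr_ge0 ltW// tau_gt0.
pose u k := (c (sigma k))^-1%:C *: ma (p k) x.
have u2 k : rnorm (u k) <= 2.
  have [_ le2 _] := pP k; rewrite rnormZr//.
  by rewrite ler_pdivrMl ?tau_gt0// mulrC.
have [w wP] := compact_operator_cluster compactT u2.
have l2 : 0 < nc l / 2 by rewrite divr_gt0.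
have [i _ wi] := wP _ 0%N l2; have [j ij wj] := wP _ i.+1 l2.
(* The seminorm at [tau (sigma i)] gives [T (u i)] the value [|l|] and ignores [T (u j)], because
   [p j] vanishes at the next point of the orbit; yet both images are within [|l| / 2] of [w]. *)
have qi : q (tau (sigma i)) (T (u i)) = nc l.
  have [pb _ _] := pP i; rewrite blinZ (seminormZr _ (sq _) (cV _)).
  rewrite -(linked_bump hm _ (@tau_linked (sigma i)) pb) qTx mulrCA mulVf ?mulr1//.
  by rewrite gt_eqF ?tau_gt0.
have qj : q (tau (sigma i)) (T (u j)) = 0.
  have [[cp _ _] _ pj] := pP j; rewrite blinZ (seminormZr _ (sq _) (cV _)).
  rewrite (@tau_linked (sigma i)) ?mulr0//; first by cont.
  by rewrite pj// sigma_lt.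
have := seminorm_leB (T (u i)) (T (u j)) (sq (tau (sigma i))); rewrite qi qj.
have := fibre_norm_le_rnorm hm (tau (sigma i)) (T (u i) - T (u j)).
have := rnorm_triB (T (u i)) w (T (u j)); rewrite (rnormB _ w).
lra.
Qed.

End Orbit.

Theorem periodic_orbit : x != 0 -> exists tau n,
  [/\ (0 < n)%N, tau n = tau 0%N, q (tau 0%N) x != 0,
    forall k, linked m T (tau k) (tau k.+1) &
    forall i j, (i < j)%N -> (j < n)%N -> tau i <> tau j].
Proof.
move=> x0.
have [t0 qt0] : exists t, q t x != 0.
  apply: contrapT => nq; move/eqP: x0; apply.
  have : T x = 0.
    apply: (nonatomic_image_eq0 compactK hm compactT disjT) => t.
    by apply/eqP/negP => /negP qt; apply: nq; exists t.
  by rewrite Tx => /eqP; rewrite scaler_eq0 (negbTE l0) => /eqP.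
have /choice[phi phiP] : forall t, exists s, q t x != 0 -> linked m T t s.
  move=> t; have [qt|] := boolP (q t x != 0); last by exists t.
  have [|s ts] := @ex_linked R K X compactK hausdorffK m hm T disjT t x.
    by rewrite qTx mulf_neq0// gt_eqF.
  by exists s.
have phi_neq0 t : q t x != 0 -> q (phi t) x != 0.
  move=> qt; apply: contraNneq qt => qp.
  have := linked_fibre_norm hm x (phiP t _); rewrite qTx qp mulr0.
  have := seminorm_ge0 x (sq t); rewrite le_eqVlt => /orP[/eqP<-//|qt].
  by move=> /(_ (lt0r_neq0 qt)); rewrite pmulr_rle0// leNgt qt.
have iter_neq0 n t : q t x != 0 -> q (iter n phi t) x != 0.
  by move=> qt; elim: n => //= n; exact: phi_neq0.
have [||i [j [ij tij]]] := @orbit_not_injective (fun n => iter n phi t0).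
- by move=> n; apply: phiP; exact: iter_neq0.
- by move=> n; rewrite lt_def iter_neq0// seminorm_ge0//; exact: (sq _).
pose t := iter i phi t0.
have qt : q t x != 0 by exact: iter_neq0.
have ex_period : exists n, (0 < n)%N && `[< iter n phi t = t >].
  exists (j - i)%N; rewrite subn_gt0 ij; apply/asboolP.
  by rewrite /t -iterD subnK// ltnW.
have [n /andP[n0 /asboolP nt] nmin] := ex_minnP ex_period.
exists (fun k => iter k phi t), n; split=> //.
  by move=> k; apply: phiP; exact: iter_neq0.
move=> a b ab bn eqab.
(* If the points [a < b] of the orbit coincide, [n - b] further steps lead back to [t], giving the
   smaller period [n - b + a]. *)
have : (n - b + a < n)%N by lia.
rewrite ltnNge => /negP; apply; apply: nmin; apply/andP; split; first by lia.
by apply/asboolP; rewrite iterD eqab -iterD subnK// ltnW.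
Qed.

End Orbits.

(** * Eigenfunctionals carried by a periodic orbit *)

Section PeriodicFunctional.
Context {R : realType} {K : topologicalType} {X : completeNormedModType R[i]}.
Hypotheses (compactK : compact [set: K]) (hausdorffK : hausdorff_space K).
Variable m : (K -> R[i]^o) -> blin X X.
Hypothesis hm : banach_module m.
Variable T : blin X X.
Hypothesis compactT : compact_operator T.
Implicit Types (p r h : K -> R) (t s : K).
Local Notation ma := (real_act m).
Local Notation q := (fibre_norm m).
Local Notation sq t := (fibre_seminorm hm t).

(** A joint eigenvector of the adjoint action, with evaluation at [s] as its character. *)
Definition atom_at (s : K) (F : dual X) :=
  forall (f : K -> R[i]^o) u, continuous f -> F (m f u) = f s * F u.

Lemma dominated_atom_at t (F : dual X) (C : R) :
  (forall u, nc (F u) <= C * q t u) -> atom_at t F.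
Proof.
move=> FC f u cf; apply/eqP; rewrite -subr_eq0 -nc_eq0 eq_le rnorm_ge0 andbT.
have -> : F (m f u) - f t * F u = F (m (fun s => f s - f t * 1) u).
  rewrite (actB hm); [|cont..]; rewrite (actZ hm); [|cont]; rewrite (act1 hm).
  by rewrite blinB blinZ.
rewrite (le_trans (FC _))// (fibre_norm_vanish compactK hausdorffK hm); first by rewrite mulr0.
  by cont.
by rewrite mulr1 subrr.
Qed.

Variables (l : R[i]) (x : X) (tau : nat -> K) (n : nat).
Hypotheses (l0 : l != 0) (Tx : T x = l *: x) (n0 : (0 < n)%N).
Hypothesis tau_periodic : tau n = tau 0%N.
Hypothesis tau_linked : forall k, linked m T (tau k) (tau k.+1).
Hypothesis qx : q (tau 0%N) x != 0.

Lemma iter_blinD k : {morph iter k T : u v / u + v}.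
Proof. by elim: k => [//|k IH] u v /=; rewrite IH blinD. Qed.

Lemma iter_blinZ k (a : R[i]) : {morph iter k T : u / a *: u}.
Proof. by elim: k => [//|k IH] u /=; rewrite IH blinZ. Qed.

Lemma iter_blinB k : {morph iter k T : u v / u - v}.
Proof. by elim: k => [//|k IH] u v /=; rewrite IH blinB. Qed.

Lemma iter_opnorm k u : rnorm (iter k T u) <= opnorm T ^+ k * rnorm u.
Proof.
elim: k => [|k IH] /=; first by rewrite mul1r.
by rewrite exprS -mulrA (le_trans (opnormP _ _))// ler_wpM2l ?opnorm_ge0.
Qed.

Lemma iter_fibre_norm k u : q (tau 0%N) (iter k T u) <= opnorm T ^+ k * q (tau k) u.
Proof.
elim: k u => [|k IH] u; first by rewrite mul1r.
rewrite iterSr (le_trans (IH _))// exprSr -mulrA ler_wpM2l ?exprn_ge0 ?opnorm_ge0//.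
exact: linked_fibre_norm.
Qed.

(** [fixed_functional] for [l^-n T^n] and the seminorm at [tau 0]. Its [k]-th image under [T'] is
    dominated by [opnorm T ^+ k] times the seminorm at [tau k], hence an atom there. *)
Lemma ex_periodic_functional : exists F : dual X,
  [/\ F != 0, iter n (adjoint T) F = l ^+ n *: F &
   forall k, atom_at (tau k) (iter k (adjoint T) F)].
Proof.
have ln0 : l ^+ n != 0 by rewrite expf_neq0.
pose S0 u := (l ^+ n)^-1 *: iter n T u.
have lS0 : linear S0.
  move=> a u v; rewrite /S0 iter_blinD iter_blinZ scalerDr !scalerA.
  by rewrite (mulrC a).
pose S : {linear X -> X} := HB.pack S0 (GRing.isLinear.Build _ _ _ _ S0 lS0).
pose q0 := q (tau 0%N); have sq0 : seminorm q0 := sq _.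
pose c := nc (l ^+ n)^-1 * opnorm T ^+ n.
have Sc u : q0 (S u) <= c * q0 u.
  rewrite sq0.2 /c -mulrA ler_wpM2l ?rnorm_ge0//.
  by have := iter_fibre_norm n u; rewrite tau_periodic.
have Scomp (u : nat -> X) (M : R) : (forall k, q0 (u k) <= M) ->
    exists w, forall (e : R) N, 0 < e -> exists2 k, (N <= k)%N & q0 (w - S (u k)) < e.
  move=> uM.
  (* The [u k] are bounded for [q0] only. Multiplying by a bump bounds them in norm and changes them
     by a [q0]-null vector, which [S] preserves. *)
  have ex_p k : exists p : K -> R, bump (tau 0%N) p /\ rnorm (ma p (u k)) <= M + 1.
    have [|p pb pu] := @fibre_norm_lt R K X m (tau 0%N) (u k) (M + 1).
      by rewrite (le_lt_trans (uM k))// ltrDl.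
    by exists p; split=> //; exact: ltW.
  have [p pP] := choice ex_p.
  have [|w wP] := compact_operator_cluster compactT (u := fun k => ma (p k) (u k)) (M := M + 1).
    by move=> k; have [_] := pP k.
  (* Of [T^n], one factor supplies compactness and the other [n - 1] only cost the constant [d];
     here [0 < n] matters. *)
  pose d := nc (l ^+ n)^-1 * opnorm T ^+ n.-1.
  have d0 : 0 <= d by rewrite mulr_ge0 ?rnorm_ge0 ?exprn_ge0 ?opnorm_ge0.
  have d1 : 0 < d + 1 by rewrite ltr_wpDl.
  exists ((l ^+ n)^-1 *: iter n.-1 T w) => e N e0.
  have [|k Nk wk] := wP (e / (d + 1)) N; first by rewrite divr_gt0.
  exists k => //; have [pb _] := pP k; have [cp _ pt] := pb.
  have S0u : q0 (S (ma (p k) (u k)) - S (u k)) = 0.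
    apply/eqP; rewrite -linearB eq_le (seminorm_ge0 _ sq0) andbT (le_trans (Sc _))//.
    have -> : ma (p k) (u k) - u k = m (fun s => (p k s - 1)%:C) (u k).
      by rewrite -/(ma _) (real_actB hm) ?(real_act1 hm)//; cont.
    rewrite /q0 (fibre_norm_vanish compactK hausdorffK hm) ?mulr0//; first by cont.
    by rewrite pt subrr.
  have SE v : S v = (l ^+ n)^-1 *: iter n.-1 T (T v).
    by rewrite -iterSr prednK.
  rewrite (le_lt_trans (seminorm_triB _ (S (ma (p k) (u k))) _ sq0))// S0u addr0.
  rewrite SE -scalerBr -iter_blinB sq0.2.
  rewrite (le_lt_trans (ler_wpM2l (rnorm_ge0 _) (fibre_norm_le_rnorm hm _ _)))//.
  rewrite (le_lt_trans (ler_wpM2l (rnorm_ge0 _) (iter_opnorm _ _)))// mulrA -/d.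
  rewrite (le_lt_trans (ler_wpM2l d0 (ltW wk)))// mulrA ltr_pdivrMr// mulrC.
  by rewrite ltr_pM2l// ltrDl.
have Sx : q0 (S x - x) = 0.
  rewrite -[S x]/(_ *: iter n T x) (_ : iter n T x = l ^+ n *: x).
    by rewrite scalerA mulVf// scale1r subrr seminorm0.
  elim: (n) => [|k IH]; first by rewrite scale1r.
  by rewrite iterS IH blinZ Tx scalerA exprSr.
have [F0 [lF0 F0q F0S [v F0v]]] := fixed_functional sq0 Sc Scomp qx Sx.
have [F FE] : exists F : dual X, F =1 F0.
  apply: (bounded_blin (C := 1) lF0) => u; rewrite mul1r.
  exact: le_trans (F0q u) (fibre_norm_le_rnorm hm _ _).
have iterE k u : iter k (adjoint T) F u = F (iter k T u).
  elim: k u => // k IH u; rewrite iterS -[LHS]/(iter k (adjoint T) F (T u)) IH.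
  by rewrite -iterSr.
exists F; split.
- by apply: contraNneq F0v => FF; rewrite -FE FF.
- apply: blin_ext => u; rewrite iterE -[RHS]/(l ^+ n *: F u) !FE.
  rewrite -(F0S u) -[S u]/(_ *: iter n T u) -!FE blinZ scalerA mulfV//.
  by rewrite scale1r.
move=> k; apply: (@dominated_atom_at _ _ (opnorm T ^+ k)) => u.
rewrite iterE FE (le_trans (F0q _))//.
exact: iter_fibre_norm.
Qed.

End PeriodicFunctional.

(** * Atoms of the dual module *)

Section DualCenter.
Context {R : realType} {K : topologicalType} {X : completeNormedModType R[i]}.
Hypotheses (compactK : compact [set: K]) (hausdorffK : hausdorff_space K).
Variable m : (K -> R[i]^o) -> blin X X.
Hypothesis hm : banach_module m.
Implicit Types (p r h : K -> R) (f : K -> R[i]^o) (t s : K) (F G : dual X).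
Local Notation ma := (real_act m).
Local Notation Z := (dual_center m).

Lemma dual_eval_le F y : nc (F y) <= rnorm F * rnorm y.
Proof. exact: (opnormP F y). Qed.

Lemma dualD F G y : (F + G) y = F y + G y. Proof. by []. Qed.
Lemma dualB F G y : (F - G) y = F y - G y. Proof. by []. Qed.
Lemma dualZ (a : R[i]) F y : (a *: F) y = a * F y. Proof. by []. Qed.
Lemma dual0 y : (0 : dual X) y = 0. Proof. by []. Qed.

Lemma dual_ext F G : (forall y, F y = G y) -> F = G.
Proof. by move=> FG; apply: blin_ext. Qed.

Lemma adjoint_center f : continuous f -> Z (adjoint (m f)).
Proof.
move=> cf; apply: subset_closure; exists (adjoint (m f)) => //.
by exists (m f) => //; exists f.
Qed.

Lemma center_closure z F : Z z ->
  closure [set adjoint (m f) F | f in [set f : K -> R[i]^o | continuous f]] (z F).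
Proof.
move=> Zz; apply/closure_rnormP => e e0.
pose B : set {ptws dual X -> dual X} := [set g | rnorm (z F - g F) < e].
have zB : nbhs (z : {ptws dual X -> dual X}) B.
  have zF : nbhs (z F) [set G : dual X | rnorm (z F - G) < e].
    apply/nbhs_ballP; exists e%:C; first by rewrite /= ltcR.
    by move=> G /rnorm_ball.
  exact: (@proj_continuous (dual X) (fun=> dual X) F (z : {ptws dual X -> dual X}) _ zF).
have [_ [[_ [_ [f cf <-] <-] <-] Bf]] := Zz B zB.
by exists (adjoint (m f) F) => //; exists f.
Qed.

(** An expansion whose coefficients are evaluations at fixed vectors is a closed condition. Taking
    [G = 0] covers the one-dimensional case. *)
Lemma closure_expansion (E : set (dual X)) F G x y u :
  (forall w, E w -> forall v, w v = w x * F v + w y * G v) -> closure E u ->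
  u = u x *: F + u y *: G.
Proof.
move=> Ew /closure_rnormP clu; apply: dual_ext => v.
rewrite dualD !dualZ; apply/eqP; rewrite -subr_eq0; apply/eqP.
apply: (@rnorm_eq0_eps R R[i]^o) => e e0.
pose C := rnorm v + rnorm x * nc (F v) + rnorm y * nc (G v) + 1.
have C0 : 0 < C by rewrite ltr_wpDl// !addr_ge0 ?mulr_ge0 ?rnorm_ge0.
have [w wE uw] := clu _ (divr_gt0 e0 C0).
have -> : u v - (u x * F v + u y * G v) =
    (u - w) v - ((u - w) x * F v + (u - w) y * G v).
  by rewrite !dualB (Ew w wE v); ring.
apply: (@le_trans _ _ (rnorm (u - w) * C)); last by rewrite -ler_pdivlMr// ltW.
have le_M (x' : X) (a : R[i]) : nc ((u - w) x' * a) <= rnorm (u - w) * (rnorm x' * nc a).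
  by rewrite ncM mulrA ler_wpM2r ?rnorm_ge0// dual_eval_le.
have := rnormD ((u - w) v : R[i]^o) (- ((u - w) x * F v + (u - w) y * G v)).
have := rnormD ((u - w) x * F v : R[i]^o) ((u - w) y * G v).
have := dual_eval_le (u - w) v; have := le_M x (F v); have := le_M y (G v).
rewrite rnormN /C !mulrDr mulr1; have := rnorm_ge0 (u - w).
lra.
Qed.

Lemma closure_eval_ge0 (E : set (dual X)) x u :
  (forall w, E w -> 0 <= w x) -> closure E u -> 0 <= u x.
Proof.
move=> Ew /closure_rnormP clu.
have approx (e : R) : 0 < e -> exists2 c : R[i], 0 <= c & nc (u x - c) <= e.
  move=> e0; have x1 : 0 < rnorm x + 1 by rewrite ltr_wpDl ?rnorm_ge0.
  have [w wE uw] := clu _ (divr_gt0 e0 x1).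
  exists (w x); first exact: Ew.
  rewrite (le_trans (dual_eval_le (u - w) x))//.
  rewrite (le_trans (ler_wpM2r (rnorm_ge0 _) (ltW uw)))//.
  by rewrite mulrAC ler_pdivrMr// ler_pM2l// lerDl.
rewrite lecE/=; apply/andP; split.
  rewrite -normr_eq0 eq_le normr_ge0 andbT; apply: le0_eps => e /approx[c c0 uc].
  by have := nc_Im (u x - c); rewrite raddfB/= (ger0_Im c0) subr0 => /le_trans; apply.
rewrite -oppr_le0; apply: le0_eps => e /approx[c /ge0_Re c0 uc].
by have := nc_Re (u x - c); rewrite raddfB/= ler_norml => /andP[+ _]; lra.
Qed.

Lemma adjoint_atom s F f : atom_at m s F -> continuous f ->
  adjoint (m f) F = f s *: F.
Proof. by move=> Fs cf; apply: dual_ext => u; exact: Fs. Qed.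

Lemma center_atom s F x z : atom_at m s F -> F x = 1 -> Z z -> z F = z F x *: F.
Proof.
move=> Fs Fx Zz; rewrite {1}(@closure_expansion _ F 0 x x _ _ (@center_closure z F Zz)).
  by rewrite scaler0 addr0.
move=> _ [f cf <-] v; rewrite (adjoint_atom Fs cf).
by rewrite !dualZ dual0 Fx mulr1 mulr0 addr0.
Qed.

Lemma ex_dual_unit F : F != 0 -> exists x, F x = 1.
Proof.
move=> F0; have [x Fx] : exists x, F x != 0.
  apply: contrapT => nF; move/eqP: F0; apply; apply: dual_ext => y.
  by apply/eqP/negP => /negP Fy; apply: nF; exists y.
by exists ((F x)^-1 *: x); rewrite blinZ; exact: mulVf.
Qed.

Lemma atom_at_module_atom s F : F != 0 -> atom_at m s F -> module_atom Z F.
Proof.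
move=> F0 Fs; have [x Fx] := ex_dual_unit F0; exists F; split=> //.
rewrite eqEsubset; split=> [u|_ [c _ <-]]; last first.
  apply: subset_closure; exists (adjoint (m (fun=> c))); last by rewrite (adjoint_atom Fs)//; cont.
  by apply: adjoint_center; cont.
move=> clu; exists (u x) => //.
rewrite {2}(@closure_expansion _ F 0 x x _ _ clu) ?scaler0 ?addr0//.
move=> _ [z Zz <-] v.
by rewrite dual0 mulr0 addr0 -dualZ -(center_atom Fs Fx Zz).
Qed.

(** [z F x] is the scalar by which [z] acts on [F]. This character is what converts positivity in
    the centre into nonnegative coordinates. *)
Lemma atom_character s F x : atom_at m s F -> F x = 1 ->
  character Z (fun z => z F x).
Proof.
move=> Fs Fx; split=> [a z w Zz Zw|z w Zz Zw|].
- by rewrite blinDE blinZE.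
- rewrite -[blin_comp z w F]/(z (w F)).
  by rewrite {1}(center_atom Fs Fx Zw) blinZ dualZ mulrC.
- exact: Fx.
Qed.

(* Were [chi p] not a nonnegative number, [p - chi p] would be invertible in C(K),
   although [chi] kills it. *)
Lemma adjoint_gelfand_pos p : continuous p -> (forall t, 0 <= p t) ->
  gelfand_pos Z (adjoint (ma p)).
Proof.
move=> cp p0; split; first by apply: adjoint_center; cont.
move=> chi [chi_lin chi_mul chi1].
set c := chi _; apply: contrapT => c0.
pose f t : R[i]^o := - c * 1 + (p t)%:C.
have cf : continuous f by rewrite /f; cont.
have f0 t : f t != 0.
  apply/eqP => ft; apply: c0; rewrite (_ : c = (p t)%:C) ?ler0c//.
  by apply/esym/eqP; rewrite -subr_eq0 -ft /f; apply/eqP; ring.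
pose g t : R[i]^o := (f t)^-1.
have cg : continuous g by exact: cfV.
have Z1 : Z (adjoint (m (fun=> 1))) by apply: adjoint_center; cont.
have Zp : Z (adjoint (ma p)) by apply: adjoint_center; cont.
have id_adj : adjoint (m (fun=> 1)) = blin_id (dual X).
  by apply: blin_ext => F; apply: dual_ext => u; rewrite /= (module_one hm).
have chif : chi (adjoint (m f)) = 0.
  have -> : adjoint (m f) = - c *: adjoint (m (fun=> 1)) + adjoint (ma p).
    apply: blin_ext => F; apply: dual_ext => u.
    rewrite -[RHS]/(- c * F (m (fun=> 1) u) + F (ma p u)) -[LHS]/(F (m f u)).
    by rewrite /f (actD hm); [rewrite (actZ hm); [rewrite blinD blinZ|cont]|cont..].
  by rewrite chi_lin// id_adj chi1 mulr1 addNr.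
have := chi_mul _ _ (adjoint_center cf) (adjoint_center cg).
rewrite chif mul0r; have -> : blin_comp (adjoint (m f)) (adjoint (m g)) = blin_id (dual X).
  apply: blin_ext => F; apply: dual_ext => u.
  rewrite -[LHS]/(F (m g (m f u))) -(actM hm _ cg cf).
  rewrite (_ : (fun t => _) = fun=> 1) ?(act1 hm)//.
  by apply/funext => t; rewrite mulVf.
by rewrite chi1 => /eqP; rewrite oner_eq0.
Qed.

(** The positive cone generated by [F + G] is the quadrant of all [a F + b G] with [a, b >= 0],
    where [F] and [G] span the two edges and the infimum is taken coordinatewise. *)
Lemma atoms_disjoint s s' F G : s <> s' -> F != 0 -> G != 0 ->
  atom_at m s F -> atom_at m s' G -> disjoint_elts Z (gelfand_pos Z) F G.
Proof.
move=> ss' F0 G0 Fs Gs.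
have [|p [cp p01 ps] /(_ 0%N isT) ps'] :=
    @ex_bump_avoid R K compactK hausdorffK s (fun=> s') 1.
  by move=> _ _ eqs; apply: ss'.
have [|r [cr r01 rs'] /(_ 0%N isT) rs] :=
    @ex_bump_avoid R K compactK hausdorffK s' (fun=> s) 1.
  by move=> _ _; exact: ss'.
have p0 t : 0 <= p t by case/andP: (p01 t).
have r0 t : 0 <= r t by case/andP: (r01 t).
have Fma h u : continuous h -> F (ma h u) = (h s)%:C * F u.
  by move=> ch; rewrite Fs//; cont.
have Gma h u : continuous h -> G (ma h u) = (h s')%:C * G u.
  by move=> ch; rewrite Gs//; cont.
have [x0 Fx0] := ex_dual_unit F0; have [y0 Gy0] := ex_dual_unit G0.
(* A dual basis: evaluation at [x] and at [y] reads off the coordinates along [F] and [G]. *)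
pose x := ma p x0; pose y := ma r y0.
have Fx : F x = 1 by rewrite /x (Fma _ _ cp) ps Fx0 mulr1.
have Gx : G x = 0 by rewrite /x (Gma _ _ cp) ps' mul0r.
have Fy : F y = 0 by rewrite /y (Fma _ _ cr) rs mul0r.
have Gy : G y = 1 by rewrite /y (Gma _ _ cr) rs' Gy0 mulr1.
have adjE h : continuous h -> adjoint (ma h) (F + G) = (h s)%:C *: F + (h s')%:C *: G.
  by move=> ch; apply: dual_ext => u; rewrite !dualD !dualZ -Fma// -Gma.
set Q := cyclic_pos (gelfand_pos Z) (F + G).
have Qab (a b : R) : 0 <= a -> 0 <= b -> Q (a%:C *: F + b%:C *: G).
  move=> a0 b0; pose h t := a * p t + b * r t.
  have ch : continuous h by rewrite /h; cont.
  have h0 t : 0 <= h t by rewrite addr_ge0 ?mulr_ge0.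
  apply: subset_closure; exists (adjoint (ma h)); first exact: adjoint_gelfand_pos.
  by rewrite adjE// /h ps rs ps' rs' !mulr1 !mulr0 addr0 add0r.
have QF (a : R) : 0 <= a -> Q (a%:C *: F).
  by move=> a0; have := Qab a 0 a0 (lexx 0); rewrite scale0r addr0.
have QG (a : R) : 0 <= a -> Q (a%:C *: G).
  by move=> a0; have := Qab 0 a (lexx 0) a0; rewrite scale0r add0r.
have Q0 : Q 0 by have := QF 0 (lexx 0); rewrite scale0r.
have zE z : gelfand_pos Z z -> z (F + G) = z F x *: F + z G y *: G.
  by move=> [Zz _]; rewrite blinD {1}(center_atom Fs Fx Zz) {1}(center_atom Gs Gy Zz).
have zx z : gelfand_pos Z z -> z (F + G) x = z F x.
  by move=> /zE ->; rewrite dualD !dualZ Fx Gx mulr1 mulr0 addr0.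
have zy z : gelfand_pos Z z -> z (F + G) y = z G y.
  by move=> /zE ->; rewrite dualD !dualZ Fy Gy mulr1 mulr0 add0r.
have Qexp u : Q u -> u = u x *: F + u y *: G.
  apply: closure_expansion => _ [z Pz <-] v.
  by rewrite (zx z Pz) (zy z Pz) {1}(zE z Pz).
have Qx u : Q u -> 0 <= u x.
  apply: closure_eval_ge0 => _ [z Pz <-]; rewrite zx//.
  by case: Pz => _ chi_ge0; exact: (chi_ge0 _ (atom_character Fs Fx)).
have Qy u : Q u -> 0 <= u y.
  apply: closure_eval_ge0 => _ [z Pz <-]; rewrite zy//.
  by case: Pz => _ chi_ge0; exact: (chi_ge0 _ (atom_character Gs Gy)).
split.
- apply: subset_closure; exists (adjoint (ma p)); first by apply: adjoint_center; cont.
  by rewrite adjE// ps ps' scale1r scale0r addr0.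
- apply: subset_closure; exists (adjoint (ma r)); first by apply: adjoint_center; cont.
  by rewrite adjE// rs rs' scale1r scale0r add0r.
exists F, G; split; [exact: modulus_self|exact: modulus_self|].
split.
- by exists 0 => //; exists 0; rewrite ?subr0.
- move=> _ [->|->]; rewrite /cone_le subr0.
    by have := QF 1 ler01; rewrite scale1r.
  by have := QG 1 ler01; rewrite scale1r.
move=> n [n1 Qn1 [n2 Qn2 nE]] nlb; rewrite /cone_le sub0r.
have nexp : n = n x *: F + n y *: G.
  rewrite -nE {1}(Qexp _ Qn1) {1}(Qexp _ Qn2) opprD addrACA -!scalerBl.
  by [].
have ny : 0 <= - n y.
  by have := Qy _ (nlb F (or_introl erefl)); rewrite dualB Fy sub0r.
have nx : 0 <= - n x.
  by have := Qx _ (nlb G (or_intror erefl)); rewrite dualB Gx sub0r.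
rewrite nexp opprD -!scaleNr (ge0_real nx) (ge0_real ny).
by apply: Qab; exact: ge0_Re.
Qed.

End DualCenter.

Theorem corollary3p4 (R : realType) (K : topologicalType)
    (compactK : compact [set: K]) (hausdorffK : hausdorff_space K)
    (X : completeNormedModType R[i])
    (m : (K -> R[i]^o) -> blin X X) (hm : banach_module m)
    (hcenter : banach_center (module_algebra m) = module_algebra m)
    (T : blin X X) (compactT : compact_operator T)
    (disjT : disjointness_preserving (module_algebra m) (module_pos m) T)
    (lambda : R[i]) (hlambda : spectrum T lambda) (lambda0 : lambda != 0) :
  exists (F : dual X) (p : nat),
    [/\ (0 < p)%N,
        module_atom (dual_center m) F,
        iter p (adjoint T) F = lambda ^+ p *: F,
        (forall i, (i < p)%N -> module_atom (dual_center m) (iter i (adjoint T) F)) &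
        (forall i j, (i < p)%N -> (j < p)%N -> i <> j ->
           disjoint_elts (dual_center m) (gelfand_pos (dual_center m))
             (iter i (adjoint T) F) (iter j (adjoint T) F))].
Proof.
have [x x0 Tx] := spectrum_eigenvector compactT hlambda lambda0.
have [tau [n [n0 tau_n qx tau_linked tau_inj]]] :=
  periodic_orbit compactK hausdorffK hm compactT disjT lambda0 Tx x0.
have [F [F0 FT Fatom]] := ex_periodic_functional compactK hausdorffK hm compactT
  lambda0 Tx n0 tau_n tau_linked qx.
have iter0 k : iter k (adjoint T) 0 = 0.
  by elim: k => [//|k IH]; rewrite iterS IH; exact: (blin0 (adjoint T)).
(* A vanishing iterate would propagate to [lambda ^+ n *: F], which is not zero. *)
have FT0 i : (i < n)%N -> iter i (adjoint T) F != 0.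
  move=> i_n; apply: contraNneq F0 => Fi.
  have := FT; rewrite -(subnK (ltnW i_n)) iterD Fi iter0 => /esym/eqP.
  by rewrite scaler_eq0 expf_eq0 (negbTE lambda0) andbF.
exists F, n; split=> //.
- exact: (atom_at_module_atom F0 (Fatom 0%N)).
- by move=> i i_n; exact: (atom_at_module_atom (FT0 i i_n) (Fatom i)).
move=> i j i_n j_n ij; apply: (@atoms_disjoint _ _ _ compactK hausdorffK _ hm (tau i) (tau j));
  [|exact: FT0|exact: FT0|exact: Fatom|exact: Fatom].
have : i != j by apply/eqP.
by rewrite neq_ltn => /orP[ij'|ji]; [exact: tau_inj|apply/nesym/tau_inj].
Qed.
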